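(* Let $M_{n,k,m}=\sum_{\alpha=1}^m\tau_\alpha Y_\alpha Y_\alpha^*$ be the random $n^k\times n^k$ Hermitian matrix defined in the context, with $|\xi_1|=1$. Suppose that for all $q\in\mathbb N$, $$\frac1m\sum_{j=1}^m\tau_j^q\to m_q^{(\tau)},\qquad m\to+\infty,$$ for some numbers $m_q^{(\tau)}\in\mathbb R$. Suppose that $k=k(n)$ is a function of $n$ that tends to infinity as $n\to\infty$, and that $m=m(n)$ tends to infinity with $m/n^k\to c$ for some constant $c\in(0,\infty)$. Then for any fixed integer $p\ge1$, almost surely, $$\lim_{n\to+\infty}\frac1{n^k}\,\mathrm{Tr}\,M_{n,k,m}^p=\sum_{s=1}^p c^s\sum_{\alpha\in\mathcal C_{s,p}^{(1)}}\left(\prod_{t=1}^s m^{(\tau)}_{\deg_t(\alpha)}\right).$$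
   Context: **Matrix model.** Let $\xi_1,\dots,\xi_n$ be i.i.d. complex-valued centered random variables with unit variance (the law of $\xi_1$ does not depend on $n$), and let $\mathbf y=\frac1{\sqrt n}(\xi_1,\dots,\xi_n)\in\mathbb C^n$. Let $\{\mathbf y_\alpha^{(l)}:1\le\alpha\le m,\,1\le l\le k\}$ be i.i.d. copies of $\mathbf y$, and let $Y_\alpha=\mathbf y_\alpha^{(1)}\otimes\cdots\otimes\mathbf y_\alpha^{(k)}$, viewed as an $n^k$-dimensional column vector. Let $(\tau_1,\tau_2,\dots)$ be a fixed sequence of real numbers, and $M_{n,k,m}=\sum_{\alpha=1}^m\tau_\alpha Y_\alpha Y_\alpha^*$, where $^*$ is conjugate transpose. The hypothesis $|\xi_1|=1$ means almost surely. The matrices for different $n$ are defined on a common probability space. **Sequences.** Write $[s]=\{1,\dots,s\}$. A sequence $\alpha=(\alpha_1,\dots,\alpha_p)$ of positive integers is canonical if $\alpha_1=1$ and $\alpha_u\le\max\{\alpha_1,\dots,\alpha_{u-1}\}+1$ for $u\ge2$. $\mathcal C_{s,p}$ is the set of canonical sequences of length $p$ with exactly $s$ distinct values (the set of values is then $[s]$). $\deg_t(\alpha)=\#\{j\in[p]:\alpha_j=t\}$. **Graphs.** For sequences $\alpha=(\alpha_1,\dots,\alpha_p)$ and $i=(i^{(1)},\dots,i^{(p)})$, with the convention $\alpha_{p+1}=\alpha_1$, $g(i,\alpha)$ is the directed bipartite multigraph whose vertices are the distinct values of $\alpha$ (''$\alpha$-vertices'', placed on one line) and the distinct values of $i$ (''$i$-vertices'',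 placed on another line; an $\alpha$-vertex and an $i$-vertex are always different vertices even if they have the same numerical value), with $p$ down edges $\alpha_u\to i^{(u)}$ and $p$ up edges $i^{(u)}\to\alpha_{u+1}$, $1\le u\le p$, counted with multiplicity. Two edges coincide if they join the same two vertices, irrespective of orientation. $g(i,\alpha)$ is a $\Delta_1(p,s;\alpha)$-graph (where $s$ is the number of distinct values of $\alpha$) if each down edge coincides with exactly one up edge and, after gluing each pair of coincident edges and removing orientation, the resulting graph is a tree with $p$ edges and $p+1$ vertices. $\mathcal C_{s,p}^{(1)}$ is the set of $\alpha\in\mathcal C_{s,p}$ for which there exists $i\in\mathcal C_{p+1-s,p}$ such that $g(i,\alpha)$ is a $\Delta_1(p,s;\alpha)$-graph. *)

(* Defs.v *)
From HB Require Import structures.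
From mathcomp Require Export all_boot all_order all_algebra.
From mathcomp Require Export sesquilinear spectral mxtens complex.
From mathcomp Require Export all_classical all_reals all_analysis.
Export Order.TTheory GRing.Theory Num.Theory.
Export numFieldNormedType.Exports.

Set Implicit Arguments.
Unset Strict Implicit.
Unset Printing Implicit Defensive.

Local Open Scope classical_set_scope.
Local Open Scope ring_scope.
Local Open Scope complex_scope.
Local Open Scope sesquilinear_scope.

Section ComplexRandomVariables.
Context {R : realType}.

(* C is identified with R * R, so the Borel sets of C are the sets
   [reim @^-1` B] with B measurable in the product R * R. *)
Definition reim (z : R[i]) : R * R := (complex.Re z, complex.Im z).

Section OneSpace.
Context {d : measure_display} {T : measurableType d} (P : probability T R).

Definition is_crv (X : T -> R[i]) : Prop := measurable_fun setT (reim \o X).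

Definition cintegrable (X : T -> R[i]) : Prop :=
  P.-integrable setT (fun w => (complex.Re (X w))%:E) /\
  P.-integrable setT (fun w => (complex.Im (X w))%:E).

(* Meaningful only when X is [cintegrable]. *)
Definition cexpectation (X : T -> R[i]) : R[i] :=
  fine 'E_P[fun w => complex.Re (X w)] +i* fine 'E_P[fun w => complex.Im (X w)].

Definition cvariance (X : T -> R[i]) : \bar R :=
  'E_P[fun w => (Normc.normc (X w - cexpectation X) ^+ 2)%R].

Definition mutually_independent (I : finType) (X : I -> T -> R[i]) : Prop :=
  forall (J : {set I}) (B : I -> set (R * R)),
    (forall j, j \in J -> measurable (B j)) ->
    P (\bigcap_(j in [set` J]) ((reim \o X j) @^-1` B j)) =
    (\prod_(j in J) P ((reim \o X j) @^-1` B j))%E.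

End OneSpace.

Definition same_law {d1 d2 : measure_display}
    {T1 : measurableType d1} {T2 : measurableType d2}
    (P1 : probability T1 R) (X1 : T1 -> R[i])
    (P2 : probability T2 R) (X2 : T2 -> R[i]) : Prop :=
  forall B : set (R * R), measurable B ->
    P1 ((reim \o X1) @^-1` B) = P2 ((reim \o X2) @^-1` B).

Definition iid_copies {d0 d : measure_display}
    {T0 : measurableType d0} {T : measurableType d}
    (P0 : probability T0 R) (xi : T0 -> R[i])
    (P : probability T R) (I : finType) (X : I -> T -> R[i]) : Prop :=
  [/\ forall j, is_crv (X j),
      forall j, same_law P (X j) P0 xi &
      mutually_independent P X].

End ComplexRandomVariables.

Section MatrixModel.
Context {R : realType}.

(* [tens_vec y] is y 0 (x) y 1 (x) ... (x) y (k - 1); the [castmx] only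
   transports along n * n ^ k = n ^ k.+1. *)
Fixpoint tens_vec (n k : nat) : ('I_k -> 'cV[R[i]]_n) -> 'cV[R[i]]_(n ^ k) :=
  match k with
  | 0%N => fun _ => const_mx 1
  | k'.+1 => fun y =>
      castmx (esym (expnS n k'), muln1 1)
        (y ord0 *t tens_vec (fun l : 'I_k' => y (lift ord0 l)))
  end.

(* x is the m-by-k-by-n array of entries; x a l lists the coordinates of
   sqrt n *: y_a^(l). *)
Definition Yvec (n k m : nat) (x : 'I_m -> 'I_k -> 'I_n -> R[i]) (a : 'I_m) :
    'cV[R[i]]_(n ^ k) :=
  tens_vec (fun l => ((Num.sqrt n%:R)^-1)%:C *: \col_(j < n) x a l j).

(* tau is indexed from 0, like the ordinals a : 'I_m. *)
Definition Mmx (n k m : nat) (tau : nat -> R)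
    (x : 'I_m -> 'I_k -> 'I_n -> R[i]) : 'M[R[i]]_(n ^ k) :=
  \sum_(a < m) (tau a)%:C *: (Yvec x a *m (Yvec x a) ^t*).

End MatrixModel.

Local Close Scope classical_set_scope.

Section Sequences.

Definition canonical (a : seq nat) : Prop :=
  [/\ forall j, (j < size a)%N -> (0 < nth 0 a j)%N,
      nth 0%N a 0 = 1%N &
      forall u, (0 < u < size a)%N ->
        (nth 0 a u <= (\max_(v < u) nth 0 a v).+1)%N].

(* A canonical sequence of length p has all its values in {1, ..., p}, so
   letting the entries range over 'I_p.+1 loses nothing. *)
Definition Cseq (s p : nat) : {set p.-tuple 'I_p.+1} :=
  [set a : p.-tuple 'I_p.+1 |
     `[< canonical (map val a) >] && (size (undup a) == s)].

Definition degree (p : nat) (a : p.-tuple 'I_p.+1) (t : nat) : nat :=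
  #|[set j : 'I_p | tnth a j == t :> nat]|.

End Sequences.

Section Trees.
Variable V : finType.

Definition is_tree (vs : {set V}) (e : rel V) : Prop :=
  [/\ (0 < #|vs|)%N,
      {in vs &, forall x y, connect e x y} &
      forall c : seq V, ucycle e c -> (size c <= 2)%N].

End Trees.

Section BipartiteGraph.
Variables (A I : finType) (p : nat) (a : p.-tuple A) (i : p.-tuple I).

(* An edge is recorded as its pair (alpha-end, i-end), orientation being given
   by the family (down or up) it belongs to; two edges coincide iff these
   pairs are equal. [ordS] is the cyclic successor, so alpha_{p+1} = alpha_1. *)
Definition down_edge (u : 'I_p) : A * I := (tnth a u, tnth i u).
Definition up_edge (u : 'I_p) : A * I := (tnth a (ordS u), tnth i u).

(* The two kinds of vertices are kept apart by the disjoint sum. *)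
Definition vertices : {set A + I} :=
  [set inl x | x in a] :|: [set inr y | y in i].

Definition glued_edges : {set A * I} :=
  [set down_edge u | u : 'I_p] :|: [set up_edge u | u : 'I_p].

Definition glued_adj : rel (A + I) := fun x y =>
  match x, y with
  | inl b, inr j | inr j, inl b => (b, j) \in glued_edges
  | _, _ => false
  end.

Definition is_Delta1 : Prop :=
  [/\ forall u, #|[set v | up_edge v == down_edge u]| = 1%N,
      is_tree vertices glued_adj,
      #|glued_edges| = p &
      #|vertices| = p.+1].

End BipartiteGraph.

Definition Cseq1 (s p : nat) : {set p.-tuple 'I_p.+1} :=
  [set a in Cseq s p |
     [exists i : p.-tuple 'I_p.+1, (i \in Cseq (p.+1 - s) p) &&
        `[< is_Delta1 a i >]]].

(* Main.v *)
Require Import Defs.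
From mathcomp Require Import zify ring lra measurable_realfun.

(** Expanding the trace over words [a] of length [p] in the letters [1 .. m],
    [Tr M^p] is the sum of [prod_u tau_(a_u)] times the cyclic product
    [prod_u <Y_(a_u), Y_(a_(u+1))>] ([trace_expansion]).  An inner product of
    tensor products is a product of [k] inner products, so the expectation of
    the cyclic product is [e(a) ^ k], where [e(a)] is the average over the
    labellings [i] in [[n]^p] of a product over pairs (letter, label) of mixed
    moments [mu (u, v) = E (xi ^ u * conj xi ^ v)], [u] and [v] counting the up
    and down edges of the graph [g(i, a)] at that pair ([cE_cyclic]).  Because
    [|xi| = 1] and [E xi = 0], one has [mu (u, u) = 1] and [mu (u, v) = 0] when
    [|u - v| = 1].

    Since [k] is unbounded, [e(a)] has to be known exactly whenever it
    contributes.  This is the role of the dichotomy [planar_or_thin] for a word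
    with [s] letters.  Erasing a letter equal to its cyclic neighbour, or a
    letter that occurs only once, changes the set of contributing labellings in
    a controlled way.  If these reductions end at a word of length one, the word
    is planar: the contributing labellings are those constant on the blocks of
    one labelling with [p + 1 - s] values, each contributes 1, and
    [n ^ (s - 1) * e(a) = 1] exactly.  Otherwise they end at a word in which
    every letter and every label of a contributing labelling occurs at least
    twice; contributing labellings of [a] then take at most [p - s] values,
    [n ^ (s - 1) * e(a) = O (1 / n)], and the [k]-th power kills the term.
    Planar words are those whose canonical form lies in [Cseq1]
    ([planar_Cseq1], [Cseq1_planar]): a closed walk of [2 p] steps through
    [p + 1] vertices needs [p] distinct edges ([nval_walk]), so it crosses each
    edge of a tree exactly twice.

    Summing the weights over the words with a given canonical form [b] gives
    [m ^ s * prod_t mtau (degree b t)] to first order, non-injective choices of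
    letters being negligible ([block_sum_limit]); with [m / n ^ k] tending to
    [c] this yields the limit of the mean ([mean_close],
    [noncrossing_sum_limit]).

    For almost sure convergence the variance is shown to be
    [O ((D / n) ^ k)], which is summable as soon as [k >= 2] ([variance_le],
    [ae_cvg0]).  Two words without common letter are uncorrelated; two words
    sharing a letter can be spliced there into one closed word of length
    [2 p], to which the bounds above apply ([covariance_le]).

    Independence is a statement on events; [cE_prod_independent] turns it into
    a product formula for bounded complex functions.  As [|xi| = 1] holds only
    almost surely, the entries are first replaced by entries of modulus 1
    everywhere ([unitize]), which changes nothing outside a null set
    ([ae_mod1]). *)

Set Implicit Arguments.
Unset Strict Implicit.
Unset Printing Implicit Defensive.

(** * Closed walks on words and labellings *)

Definition nval (A : eqType) (s : seq A) : nat := size (undup s).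

Lemma eq_nval (A : eqType) (s t : seq A) : s =i t -> nval s = nval t.
Proof. by move=> /perm_undup /perm_size. Qed.

Lemma nval_cons (A : eqType) (x : A) s : nval (x :: s) = (x \notin s) + nval s.
Proof. by rewrite /nval /=; case: (x \in s). Qed.

Lemma nval_rot (A : eqType) n (s : seq A) : nval (rot n s) = nval s.
Proof. by apply: eq_nval => x; rewrite mem_rot. Qed.

Lemma nval_double (A : eqType) (s : seq A) :
  {in s, forall x, 1 < count_mem x s} -> (nval s).*2 <= size s.
Proof.
move=> H; rewrite -(perm_size (perm_count_undup s)) size_flatten /shape -map_comp /nval.
have {H} : {in undup s, forall x, 1 < count_mem x s} by move=> x; rewrite mem_undup; apply: H.
set f := size \o _; have fE x : f x = count_mem x s by rewrite /f /= size_nseq.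
elim: (undup s) => //= x t IH H; rewrite fE doubleS.
rewrite (@leq_add 2) ?H ?mem_head //; apply: IH => y yt.
by apply: H; rewrite inE yt orbT.
Qed.

Lemma zip_rot (A B : Type) k (a : seq A) (i : seq B) :
  size i = size a -> zip (rot k a) (rot k i) = rot k (zip a i).
Proof.
move=> s; rewrite /rot zip_cat ?size_drop ?s //; congr (_ ++ _).
  by elim: k a i s => [|k IH] [|x a] [|y i] //= [s]; apply: IH.
by elim: k a i s => [|k IH] [|x a] [|y i] //= [s]; rewrite IH.
Qed.

Lemma zip_cons (A B : Type) (x : A) (y : B) s t : zip (x :: s) (y :: t) = (x, y) :: zip s t.
Proof. by []. Qed.

Lemma count_mem_cons (A : eqType) (x y : A) s :
  count_mem x (y :: s) = (y == x) + count_mem x s.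
Proof. by []. Qed.

Section Walks.
Variables A J : eqType.
Implicit Types (a : seq A) (i : seq J).

Definition downs a i : seq (A * J) := zip a i.
Definition ups a i : seq (A * J) := zip (rot 1 a) i.

(** Every edge is crossed equally often in both directions; such a labelling
    has moment exactly 1. *)
Definition balanced a i : bool := perm_eq (ups a i) (downs a i).

(** The mixed moments of a centered unimodular variable vanish when the two
    exponents differ by 1, so only these labellings contribute. *)
Definition nolone a i : bool :=
  all (fun e => (count_mem e (ups a i) != (count_mem e (downs a i)).+1) &&
                (count_mem e (downs a i) != (count_mem e (ups a i)).+1))
      (ups a i ++ downs a i).

Lemma noloneP a i :
  reflect (forall e, (count_mem e (ups a i) != (count_mem e (downs a i)).+1) &&
                     (count_mem e (downs a i) != (count_mem e (ups a i)).+1))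
          (nolone a i).
Proof.
apply: (iffP allP) => [H e|H e _]; last exact: H.
case: (boolP (e \in ups a i ++ downs a i)) => [/H //|].
by rewrite mem_cat negb_or => /andP[/count_memPn -> /count_memPn ->].
Qed.

Lemma balanced_nolone a i : balanced a i -> nolone a i.
Proof. by move=> /permP H; apply/noloneP => e; rewrite H; lia. Qed.

Lemma ups_rot k a i : size i = size a -> ups (rot k a) (rot k i) = rot k (ups a i).
Proof. by move=> s; rewrite /ups rot_rot zip_rot // size_rot. Qed.

Lemma balanced_rot k a i : size i = size a -> balanced (rot k a) (rot k i) = balanced a i.
Proof. by move=> s; rewrite /balanced ups_rot // /downs zip_rot // perm_rot perm_sym perm_rot
    perm_sym. Qed.

Lemma nolone_rot k a i : size i = size a -> nolone (rot k a) (rot k i) = nolone a i.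
Proof.
move=> s; have cr e (l : seq (A * J)) : count_mem e (rot k l) = count_mem e l.
  by apply/permP; rewrite perm_rot.
by apply/noloneP/noloneP => H e; have := H e; rewrite ups_rot // /downs zip_rot // !cr.
Qed.

(** A repeated letter makes the walk cross one edge up and down at once; the
    rest of the walk is that of the shorter word, whatever the label [j]. *)
Lemma adjacent_walk (x : A) (j : J) a i :
  downs (x :: x :: a) (j :: i) = (x, j) :: downs (x :: a) i /\
  ups (x :: x :: a) (j :: i) = (x, j) :: ups (x :: a) i.
Proof. by rewrite /ups !rot1_cons. Qed.

(** If the labels before and after an isolated visit of [x] agree, the two
    edges at [x] cancel and erasing the visit leaves a walk on the shorter word. *)
Lemma leaf_walk (y x : A) (j : J) a i :
  perm_eq (downs (y :: x :: a) (j :: j :: i)) ((x, j) :: downs (y :: a) (j :: i)) /\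
  ups (y :: x :: a) (j :: j :: i) = (x, j) :: ups (y :: a) (j :: i).
Proof.
split; last by rewrite /ups !rot1_cons.
by apply/permP => P /=; rewrite addnCA.
Qed.

(** One up and one down crossing of the same edge do not affect the
    differences between up and down counts. *)
Lemma cons_walk (e : A * J) b l a i :
  perm_eq (downs b l) (e :: downs a i) -> perm_eq (ups b l) (e :: ups a i) ->
  (balanced b l = balanced a i) * (nolone b l = nolone a i).
Proof.
move=> Hd Hu; split.
  by rewrite /balanced (permPl Hu) (permPr Hd) perm_cons.
by apply/noloneP/noloneP => H f; have := H f;
  rewrite (permP Hd) (permP Hu) /=; case: (_ == f) => //=; rewrite ?add0n ?add1n ?eqSS.
Qed.

Lemma count_zip_notin (x : A) (j : J) a i : (x \notin a) || (j \notin i) ->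
  count_mem (x, j) (zip a i) = 0.
Proof.
move=> H; apply/count_memPn; apply: contraTN H.
elim: a i => [|y a IH] [|l i] //=; rewrite !inE negb_or !negbK.
case/predU1P => [[-> ->]|/IH]; first by rewrite !eqxx.
by rewrite negb_or !negbK => /andP[-> ->]; rewrite !orbT.
Qed.

(** A letter visited once has a single up edge and a single down edge; they
    must coincide, for otherwise each of them has counts 1 and 0. *)
Lemma nolone_leaf (y x : A) (j1 j2 : J) a i :
  x \notin y :: a -> nolone (y :: x :: a) (j1 :: j2 :: i) -> j1 = j2.
Proof.
move=> xa /noloneP /(_ (x, j1)) /andP[].
have [//|neq] := eqVneq j1 j2.
move: xa; rewrite inE eq_sym => /norP[/negbTE yx xa].
rewrite /ups /downs !rot1_cons rcons_cons !zip_cons !count_mem_cons !xpair_eqE yx eq_refl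
    !(eq_sym j2).
rewrite (negbTE neq) eqxx !count_zip_notin ?xa // mem_rcons inE eq_sym yx (negbTE xa).
by [].
Qed.

End Walks.

Lemma map_balanced (A A' J J' : eqType) (f : A -> A') (h : J -> J') a i :
  balanced a i -> balanced (map f a) (map h i).
Proof.
have mz (s : seq A) (t : seq J) : zip (map f s) (map h t) = [seq (f e.1, h e.2) | e <- zip s t].
  by elim: s t => [|x s IH] [|y t] //=; rewrite IH.
by rewrite /balanced /ups /downs -map_rot !mz => /perm_map->.
Qed.

(** A labelling whose graph is a tree takes [p + 1 - s] values, where [s] is the
    number of letters; here one such labelling governs all the contributing
    ones.  Labels range over [nat] so that a fresh one exists. *)
Definition planar (A : eqType) (a : seq A) (i0 : seq nat) : Prop :=
  [/\ size i0 = size a, nval i0 + nval a = (size a).+1, balanced a i0 &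
      forall (J : eqType) (i : seq J), size i = size a -> nolone a i ->
        exists g : nat -> J, i = map g i0].

(** Contributing labellings miss the number of values of a tree labelling, so
    the contribution of the word is smaller by a factor [n] per tensor factor. *)
Definition thin (A : eqType) (a : seq A) : Prop :=
  forall (J : eqType) (i : seq J), size i = size a -> nolone a i ->
    nval i + nval a <= size a.

Section Dichotomy.
Variable A : eqType.
Implicit Type a : seq A.

Lemma planar_rot k a i0 : planar (rot k a) i0 -> planar a (rotr k i0).
Proof.
move=> [s v b H]; rewrite size_rot in s.
have sr : size (rotr k i0) = size a by rewrite size_rotr.
split=> //.
- by rewrite -(nval_rot k) rotrK -(nval_rot k a) v size_rot.
- by rewrite -(balanced_rot k) // rotrK.
move=> J i si Wi; have [||g Eg] := H J (rot k i); rewrite ?size_rot ?nolone_rot //.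
by exists g; apply: (@rot_inj k); rewrite -map_rot rotrK.
Qed.

Lemma thin_rot k a : thin (rot k a) -> thin a.
Proof.
move=> H J i si Wi; have := H J (rot k i); rewrite !size_rot !nval_rot nolone_rot //.
exact.
Qed.

Lemma planar1 (x : A) : planar [:: x] [:: 0].
Proof.
split=> //; first by rewrite /balanced /ups /downs rot1_cons perm_refl.
by move=> J [|j [|]] // _ _; exists (fun=> j).
Qed.

Lemma planar_adjacent (x : A) a i0 :
  planar (x :: a) i0 -> exists i1, planar (x :: x :: a) i1.
Proof.
move=> [s v b H]; set j := (\max_(l <- i0) l).+1.
have jN : j \notin i0.
  apply/negP => ji; suff : j <= \max_(l <- i0) l by rewrite ltnn.
  by rewrite (leq_bigmax_seq (F := id)).
exists (j :: i0).
have [Ed Eu] := adjacent_walk x j a i0.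
split=> [||| J [|l i] //= [si] W]; first by rewrite /= s.
- by rewrite (nval_cons j) (nval_cons x) jN inE eqxx add1n addSn v.
- by rewrite (@cons_walk _ _ (x, j) _ _ (x :: a) i0) ?Ed ?Eu.
have [Ed' Eu'] := adjacent_walk x l a i.
rewrite (@cons_walk _ _ (x, l) _ _ (x :: a) i) ?Ed' ?Eu' // in W.
have [g ->] := H J i si W.
exists (fun t => if t == j then l else g t); rewrite eqxx; congr (_ :: _).
by apply/eq_in_map => t ti; case: eqP => // tj; rewrite tj (negbTE jN) in ti.
Qed.

Lemma thin_adjacent (x : A) a : thin (x :: a) -> thin (x :: x :: a).
Proof.
move=> H J [|l i] //= [si] W.
have [Ed' Eu'] := adjacent_walk x l a i.
rewrite (@cons_walk _ _ (x, l) _ _ (x :: a) i) ?Ed' ?Eu' // in W.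
have := H J i si W; rewrite (nval_cons l) (nval_cons x (x :: a)) inE eqxx /=.
by case: (l \in i) => /=; lia.
Qed.

Lemma planar_leaf (y x : A) a i0 : x \notin y :: a ->
  planar (y :: a) i0 -> exists i1, planar (y :: x :: a) i1.
Proof.
move=> xa [s v b H]; case: i0 s v b H => // j i0 s v b H.
exists (j :: j :: i0).
have [Ed Eu] := leaf_walk y x j a i0.
have nv : nval (y :: x :: a) = (nval (y :: a)).+1.
  rewrite (@eq_nval _ _ (x :: y :: a)); first by rewrite nval_cons xa.
  by move=> z; rewrite !inE orbCA.
split=> [||| J [|j1 [|j2 i]] //= [si] W]; first by move: s => /= ->.
- by rewrite nv (nval_cons j) mem_head addnS v.
- by rewrite (@cons_walk _ _ (x, j) _ _ (y :: a) (j :: i0)) ?Eu.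
have jj := nolone_leaf xa W; rewrite -{j2}jj in W *.
have [Ed' Eu'] := leaf_walk y x j1 a i.
rewrite (@cons_walk _ _ (x, j1) _ _ (y :: a) (j1 :: i)) ?Eu' // in W.
have [|g [-> ->]] := H J (j1 :: i) _ W; first by rewrite /= si.
by exists g.
Qed.

Lemma thin_leaf (y x : A) a : x \notin y :: a -> thin (y :: a) -> thin (y :: x :: a).
Proof.
move=> xa H J [|j1 [|j2 i]] //= [si] W.
have jj := nolone_leaf xa W; rewrite -{j2}jj in W *.
have [Ed' Eu'] := leaf_walk y x j1 a i.
rewrite (@cons_walk _ _ (x, j1) _ _ (y :: a) (j1 :: i)) ?Eu' // in W.
have := H J (j1 :: i); rewrite /= si => /(_ erefl W).
rewrite (nval_cons j1 (j1 :: i)) mem_head (@eq_nval _ [:: y, x & a] (x :: y :: a)).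
  by rewrite (nval_cons x) xa /=; lia.
by move=> z; rewrite !inE orbCA.
Qed.

(** A label used once, between two different letters, carries one down edge
    and one up edge, and these are distinct. *)
Lemma nolone_repeated (J : eqType) a (i : seq J) : size i = size a ->
  ~~ has (fun e => e.1 == e.2) (zip a (rot 1 a)) -> nolone a i ->
  {in i, forall j, 1 < count_mem j i}.
Proof.
move=> si adj W j ji; rewrite ltnNge; apply/negP => c1.
case: (rot_to ji) => k t Et.
have st : size (rot k a) = (size t).+1 by rewrite size_rot -si -(size_rot k) Et.
move: W; rewrite -(nolone_rot k) // Et.
have jt : j \notin t.
  have : count_mem j (rot k i) <= 1 by rewrite (permP (_ : perm_eq _ i)) // perm_rot.
  by rewrite Et /= eqxx add1n ltnS leqn0 => /eqP/count_memPn.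
have : ~~ has (fun e => e.1 == e.2) (zip (rot k a) (rot 1 (rot k a))).
  by rewrite rot_rot zip_rot ?size_rot // has_rot.
case: (rot k a) st => [|x [|y b]] // [sb]; rewrite rot1_cons /=; first by rewrite eqxx.
rewrite negb_or => /andP[xy _] /noloneP/(_ (x, j))/andP[_].
rewrite /ups /downs !rot1_cons rcons_cons.
by rewrite !zip_cons !count_mem_cons !count_zip_notin ?jt ?orbT // !xpair_eqE !eqxx (eq_sym y x)
    (negbTE xy).
Qed.

(** By induction on the length: equal neighbours and letters that occur once
    are erased, after a rotation that brings them to the front.  A word without
    either has at most half as many letters, and by [nolone_repeated] half as
    many labels, as its length. *)
Lemma planar_or_thin a : 0 < size a -> (exists i0, planar a i0) \/ thin a.
Proof.
have [n] := ubnP (size a); elim: n => // n IH in a *.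
have rotD k (b : seq A) : (exists i0, planar (rot k b) i0) \/ thin (rot k b) ->
    (exists i0, planar b i0) \/ thin b.
  case=> [[i0 H]|H]; [left; exists (rotr k i0); exact: planar_rot|right; exact: thin_rot H].
case: (ltngtP (size a) 1) => [|ga|]; first by case: a.
  move=> sa _; have [adj|adj] := boolP (has (fun e => e.1 == e.2) (zip a (rot 1 a))).
    have [k sk] : exists2 k, k < size a & forall x0, nth x0 a k == nth x0 (rot 1 a) k.
      have x0 : A by case: (a) ga.
      case/hasP: adj => e /(nthP (x0, x0))[k sk <-] E.
      rewrite size_zip size_rot minnn in sk; exists k => // x1.
      move: E; rewrite nth_zip ?size_rot //=.
      by rewrite !(set_nth_default x1 x0) ?size_rot.
    move=> E; apply: (rotD k).
    have sb := size_rot k a.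
    case Eb : (rot k a) sb => [|x [|y b]] sb; [by rewrite -sb in ga|by rewrite -sb in ga|].
    have -> : x = y.
      have := E x; have -> : nth x a k = x.
        by have := nth_cat x (drop k a) (take k a) 0;
        rewrite -/(rot k a) Eb size_drop subn_gt0 sk nth_drop addn0.
      have -> : nth x (rot 1 a) k = y.
        have := nth_cat x (drop k (rot 1 a)) (take k (rot 1 a)) 0.
        by rewrite -/(rot k (rot 1 a)) rot_rot Eb rot1_cons size_drop size_rot subn_gt0 sk
        nth_drop addn0.
      by move/eqP.
    have [||[i0 H]|H] := IH (y :: b); [by rewrite -sb in sa| by []| |].
      by left; apply: planar_adjacent H.
    by right; apply: thin_adjacent.
  have [/hasP[x xa /eqP c1]|single] := boolP (has (fun x => count_mem x a == 1) a).
    case: (rot_to xa) => k t Et.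
    have xt : x \notin t.
      have : count_mem x (rot k a) = 1 by rewrite (permP (_ : perm_eq _ a)) // perm_rot.
      by rewrite Et /= eqxx => -[/count_memPn].
    case/lastP: t => [|b y] in Et xt *; first by rewrite -(size_rot k) Et in ga.
    apply: (rotD k); apply: (rotD (size b).+1).
    rewrite Et -rcons_cons -cats1 -[(size b).+1]/(size (x :: b)) rot_size_cat cat1s.
    have xyb : x \notin y :: b by rewrite -mem_rcons.
    have sb : size (y :: b) < n by rewrite -ltnS; move: sa; rewrite -(size_rot k) Et /= size_rcons.
    have [||[i0 H]|H] := IH (y :: b) => //.
      by left; apply: planar_leaf H.
    by right; apply: thin_leaf.
  (* Irreducible word: all letters and all labels occur at least twice. *)
  right=> J i si W.
  have := nval_double (nolone_repeated si adj W).
  suff : (nval a).*2 <= size a by rewrite si; lia.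
  apply: nval_double => x xa; rewrite ltn_neqAle eq_sym -has_count has_pred1 xa andbT.
  by apply: contraNN single => H; apply/hasP; exists x.
case: a => [|x [|]] // _ _ _; left; exists [:: 0]; exact: planar1.
Qed.

End Dichotomy.

(** * Canonical sequences *)

Section Canonical.

(** Listed in the order of first occurrence, whereas [undup] keeps the last
    occurrence of each value. *)
Definition firsts (A : eqType) (s : seq A) := rev (undup (rev s)).

(** The canonical form of a word, the same for two words exactly when they
    differ by an injective renaming of the letters. *)
Definition canon (A : eqType) (s : seq A) : seq nat :=
  [seq (index x (firsts s)).+1 | x <- s].

Lemma mem_firsts (A : eqType) (s : seq A) : firsts s =i s.
Proof. by move=> x; rewrite mem_rev mem_undup mem_rev. Qed.

Lemma size_firsts (A : eqType) (s : seq A) : size (firsts s) = nval s.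
Proof. by rewrite size_rev; apply: eq_nval => x; rewrite mem_rev. Qed.

Lemma firsts_rcons (A : eqType) (s : seq A) x :
  firsts (rcons s x) = if x \in s then firsts s else rcons (firsts s) x.
Proof. by rewrite /firsts rev_rcons /= mem_rev; case: ifP => //; rewrite rev_cons. Qed.

Lemma size_canon (A : eqType) (s : seq A) : size (canon s) = size s.
Proof. exact: size_map. Qed.

Lemma canon_rcons (A : eqType) (s : seq A) x : canon (rcons s x) =
  rcons (canon s) (if x \in s then (index x (firsts s)).+1 else (nval s).+1).
Proof.
rewrite /canon map_rcons firsts_rcons; case: ifP => // xs.
rewrite -[rcons (firsts s) x]cats1 index_cat mem_firsts xs /= eqxx addn0 size_firsts; congr rcons.
by apply/eq_in_map => y ys; rewrite index_cat mem_firsts ys.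
Qed.

(** A new value always receives the next free rank. *)
Lemma max_canon (A : eqType) (s : seq A) : \max_(y <- canon s) y = nval s.
Proof.
elim/last_ind: s => [|s x IH]; first by rewrite big_nil.
rewrite canon_rcons -cats1 big_cat big_seq1 IH /= (@eq_nval _ (rcons s x) (x :: s)); last first.
  by move=> y; rewrite mem_rcons.
rewrite nval_cons; case: ifP => xs /=; last lia.
by apply/maxn_idPl; rewrite -size_firsts index_mem mem_firsts.
Qed.

Lemma take_canon (A : eqType) u (s : seq A) : take u (canon s) = canon (take u s).
Proof.
elim/last_ind: s => [|s x IH] //; rewrite canon_rcons -!cats1.
case: (leqP u (size s)) => us; first by rewrite !takel_cat ?size_canon.
by rewrite !take_oversize ?size_cat ?size_canon /= ?addn1 // !cats1 canon_rcons.
Qed.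

Lemma max_take (c : seq nat) u : u <= size c -> \max_(v < u) nth 0 c v = \max_(y <- take u c) y.
Proof.
move=> uc; rewrite (big_nth 0) size_takel // big_mkord.
by apply: eq_bigr => v _; rewrite nth_take.
Qed.

Lemma canonical_canon (A : eqType) (s : seq A) : 0 < size s -> canonical (canon s).
Proof.
move=> s0; have x0 : A by case: (s) s0.
split=> [j|| u]; rewrite ?size_canon.
- move=> H; by rewrite (nth_map x0).
- case: s s0 => // x s _; rewrite -[nth _ _ _](nth_take (n0 := 1)) // take_canon.
  by rewrite /= take0 /canon /firsts /= eqxx.
case/andP=> _ us; rewrite max_take ?size_canon ?(ltnW us) // take_canon max_canon.
rewrite -[nth _ _ _](nth_take (n0 := u.+1)) // take_canon (take_nth x0) // canon_rcons.
rewrite nth_rcons size_canon size_takel ?(ltnW us) // ltnn eqxx; case: ifP => // xs.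
by rewrite leqW // -size_firsts index_mem mem_firsts.
Qed.

Lemma canonK (A : eqType) (x0 : A) (s : seq A) :
  map (fun v => nth x0 (firsts s) v.-1) (canon s) = s.
Proof.
rewrite /canon -map_comp -[RHS]map_id; apply/eq_in_map => x xs /=.
by rewrite nth_index // mem_firsts.
Qed.

Lemma index_map_in (A B : eqType) (f : A -> B) (s : seq A) x :
  {in x :: s &, injective f} -> index (f x) (map f s) = index x s.
Proof.
elim: s => //= y s IH inj.
rewrite (inj_in_eq inj) ?inE ?eqxx ?orbT //; case: ifP => // _; rewrite IH //.
by apply: sub_in2 inj => z; rewrite !inE => /orP[->//|->]; rewrite !orbT.
Qed.

Lemma firsts_map (A B : eqType) (f : A -> B) (s : seq A) :
  {in s &, injective f} -> firsts (map f s) = map f (firsts s).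
Proof.
elim/last_ind: s => //= s x IH inj.
have injs : {in s &, injective f}.
  by apply: sub_in2 inj => z zs; rewrite mem_rcons inE zs orbT.
have xs : x \in rcons s x by rewrite mem_rcons mem_head.
have -> : firsts (rcons s x) =
    if x \in s then firsts s else rcons (firsts s) x by exact: firsts_rcons.
rewrite map_rcons firsts_rcons IH //.
have -> : (f x \in map f s) = (x \in s).
  apply/mapP/idP => [[y ys /inj->//]|]; last by exists x.
  by rewrite mem_rcons inE ys orbT.
by case: ifP => //; rewrite map_rcons.
Qed.

Lemma canon_map (A B : eqType) (f : A -> B) (s : seq A) :
  {in s &, injective f} -> canon (map f s) = canon s.
Proof.
move=> inj; rewrite /canon -map_comp firsts_map //; apply/eq_in_map => x xs /=.
rewrite index_map_in //; apply: sub_in2 inj => z; rewrite inE => /orP[/eqP->//|].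
by rewrite mem_firsts.
Qed.

Lemma nval_map (A B : eqType) (f : A -> B) (s : seq A) :
  {in s &, injective f} -> nval (map f s) = nval s.
Proof. by move=> inj; rewrite -!size_firsts firsts_map // size_map. Qed.

Lemma nval_canon (A : eqType) (s : seq A) : nval (canon s) = nval s.
Proof.
apply: nval_map => x y xs ys [/(congr1 (nth x (firsts s)))].
by rewrite !nth_index ?mem_firsts.
Qed.

(** The defining inequality of a canonical sequence forces the values to
    appear for the first time in the order [1, 2, 3 ..]. *)
Lemma firsts_canonical (c : seq nat) : canonical c -> firsts c = iota 1 (nval c).
Proof.
elim/last_ind: c => [[]//|c x IH [pos one step]].
case: c => [|z c] in IH pos one step *.
  by move: one => /= ->.
have Hc : canonical (z :: c).
  split=> [j jc|| u /andP[u0 uc]].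
  - by have := pos j; rewrite size_rcons nth_rcons jc; apply; rewrite ltnW.
  - by have := one; rewrite nth_rcons.
  have := step u; rewrite u0 size_rcons ltnW // nth_rcons uc => /(_ isT) /leq_trans; apply.
  rewrite ltnS; apply: eq_leq; apply: eq_bigr => v _.
  by rewrite nth_rcons (ltn_trans (ltn_ord v)).
have Fc := IH Hc; rewrite firsts_rcons Fc.
have -> : nval (rcons (z :: c) x) = (x \notin z :: c) + nval (z :: c).
  by rewrite -nval_cons; apply: eq_nval => y; rewrite mem_rcons.
case: ifP => // xc; rewrite -cats1 addnC iotaD; congr (_ ++ _).
congr [:: _]; apply/eqP; rewrite eqn_leq; apply/andP; split.
  have := step (size (z :: c)); rewrite size_rcons ltnSn => /(_ isT).
  rewrite max_take ?size_rcons // -cats1 take_size_cat // nth_cat ltnn subnn /=.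
  move=> /leq_trans -> //; rewrite ltnS; apply/bigmax_leqP_seq => y yc _.
  by move: yc; rewrite -mem_firsts Fc mem_iota add1n ltnS => /andP[].
have := pos (size (z :: c)); rewrite size_rcons ltnSn -cats1 nth_cat ltnn subnn /= => /(_ isT) x0.
by rewrite leqNgt; apply: contraFN xc => xl; rewrite -mem_firsts Fc mem_iota x0.
Qed.

Lemma canon_canonical (c : seq nat) : canonical c -> canon c = c.
Proof.
move=> H; rewrite /canon (firsts_canonical H) -[RHS]map_id.
apply/eq_in_map => x; rewrite -mem_firsts (firsts_canonical H) => /(nthP 0)[k].
rewrite size_iota => kn <-; rewrite index_uniq ?iota_uniq ?size_iota //.
by rewrite nth_iota.
Qed.

Lemma mem_canonical (c : seq nat) x : canonical c -> (x \in c) = (0 < x <= nval c).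
Proof. by move=> H; rewrite -mem_firsts (firsts_canonical H) mem_iota add1n ltnS. Qed.

End Canonical.

(** * Counting the edges of a walk *)

Section WalkCount.
Variables A J : eqType.

(** Every vertex but the first is reached for the first time through an edge
    that was not used before.  The walk ends on a label if [x :: a] and [i] have
    equal length, and on a letter if [i] is shorter. *)
Lemma nval_walk (x : A) (a : seq A) (i : seq J) : size a <= size i <= (size a).+1 ->
  nval (x :: a) + nval i <= (nval (zip (x :: a) i ++ zip a i)).+1.
Proof.
elim: i x a => [|j i IH] x [|y a] //=; rewrite !ltnS => sz.
- by case: i sz {IH}.
have := IH y a sz; rewrite !(nval_cons x) !(nval_cons j).
set E := zip (y :: a) i ++ zip a i.
have -> : nval ((x, j) :: zip (y :: a) i ++ (y, j) :: zip a i) =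
    ((x, j) \notin (y, j) :: E) + (((y, j) \notin E) + nval E).
  rewrite -!nval_cons; apply: eq_nval => e.
  by rewrite !(mem_cat, inE); case: (e == _); case: (e == _); rewrite ?orbT.
have mE u l : (u, l) \in E -> (u \in y :: a) && (l \in i).
  have zE s t : (u, l) \in zip s t -> (u \in s) && (l \in t).
    by move=> H; apply: contraTT H; rewrite negb_and => /count_zip_notin/count_memPn.
  rewrite mem_cat => /orP[/zE//|/zE/andP[ua ->]].
  by rewrite inE ua orbT.
have [ji|ji] := boolP (j \in i); last first.
  have -> : (y, j) \notin E by apply: contraNN ji => /mE/andP[].
  have [xy|xy] := boolP (x \in y :: a) => /=; first by lia.
  have -> : (x, j) \notin (y, j) :: E.
    rewrite inE xpair_eqE eqxx andbT negb_or.
    move: xy; rewrite inE negb_or => /andP[-> xa] /=.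
    by apply: contraNN ji => /mE/andP[].
  by rewrite /=; lia.
have [xy|xy] := boolP (x \in y :: a) => /=; first by lia.
have -> : (x, j) \notin (y, j) :: E.
  rewrite inE xpair_eqE eqxx andbT negb_or.
  apply/andP; split; first by move: xy; rewrite inE negb_or => /andP[].
  by apply: contraNN xy => /mE/andP[].
by rewrite /=; lia.
Qed.

End WalkCount.

Definition edges (A J : eqType) (a : seq A) (i : seq J) := ups a i ++ downs a i.

Lemma edges_rot (A J : eqType) k (a : seq A) (i : seq J) : size i = size a ->
  perm_eq (edges (rot k a) (rot k i)) (edges a i).
Proof.
move=> si; rewrite /edges ups_rot // /downs zip_rot //.
by apply: perm_cat; rewrite perm_rot.
Qed.

Lemma perm_nval (A : eqType) (s t : seq A) : perm_eq s t -> nval s = nval t.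
Proof. by move=> /perm_mem/eq_nval. Qed.

Definition swap (A B : Type) (e : A * B) := (e.2, e.1).

Lemma swap_inj (A B : Type) : injective (@swap A B).
Proof. by case=> [x y] [z t] [-> ->]. Qed.

Lemma map_swap (A B : Type) (s : seq A) (t : seq B) : map (@swap A B) (zip s t) = zip t s.
Proof. by elim: s t => [|x s IH] [|y t] //=; rewrite IH. Qed.

(** Cutting the closed walk open at an up edge leaves a walk that still visits
    all the [p + 1] vertices, hence uses [p] distinct edges; as there are no
    others, the edge that was cut is among them. *)
Lemma up_repeated (A J : eqType) (a : seq A) (i : seq J) :
  size i = size a -> nval a + nval i = (size a).+1 -> nval (edges a i) = size a ->
  {in ups a i, forall e, 1 < count_mem e (edges a i)}.
Proof.
move=> si na ne e /rot_to[k t Et].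
have sk : size (rot k i) = size (rot k a) by rewrite !size_rot.
have Ep : perm_eq (edges (rot 1 (rot k a)) (rot 1 (rot k i))) (edges a i).
  exact: perm_trans (edges_rot 1 sk) (edges_rot k si).
have Eu : ups (rot 1 (rot k a)) (rot 1 (rot k i)) = rcons t e.
  by rewrite ups_rot // ups_rot // Et rot1_cons.
rewrite -(permP Ep).
move: (perm_nval Ep) (etrans (nval_rot 1 _) (nval_rot k a)) (etrans (nval_rot 1 _) (nval_rot k
    i)) Eu => {Ep}.
rewrite ne.
have : size (rot 1 (rot k i)) = size (rot 1 (rot k a)) by rewrite !size_rot.
have := size_rot 1 (rot k a); rewrite (size_rot k a).
case: (rot 1 (rot k a)) (rot 1 (rot k i)) => [|x b] l.
  by move=> <- /size0nil -> _ _ _; case: (t).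
case/lastP: l => [//|l j] sb /=; rewrite size_rcons => -[sl] ne' na' ni'.
rewrite -na' -ni' /= in na; rewrite /= in sb; rewrite -sb in ne'.
rewrite /ups rot1_cons -!cats1 zip_cat ?sl // !cats1 => /rcons_inj[Et' Ee].
rewrite ltnNge; apply/negP => c1.
have zl : zip b (rcons l j) = zip b l.
  by rewrite -cats1 -{1}[b]cats0 zip_cat //= cats0.
have := @nval_walk _ _ x b (rcons l j); rewrite size_rcons sl leqnSn leqnn => /(_ isT).
rewrite na zl ltnS => nw; have : nval (e :: zip (x :: b) (rcons l j) ++ zip b l) = (size b).+1.
  rewrite -ne'; apply: eq_nval => f.
  rewrite /edges /ups rot1_cons -!cats1 zip_cat ?sl // !mem_cat inE -Ee /=.
  by rewrite !inE !mem_cat; do !case: (_ \in _); case: (_ == _); rewrite ?orbT.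
rewrite nval_cons; have -> : e \notin zip (x :: b) (rcons l j) ++ zip b l; last by rewrite /=; lia.
move: c1; rewrite /edges /ups rot1_cons -!cats1 zip_cat ?sl // !count_cat /= Ee eqxx.
have -> : zip (x :: b) (l ++ [:: j]) = zip (x :: b) (rcons l j) by rewrite cats1.
rewrite addn0 addn1 addSn ltnS leqn0 addn_eq0 => /andP[/eqP c1 /eqP c2].
rewrite mem_cat negb_or.
by apply/andP; split; apply/count_memPn; rewrite -?cats1.
Qed.

(** Exchanging the roles of letters and labels turns down edges into up edges
    of the walk started one step later. *)
Lemma edge_repeated (A J : eqType) (a : seq A) (i : seq J) :
  size i = size a -> nval a + nval i = (size a).+1 -> nval (edges a i) = size a ->
  {in edges a i, forall e, 1 < count_mem e (edges a i)}.
Proof.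
move=> si na ne e; rewrite mem_cat => /orP[|ed]; first exact: up_repeated.
have Es : perm_eq (edges i (rot 1 a)) (map (@swap A J) (edges a i)).
  rewrite /edges map_cat /ups /downs !map_swap zip_rot // perm_catC.
  by apply: perm_cat => //; rewrite perm_rot.
have ci f : count_mem (swap f) (edges i (rot 1 a)) = count_mem f (edges a i).
  rewrite (permP Es) count_map; apply: eq_count => g /=.
  by rewrite (inj_eq (@swap_inj _ _)).
rewrite -ci; apply: up_repeated; rewrite ?size_rot ?nval_rot //.
- by rewrite addnC na si.
- by rewrite (perm_nval Es) nval_map ?ne // => x y _ _; apply: swap_inj.
by rewrite /ups zip_rot // mem_rot -map_swap; apply: map_f.
Qed.

Lemma nval_edges (A J : eqType) (a : seq A) (i : seq J) : 0 < size a ->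
  size i = size a -> nval a + nval i <= (nval (edges a i)).+1.
Proof.
case: a => // x b _; case/lastP: i => // i j; rewrite size_rcons => -[si].
have := @nval_walk _ _ x b (rcons i j); rewrite size_rcons si leqnSn leqnn => /(_ isT).
move/leq_trans; apply; rewrite ltnS; apply: uniq_leq_size; first exact: undup_uniq.
move=> e; rewrite !mem_undup /edges /ups rot1_cons -!cats1 zip_cat ?si // !mem_cat.
have -> : zip b (i ++ [:: j]) = zip b i by rewrite -{1}[b]cats0 zip_cat //= cats0.
by case/orP => ->; rewrite ?orbT.
Qed.

Lemma count2_of_double (A : eqType) (s : seq A) : size s = (nval s).*2 ->
  {in s, forall x, 1 < count_mem x s} -> {in s, forall x, count_mem x s = 2}.
Proof.
move=> sz H x xs; apply/eqP; rewrite eqn_leq H // andbT leqNgt; apply/negP => c3.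
have cr y : count_mem y (rem x s) = count_mem y s - (x == y).
  by rewrite count_rem xs.
have mr y : (y \in rem x s) = (y \in s).
  rewrite -!has_pred1 !has_count cr; case: eqVneq => [<-|]; last by rewrite subn0.
  by rewrite subn_gt0 (ltnW c3) (ltn_trans _ c3).
have := @nval_double _ (rem x s); rewrite (eq_nval mr) size_rem // sz.
have nv : 0 < nval s by rewrite /nval; case: (undup s) (mem_undup s x); rewrite xs.
move=> E; have : (nval s).*2 <= (nval s).*2.-1; last by lia.
apply: E => y; rewrite mr cr => ys; case: eqVneq => [<-|_]; first by rewrite ltn_subRL.
by rewrite subn0 H.
Qed.

(** * Tree graphs and balanced walks *)

Section Delta1.
Variables (A J : finType) (p : nat) (a : p.-tuple A) (i : p.-tuple J).

Lemma nth_rot1 (T : Type) (x0 : T) (s : seq T) u : u < size s ->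
  nth x0 (rot 1 s) u = nth x0 s (u.+1 %% size s).
Proof.
case: s => // x s; rewrite rot1_cons nth_rcons ltnS leq_eqVlt => /predU1P[->|us].
  by rewrite ltnn eqxx modnn.
by rewrite us modn_small.
Qed.

Lemma tuple_mapE (T : Type) (t : p.-tuple T) : val t = map (tnth t) (enum 'I_p).
Proof. by rewrite map_tnth_enum. Qed.

Lemma downsE : downs a i = [seq down_edge a i u | u <- enum 'I_p].
Proof.
by rewrite /downs (tuple_mapE a) (tuple_mapE i) zip_map.
Qed.

Lemma rot1_tuple (T : Type) (t : p.-tuple T) : rot 1 t = map (fun u => tnth t (ordS u)) (enum 'I_p).
Proof.
case: (posnP p) => p0.
  have /size0nil -> : size (rot 1 t) = 0 by rewrite size_rot size_tuple.
  by apply/esym/size0nil; rewrite size_map size_enum_ord.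
pose u0 := Ordinal p0; pose x0 := tnth t u0.
apply: (@eq_from_nth _ x0); first by rewrite size_map size_enum_ord size_rot size_tuple.
move=> u; rewrite size_rot size_tuple => up.
rewrite nth_rot1 ?size_tuple // (nth_map u0) ?size_enum_ord // (tnth_nth x0) /=.
by rewrite nth_enum_ord.
Qed.

Lemma upsE : ups a i = [seq up_edge a i u | u <- enum 'I_p].
Proof.
by rewrite /ups rot1_tuple (tuple_mapE i) zip_map.
Qed.

Lemma mem_glued e : (e \in glued_edges a i) = (e \in edges a i).
Proof.
rewrite /glued_edges inE mem_cat orbC upsE downsE.
congr (_ || _); apply/imsetP/mapP => -[u _ ->]; by exists u; rewrite ?mem_enum.
Qed.

Lemma card_nval (T : finType) (s : seq T) : #|[set x in s]| = nval s.
Proof. by rewrite cardsE -(eq_card (mem_undup s)); apply/card_uniqP/undup_uniq. Qed.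

Lemma card_glued : #|glued_edges a i| = nval (edges a i).
Proof. by rewrite -card_nval; apply: eq_card => e; rewrite mem_glued inE. Qed.

Lemma card_vertices : #|vertices a i| = nval a + nval i.
Proof.
rewrite /vertices cardsU disjoint_setI0 ?cards0 ?subn0; last first.
  by apply/pred0P => x /=; apply/negbTE/negP => /andP[/imsetP[y _ ->] /imsetP[z _]].
rewrite !card_imset; [|by move=> x y []|by move=> x y []].
by congr (_ + _); rewrite -card_nval cardsE.
Qed.

Lemma size_edges : size (edges a i) = p.*2.
Proof. by rewrite size_cat !size_zip size_rot !size_tuple minnn addnn. Qed.

(** The [2 p] steps use each of the [p] edges at least twice, hence exactly
    twice; since each down edge meets one up edge, the down edges are distinct and
    exhaust all the edges. *)
Lemma Delta1_balanced : is_Delta1 a i -> balanced a i /\ nval a + nval i = p.+1.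
Proof.
move=> [one _ cE cV]; rewrite card_vertices in cV; split=> //.
rewrite card_glued in cE.
have si : size i = size a by rewrite !size_tuple.
have two : {in edges a i, forall e, count_mem e (edges a i) = 2}.
  apply: count2_of_double; last by apply: edge_repeated; rewrite ?size_tuple.
  by rewrite cE size_edges.
have ue e : e \in downs a i -> count_mem e (ups a i) = 1.
  rewrite downsE => /mapP[u _ ->]; rewrite -(one u) upsE count_map.
  by rewrite -sum1_count big_enum_cond /= -sum1_card; apply: eq_bigl => v; rewrite inE.
have de e : e \in downs a i -> count_mem e (downs a i) = 1.
  move=> ed; have := two e; rewrite mem_cat ed orbT count_cat ue // => /(_ isT).
  by rewrite add1n => -[].
have ud : uniq (downs a i).
  by apply: count_mem_uniq => e; case: (boolP (e \in _)) => [/de|/count_memPn].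
have sub : edges a i =i downs a i.
  move=> e; rewrite -mem_undup -[RHS]mem_undup.
  have ss : {subset undup (downs a i) <= undup (edges a i)}.
    by move=> f; rewrite !mem_undup mem_cat orbC => ->.
  have [|_ ->] // := uniq_min_size (undup_uniq _) ss.
  by rewrite -/(nval (edges a i)) cE undup_id // size_zip !size_tuple minnn.
apply/allP => e _ /=; apply/eqP.
have [ed|ed] := boolP (e \in downs a i); first by rewrite de // ue.
have : e \notin edges a i by rewrite sub.
by rewrite mem_cat negb_or => /andP[/count_memPn -> /count_memPn ->].
Qed.

Hypothesis p_gt0 : 0 < p.
Hypothesis bal : balanced a i.
Hypothesis nv : nval a + nval i = p.+1.

(** Balance makes the edge set that of the [p] down edges, and [p] distinct
    edges are needed to visit [p + 1] vertices. *)
Lemma nval_edges_balanced : nval (edges a i) = p /\ uniq (downs a i).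
Proof.
have E : nval (edges a i) = nval (downs a i).
  by apply: eq_nval => e; rewrite mem_cat (perm_mem bal) orbb.
have sd : size (downs a i) = p by rewrite size_zip !size_tuple minnn.
have pn : p <= nval (downs a i).
  rewrite -E -ltnS -nv; apply: nval_edges; by rewrite !size_tuple.
have le : nval (downs a i) <= p by rewrite -[X in _ <= X]sd size_undup.
have np : nval (downs a i) = p by apply/eqP; rewrite eqn_leq le.
split; first by rewrite E.
by rewrite -[uniq _]negbK -ltn_size_undup -/(nval _) np sd ltnn.
Qed.

Local Notation adj := (glued_adj a i).

Lemma adj_sym : symmetric adj.
Proof. by move=> [x|x] [y|y]. Qed.

Lemma adj_vertices x y : adj x y -> x \in vertices a i.
Proof.
have mz b (s : seq A) (t : seq J) j : (b, j) \in zip s t -> b \in s /\ j \in t.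
  move=> H; apply/andP; apply: contraTT H.
  by rewrite negb_and => /count_zip_notin/count_memPn.
have mg b j : (b, j) \in glued_edges a i -> (b \in tval a) /\ (j \in tval i).
  rewrite mem_glued mem_cat => /orP[] /mz // [].
  by rewrite mem_rot.
rewrite inE; case: x y => [x|x] [y|y] //= /mg[H1 H2]; apply/orP.
  by left; apply: imset_f.
by right; apply: imset_f.
Qed.

(** Stated for arbitrary embeddings [f], [g] of letters and labels into the
    vertex set, since only the edges of the walk matter. *)
Lemma walk_connect (T : finType) (e : rel T) (f : A -> T) (g : J -> T)
    (x : A) (b : seq A) (l : seq J) : size l <= (size b).+1 -> 
  (forall y j, (y, j) \in zip (x :: b) l ++ zip b l -> e (f y) (g j)) -> symmetric e ->
  size b <= size l ->
  {in x :: b, forall y, connect e (f x) (f y)} /\ {in l, forall j, connect e (f x) (g j)}.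
Proof.
elim: b x l => [|y b IH] x [|j l] //= sl E sym sb.
- by split=> // z; rewrite inE => /eqP->.
- split=> [z|z]; first by rewrite inE => /eqP->.
  rewrite inE; case: l E sl sb => //= E _ _; rewrite orbF => /eqP->.
  by apply: connect1; apply: E; rewrite mem_head.
have [|H1 H2] := IH y l sl _ sym sb.
  move=> z k zk; apply: E; move: zk; rewrite !(inE, mem_cat).
  by case/orP => ->; rewrite !orbT.
have xj : connect e (f x) (g j) by apply: connect1; apply: E; rewrite mem_head.
have xy : connect e (f x) (f y).
  apply: connect_trans xj _; apply: connect1; rewrite sym; apply: E.
  by rewrite !(inE, mem_cat) eqxx !orbT.
split=> z; rewrite inE => /predU1P[->//|zb].
  by apply: connect_trans xy _; apply: H1.
by apply: connect_trans xy _; apply: H2.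
Qed.

Lemma vertices_connected : {in vertices a i &, forall x y, connect adj x y}.
Proof.
have [x0 H] : exists x0, {in vertices a i, forall x, connect adj x0 x}.
  have : size (tval a) = p by rewrite size_tuple.
  have : size (tval i) = p by rewrite size_tuple.
  case Ea : (tval a) => [|x b] si sa; first by have := p_gt0; rewrite -[X in _ < X]sa.
  have sb : size b <= size i <= (size b).+1 by move: si sa => /=; lia.
  have E y j : (y, j) \in zip (x :: b) i ++ zip b i -> adj (inl y) (inr j).
    rewrite /= mem_glued mem_cat /ups /downs Ea mem_cat => /orP[->|]; first by rewrite orbT.
    move=> H; apply/orP; left; rewrite /ups rot1_cons.
    elim: (b) (tval i) H => [|z s IH] [|k t] //=; rewrite !inE => /predU1P[->|/IH->].
      by rewrite eqxx.
    by rewrite orbT.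
  case/andP: sb => sb1 sb2.
  have [H1 H2] := walk_connect sb2 E adj_sym sb1.
  exists (inl x) => z; rewrite inE => /orP[] /imsetP[w ww ->].
    by apply: H1; rewrite -Ea.
  exact: H2.
have cs : connect_sym adj := sym_connect_sym adj_sym.
by move=> x y /H x0x /H; apply: connect_trans; rewrite cs.
Qed.

Definition edges_within (S : {set A + J}) : {set A * J} :=
  [set e in glued_edges a i | (inl e.1 \in S) && (inr e.2 \in S)].

(** A vertex outside [S] adjacent to [S] brings at least one new edge, so [S]
    can be enlarged, keeping the inequality, until it exhausts the connected
    graph. *)
Lemma grow (S : {set A + J}) x0 : x0 \in S -> x0 \in vertices a i ->
  #|S| <= #|edges_within S| -> #|vertices a i| <= #|glued_edges a i|.
Proof.
have [n] := ubnP #|~: S|; elim: n S => // n IH S nS x0S x0V cS.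
have [/subset_leq_card sub|/subsetPn[v vV vS]] := boolP (vertices a i \subset S).
  apply: leq_trans sub (leq_trans cS _); apply: subset_leq_card.
  by apply/fintype.subsetP => e; rewrite inE => /andP[].
have [z zS [y yS yz]] : exists2 z, z \notin S & exists2 y, y \in S & adj y z.
  apply: contrapT => N.
  have cl : fingraph.closed adj (mem S).
    apply: intro_closed; first exact: sym_connect_sym adj_sym.
    move=> y z yz yS; apply: contrapT => /negP zS; apply: N.
    by exists z => //; exists y.
  have := closed_connect cl (vertices_connected x0V vV).
  by rewrite x0S (negbTE vS).
have zsub : edges_within S \proper edges_within (z |: S).
  apply/properP; split.
    apply/fintype.subsetP => e; rewrite !inE => /and3P[-> -> ->].
    by rewrite !orbT.
  have [e Ee1 Ee2] : exists2 e, e \in glued_edges a i &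
      [&& inl e.1 \in z |: S, inr e.2 \in z |: S & ~~ ((inl e.1 \in S) && (inr e.2 \in S))].
    case: y z yz yS zS => [y|y] [z|z] //= yz yS zS.
      by exists (y, z) => //=; rewrite !inE eqxx yS (negbTE zS) ?orbT.
    by exists (z, y) => //=; rewrite !inE eqxx yS (negbTE zS) ?orbT.
  case/and3P: Ee2 => E1 E2 E3.
  by exists e; rewrite inE Ee1 //= E1 E2.
apply: (IH (z |: S)) => //.
- rewrite ltnS in nS; apply: leq_trans nS; apply: proper_card.
  apply/properP; split; first by rewrite finset.setCS finset.subsetUr.
  by exists z; rewrite !inE ?eqxx.
- by rewrite inE x0S orbT.
by rewrite cardsU1 zS add1n; apply: leq_ltn_trans cS (proper_card zsub).
Qed.

Lemma next_next (T : eqType) (c : seq T) x : uniq c -> x \in c -> 2 < size c ->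
  next c (next c x) != x.
Proof.
move=> uc /rot_to[k t Et] sc.
rewrite -!(next_rot k uc) Et.
have : uniq (rot k c) by rewrite rot_uniq.
have : 2 < size (rot k c) by rewrite size_rot.
rewrite Et; case: t {Et} => [|y [|z t]] //= _; rewrite !inE !negb_or.
move=> /and3P[/and3P[xy xz _] _ _]; rewrite !eqxx.
by rewrite eq_sym [y == x]eq_sym (negbTE xy).
Qed.

Definition edge_of (x y : A + J) : option (A * J) :=
  match x, y with
  | inl b, inr j | inr j, inl b => Some (b, j)
  | _, _ => None
  end.

(** A cycle of length at least 3 has as many edges as vertices; by [grow] the
    whole graph would have at least as many edges, [p], as vertices, [p + 1]. *)
Lemma cycle_size (c : seq (A + J)) : ucycle adj c -> size c <= 2.
Proof.
move=> /andP[cc uc]; rewrite leqNgt; apply/negP => sc.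
suff : #|vertices a i| <= #|glued_edges a i|.
  by rewrite card_vertices card_glued nv (nval_edges_balanced).1 ltnn.
have [x0 x0c] : exists x0, x0 \in c by case: (c) sc => // x s _; exists x; rewrite mem_head.
have nx x : x \in c -> adj x (next c x) by move=> xc; apply: next_cycle.
apply: (@grow [set x in c] x0); [by rewrite inE|exact: adj_vertices (nx _ x0c)|].
rewrite card_nval /nval undup_id //.
set E := edges_within _.
rewrite cardE -(size_map (fun x => edge_of x (next c x))) -[X in _ <= X](size_map Some).
apply: uniq_leq_size; last first.
  move=> f /mapP[x xc ->]; have := nx x xc; have : next c x \in c by rewrite mem_next.
  move: (next c x) => w; case: x xc => [x|x] xc; case: w => [y|y] yc //= xy; apply: map_f;
    by rewrite mem_enum inE xy /= !inE xc yc.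
rewrite map_inj_in_uniq // => x y xc yc E1.
apply/eqP; apply: contraT => neq.
have [xy yx] : x = next c y /\ y = next c x.
  move: E1 (nx x xc) (nx y yc) neq.
  case: x xc => [x|x] xc; case: y yc => [y|y] yc; case: (next c _) => [x'|x'] //;
      case: (next c _) => [y'|y'] //=.
  - by move=> [-> _]; rewrite eqxx.
  - by move=> [-> ->].
  - by move=> [-> ->].
  - by move=> [_ ->]; rewrite eqxx.
by have := next_next uc xc sc; rewrite -yx -xy eqxx.
Qed.

(** The tree condition reduces to a count: the graph is connected with [p]
    edges and [p + 1] vertices. *)
Lemma balanced_Delta1 : is_Delta1 a i.
Proof.
have [ne ud] := nval_edges_balanced.
split=> [u||| ]; last by rewrite card_vertices.
- have ued : count_mem (down_edge a i u) (downs a i) = 1.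
    by rewrite count_uniq_mem // downsE map_f // mem_enum.
  rewrite -ued -(permP bal) upsE count_map.
  by rewrite -sum1_count big_enum_cond /= -sum1_card; apply: eq_bigl => v; rewrite inE.
- split; [by rewrite card_vertices nv|exact: vertices_connected|exact: cycle_size].
by rewrite card_glued.
Qed.

End Delta1.

(** * Canonical forms of words *)

Section CanonTuple.
Variable p : nat.

Definition canon_tuple (A : eqType) (a : p.-tuple A) : p.-tuple 'I_p.+1 :=
  map_tuple (fun x => inord (index x (firsts a)).+1) a.

Lemma val_canon_tuple (A : eqType) (a : p.-tuple A) : map val (canon_tuple a) = canon a.
Proof.
rewrite /= -map_comp; apply/eq_in_map => x xa /=; rewrite inordK // ltnS.
have : index x (firsts a) < size (firsts a) by rewrite index_mem mem_firsts.
move=> /leq_trans; apply; rewrite size_firsts.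
by rewrite -[X in _ <= X](size_tuple a) size_undup.
Qed.

Lemma nval_canon_tuple (A : eqType) (a : p.-tuple A) : nval (canon_tuple a) = nval a.
Proof.
by rewrite -(nval_canon a) -val_canon_tuple (nval_map (f := val)) // => x y _ _; apply: val_inj.
Qed.

Lemma mem_Cseq s (c : p.-tuple 'I_p.+1) : c \in Cseq s p <-> canonical (map val c) /\ nval c = s.
Proof.
rewrite inE; split=> [/andP[/asboolP H /eqP]//|[H <-]].
by apply/andP; split; [apply/asboolP|].
Qed.

Hypothesis p_gt0 : 0 < p.

Lemma canon_tuple_Cseq (A : eqType) (a : p.-tuple A) : canon_tuple a \in Cseq (nval a) p.
Proof.
apply/mem_Cseq; rewrite nval_canon_tuple val_canon_tuple; split=> //.
by apply: canonical_canon; rewrite size_tuple.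
Qed.

Lemma canon_tupleK (A : eqType) (a : p.-tuple A) : exists g : 'I_p.+1 -> A, val a =
    map g (canon_tuple a).
Proof.
have x0 : A by case: (tval a) (size_tuple a) => [E|//]; move: p_gt0; rewrite -[X in _ < X]E.
exists (fun v : 'I_p.+1 => nth x0 (firsts a) (val v).-1).
by rewrite -[LHS](canonK x0) -val_canon_tuple -map_comp.
Qed.

Lemma balanced_canon (A J : eqType) (a : p.-tuple A) (i : p.-tuple J) :
  balanced a i -> balanced (canon_tuple a) (canon_tuple i).
Proof. exact: map_balanced. Qed.

(** The governing labelling of a planar word is balanced and has
    [p + 1 - s] values, so its canonical form is a witness for [Cseq1]. *)
Lemma planar_Cseq1 (A : eqType) (a : p.-tuple A) i0 :
  planar a i0 -> canon_tuple a \in Cseq1 (nval a) p.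
Proof.
move=> [si nv b _]; rewrite size_tuple in nv.
have {si} /eqP si : size i0 = p by rewrite si size_tuple.
pose i := Tuple si; have Ei : i0 = i by [].
rewrite inE canon_tuple_Cseq /=; apply/existsP; exists (canon_tuple i).
apply/andP; split.
  by rewrite (_ : p.+1 - _ = nval i) ?canon_tuple_Cseq // -nv addnK.
apply/asboolP; apply: balanced_Delta1 => //; first by apply: balanced_canon.
by rewrite !nval_canon_tuple addnC.
Qed.

(** A witness for [Cseq1] is a balanced labelling with [p + 1 - s] values, one
    more than a thin word allows. *)
Lemma Cseq1_planar (A : eqType) (a : p.-tuple A) :
  canon_tuple a \in Cseq1 (nval a) p -> exists i0, planar a i0.
Proof.
rewrite inE => /andP[_ /existsP[i /andP[_ /asboolP /Delta1_balanced[b nv]]]].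
have [|//|T] := @planar_or_thin _ (val a); first by rewrite size_tuple.
have [g Eg] := canon_tupleK a.
have W : nolone a i by apply: balanced_nolone; rewrite -[tval a]/(val a) Eg -[tval i]map_id;
    apply: map_balanced.
have := T _ (val i); rewrite !size_tuple => /(_ erefl W).
by rewrite -(nval_canon_tuple a) addnC nv ltnn.
Qed.

Lemma not_Cseq1_thin (A : eqType) (a : p.-tuple A) :
  canon_tuple a \notin Cseq1 (nval a) p -> thin a.
Proof.
move=> H; have [|[i0 P]|//] := @planar_or_thin _ (val a); first by rewrite size_tuple.
by rewrite (planar_Cseq1 P) in H.
Qed.

Section Lift.
Variables (s : nat) (c : p.-tuple 'I_p.+1).
Hypothesis cC : c \in Cseq s.+1 p.

Definition block (u : 'I_p) : 'I_s.+1 := inord (val (tnth c u)).-1.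

(** The words obtained by assigning a letter to each value of [c].  Those with
    canonical form [c] are the ones where distinct values receive distinct letters. *)
Definition lift_tuple (T : Type) (f : 'I_s.+1 -> T) : p.-tuple T := [tuple f (block u) | u < p].

Lemma mem_range (v : 'I_p.+1) : (v \in val c) = (0 < val v <= s.+1).
Proof.
have /mem_Cseq[H <-] := cC.
rewrite -(nval_map (f := val)); last by move=> x y _ _; apply: val_inj.
by rewrite -(mem_canonical _ H) (mem_map val_inj).
Qed.

Lemma val_block u : (val (block u)).+1 = tnth c u.
Proof.
have := mem_range (tnth c u); rewrite mem_tnth => /esym/andP[v0 vs].
by rewrite /block /= inordK prednK.
Qed.

Lemma block_surj t : exists u, block u = t.
Proof.
have sp : s.+1 <= p.
  have /mem_Cseq[_ <-] := cC; rewrite -[X in _ <= X](size_tuple c); exact: size_undup.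
have : inord t.+1 \in val c.
  by rewrite mem_range /= inordK // ltnS (leq_trans (ltn_ord t)).
case/tnthP => u Eu; exists u; apply: val_inj; apply: succn_inj; rewrite val_block -Eu.
by rewrite inordK // ltnS (leq_trans (ltn_ord t)).
Qed.

Lemma card_block t : #|[set u | block u == t]| = degree c t.+1.
Proof.
by apply: eq_card => u; rewrite !inE -val_block eqSS.
Qed.

Lemma lift_tuple_inj (T : Type) (f g : 'I_s.+1 -> T) : lift_tuple f = lift_tuple g -> f =1 g.
Proof.
move=> E t; have [u <-] := block_surj t.
by have := congr1 (fun x => tnth x u) E; rewrite !tnth_mktuple.
Qed.

Lemma lift_tupleE (T : Type) (f : 'I_s.+1 -> T) :
  val (lift_tuple f) = map (fun v : 'I_p.+1 => f (inord (val v).-1)) c.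
Proof. by rewrite -(map_tnth_enum c) -map_comp. Qed.

Lemma canon_lift (A : eqType) (f : 'I_s.+1 -> A) : injective f -> canon_tuple (lift_tuple f) = c.
Proof.
move=> inj; have /mem_Cseq[H _] := cC.
have cc : canon c = map val c.
  by rewrite -[RHS](canon_canonical H) canon_map // => x y _ _; apply: val_inj.
apply: val_inj; apply: (inj_map val_inj); rewrite val_canon_tuple [tval _]lift_tupleE -cc.
apply: canon_map => x y; rewrite -![_ \in _]/(_ \in val c) !mem_range => /andP[x0 xs] /andP[y0 ys].
move/inj/(congr1 val); rewrite /= !inordK ?prednK // => E.
by apply: val_inj; rewrite /= -(prednK x0) E prednK.
Qed.

Lemma nval_lift (A : finType) (f : 'I_s.+1 -> A) : ~~ injectiveb f -> nval (lift_tuple f) <= s.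
Proof.
move=> ninj; rewrite -ltnS.
apply: (@leq_ltn_trans #|codom f|).
  rewrite -card_nval; apply: subset_leq_card; apply/fintype.subsetP => x.
  rewrite inE => /tnthP[u ->]; rewrite tnth_mktuple; exact: codom_f.
have le : #|codom f| <= s.+1 by apply: leq_trans (leq_image_card f _) _; rewrite card_ord.
rewrite ltn_neqAle le andbT.
apply: contraNN ninj => /eqP H; apply/injectiveP => x y.
have /image_injP inj : #|codom f| == #|'I_s.+1| by rewrite H card_ord.
by apply: inj.
Qed.

Lemma lift_surj (A : eqType) (a : p.-tuple A) : canon_tuple a = c -> exists f, a = lift_tuple f.
Proof.
move=> E; have x0 : A by case: (tval a) (size_tuple a) => [E0|//]; move: p_gt0;
    rewrite -[X in _ < X]E0.
exists (fun t => nth x0 (firsts a) t); apply: val_inj.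
rewrite lift_tupleE /= -[LHS](canonK x0) -val_canon_tuple E -map_comp.
apply/eq_in_map => v /=; rewrite -[_ \in _]/(v \in val c) mem_range => /andP[v0 vs].
by rewrite inordK ?prednK.
Qed.

End Lift.
End CanonTuple.

Local Open Scope ring_scope.

(** * Counting words and labellings *)

(** Every [x] satisfying [P] is hit at least once by [h]. *)
Lemma ler_sum_surj (K : numDomainType) (I J : finType) (P : pred I) (F : I -> K) (h : J -> I) :
  (forall x, 0 <= F x) -> (forall x, P x -> exists y, h y = x) ->
  \sum_(x | P x) F x <= \sum_y F (h y).
Proof.
move=> F0 hP; rewrite [leRHS](partition_big h predT) //=.
rewrite [leLHS]big_mkcond; apply: ler_sum => x _.
case: ifP => [/hP[y <-]|_]; last by apply: sumr_ge0.
by rewrite (bigD1 y) //= lerDl; apply: sumr_ge0.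
Qed.

Lemma sum_prod_assign (K : comPzSemiRingType) (p s m : nat) (phi : 'I_p -> 'I_s) (w : 'I_m -> K) :
  \sum_(f : {ffun 'I_s -> 'I_m}) \prod_(u < p) w (f (phi u)) =
  \prod_(t < s) \sum_(j < m) w j ^+ #|[set u | phi u == t]|.
Proof.
rewrite bigA_distr_bigA /=; apply: eq_bigr => f _.
rewrite (partition_big phi predT) //=; apply: eq_bigr => t _.
rewrite -prodr_const big_mkcond [RHS]big_mkcond; apply: eq_bigr => u _.
by rewrite inE; case: eqP => // ->.
Qed.

Lemma nval_gt0 (A : eqType) p (a : p.-tuple A) : (0 < p)%N -> (0 < nval a)%N.
Proof.
move=> p0; rewrite -size_firsts -has_predT; apply/hasP.
by exists (tnth a (Ordinal p0)); rewrite ?mem_firsts ?mem_tnth.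
Qed.

(** A word with at most [s] values factors as positions [-> s -> letters];
    summing over all such factorizations overcounts, and for a fixed first map the
    sum of the weights is a product of [s] power sums. *)
Lemma few_values_sum (K : numDomainType) (p s m : nat) (w : 'I_m -> K) (B : K) :
  (0 < p)%N -> (forall j, 0 <= w j) -> (forall d, (d <= p)%N -> \sum_j w j ^+ d <= B) ->
  \sum_(a : p.-tuple 'I_m | (nval a <= s)%N) \prod_(x <- a) w x <= (s ^ p)%N%:R * B ^+ s.
Proof.
move=> p0 w0 wB.
pose h (x : ({ffun 'I_p -> 'I_s} * {ffun 'I_s -> 'I_m})%type) := [tuple x.2 (x.1 u) | u < p].
apply: (le_trans (@ler_sum_surj _ _ _ _ _ h _ _)) => [a|a na|].
- by apply: prodr_ge0.
- have x0 : 'I_m by case: (tval a) (size_tuple a) => [E|//]; rewrite -E in p0.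
  have s0 : (0 < s)%N.
    by apply: leq_trans na; apply: nval_gt0.
  exists ([ffun u => insubd (Ordinal s0) (index (tnth a u) (firsts a))],
          [ffun t : 'I_s => nth x0 (firsts a) t]).
  apply: eq_from_tnth => u; rewrite /h tnth_mktuple /= !ffunE val_insubd.
  have -> : (index (tnth a u) (firsts a) < s)%N.
    by rewrite (leq_trans _ na) // -size_firsts index_mem mem_firsts mem_tnth.
  by rewrite nth_index // mem_firsts mem_tnth.
have -> : \sum_y \prod_(x <- h y) w x =
    \sum_(phi : {ffun 'I_p -> 'I_s}) \prod_(t < s) \sum_(j < m) w j ^+ #|[set u | phi u == t]|.
  rewrite -(pair_bigA _ (fun phi f => \prod_(x <- h (phi, f)) w x)) /=.
  apply: eq_bigr => phi _; rewrite -sum_prod_assign; apply: eq_bigr => f _.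
  by rewrite /h /= big_map big_enum.
rewrite (_ : (s ^ p)%N%:R * B ^+ s = \sum_(phi : {ffun 'I_p -> 'I_s}) \prod_(t < s) B).
  apply: ler_sum => phi _; apply: ler_prod => t _.
  apply/andP; split; first by apply: sumr_ge0 => j _; apply: exprn_ge0.
  by apply: wB; rewrite -[X in (_ <= X)%N]card_ord max_card.
by rewrite prodr_const card_ord sumr_const card_ffun !card_ord mulr_natl.
Qed.

Lemma card_few_values (p s n : nat) : (0 < p)%N ->
  (#|[set i : p.-tuple 'I_n | (nval i <= s)%N]| <= s ^ p * n ^ s)%N.
Proof.
move=> p0; rewrite -(ler_nat int) natrM [X in _ * X]natrX.
apply: le_trans (@few_values_sum int p s n (fun=> 1) n%:R p0 _ _) => // [|d _].
  rewrite -sum1_card natr_sum big_mkcond [leRHS]big_mkcond; apply: ler_sum => i _.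
  by rewrite inE; case: ifP => // _; rewrite big1_eq.
by under eq_bigr do rewrite expr1n; rewrite sumr_const card_ord.
Qed.

(** The contributing labellings of a planar word correspond to the maps from
    the [p + 1 - s] values of the governing labelling to [1 .. n]. *)
Lemma card_balanced (A : eqType) (p : nat) (a : p.-tuple A) i0 n : (0 < p)%N -> planar a i0 ->
  #|[set i : p.-tuple 'I_n | balanced a i]| = (n ^ (p.+1 - nval a))%N.
Proof.
move=> p0 [si nv b H]; rewrite size_tuple in nv.
have {}si : size i0 == p by rewrite si size_tuple.
pose i := Tuple si.
have E : (p.+1 - nval a)%N = nval i by rewrite -nv addnK.
have i_gt0 : (0 < nval i)%N := nval_gt0 i p0.
have cC := @canon_tuple_Cseq p p0 _ i; rewrite -(prednK i_gt0) in cC.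
rewrite E -(prednK i_gt0); set s := (nval i).-1 in cC *.
rewrite -[X in (X ^ _)%N]card_ord -[X in (_ ^ X)%N]card_ord -card_ffun.
have linj : injective (fun f : {ffun 'I_s.+1 -> 'I_n} => lift_tuple (canon_tuple i) f).
  by move=> f g /(lift_tuple_inj cC) fg; apply/ffunP.
rewrite -cardsT -(card_imset _ linj); apply: eq_card => j; rewrite inE.
apply/idP/imsetP => [bj|[f _ ->]]; last first.
  rewrite lift_tupleE /= -map_comp -[tval a]map_id; exact: map_balanced.
have [|g Eg] := H _ (val j) _ (balanced_nolone bj); first by rewrite !size_tuple.
have [h Eh] := canon_tupleK p0 i.
have Ej : val j = map (g \o h) (canon_tuple i) by rewrite Eg map_comp -Eh.
have x0 : 'I_n := tnth j (Ordinal p0).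
exists [ffun t : 'I_s.+1 => g (h (inord (val t).+1))] => //.
apply: val_inj; rewrite lift_tupleE Ej; apply/eq_in_map => v.
rewrite -[_ \in _]/(v \in val (canon_tuple i)) (mem_range cC) => /andP[v0 vs].
rewrite ffunE /= inordK ?prednK ?inord_val //.
by move: vs; rewrite /s prednK.
Qed.

Section MomentSum.
Variables (K : numFieldType) (mu : nat -> nat -> K).
Hypothesis mu_diag : forall u, mu u u = 1.
Hypothesis mu_up : forall u, mu u.+1 u = 0.
Hypothesis mu_down : forall u, mu u u.+1 = 0.
Hypothesis mu_le1 : forall u v, `|mu u v| <= 1.

Variables (A : finType) (n : nat).

Definition wmoment (J : finType) (a : seq A) (i : seq J) : K :=
  \prod_(e : (A * J)%type) mu (count_mem e (ups a i)) (count_mem e (downs a i)).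

Definition moment_sum p (a : seq A) : K := \sum_(i : p.-tuple 'I_n) wmoment a i.

Lemma wmoment_balanced (J : finType) (a : seq A) (i : seq J) : balanced a i -> wmoment a i = 1.
Proof. by move=> /permP b; apply: big1 => e _; rewrite b mu_diag. Qed.

Lemma wmoment_lone (J : finType) (a : seq A) (i : seq J) : ~~ nolone a i -> wmoment a i = 0.
Proof.
case/allPn => e _; rewrite negb_and !negbK /wmoment (bigD1 e) //=.
by case/orP => /eqP->; rewrite ?mu_up ?mu_down mul0r.
Qed.

Lemma wmoment_le1 (J : finType) (a : seq A) (i : seq J) : `|wmoment a i| <= 1.
Proof. by rewrite normr_prod; apply: prodr_ile1 => e _; rewrite normr_ge0 mu_le1. Qed.

Variable p : nat.
Hypothesis p_gt0 : (0 < p)%N.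
Variable a : p.-tuple A.

Lemma moment_sum_planar i0 : planar a i0 -> moment_sum p a = (n ^ (p.+1 - nval a))%N%:R.
Proof.
move=> P; rewrite -(card_balanced n p_gt0 P) -sum1_card natr_sum [RHS]big_mkcond.
apply: eq_bigr => i _; rewrite inE; case: ifP => [/wmoment_balanced//|nb].
have [_ _ b H] := P.
apply: wmoment_lone; apply: contraFN nb => /H[|g ->]; first by rewrite !size_tuple.
by rewrite -[tval a]map_id; apply: map_balanced.
Qed.

Lemma moment_sum_le s :
  (forall i : p.-tuple 'I_n, nolone a i -> (nval i <= s)%N) ->
  `|moment_sum p a| <= (s ^ p * n ^ s)%N%:R.
Proof.
move=> H; apply: le_trans (ler_norm_sum _ _ _) _.
apply: (@le_trans _ _ (#|[set i : p.-tuple 'I_n | (nval i <= s)%N]|%:R)).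
  rewrite -sum1_card natr_sum [leRHS]big_mkcond; apply: ler_sum => i _; rewrite inE.
  case: ifP => [_|/negP ni]; first exact: wmoment_le1.
  by rewrite wmoment_lone ?normr0 //; apply/negP => /H.
by rewrite ler_nat card_few_values.
Qed.

Lemma moment_sum_thin : thin a -> `|moment_sum p a| <= (p ^ p * n ^ (p - nval a))%N%:R.
Proof.
move=> T; apply: le_trans (moment_sum_le (s := p - nval a) _) _ => [i W|].
  by have := T _ (tval i); rewrite !size_tuple => /(_ erefl W); lia.
by rewrite ler_nat leq_mul2r leq_exp2r // leq_subr orbT.
Qed.

(** A planar word has exactly [n ^ (p + 1 - s)] contributing labellings, a thin
    one fewer up to a constant. *)
Lemma moment_sum_bound : (0 < n)%N -> `|moment_sum p a| <= (p ^ p * n ^ (p.+1 - nval a))%N%:R.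
Proof.
move=> n0; have [|[i0 P]|T] := @planar_or_thin _ (val a); first by rewrite size_tuple.
  rewrite (moment_sum_planar P) normr_nat ler_nat leq_pmull //.
  by rewrite expn_gt0 p_gt0.
apply: le_trans (moment_sum_thin T) _; rewrite ler_nat leq_mul2l leq_pexp2l ?orbT //; lia.
Qed.

End MomentSum.

Local Open Scope complex_scope.

(** * Cyclic products of Gram entries *)

Lemma prod_seq_count (K : comPzSemiRingType) (I : finType) (s : seq I) (f : I -> K) :
  \prod_(e <- s) f e = \prod_e f e ^+ count_mem e s.
Proof.
elim: s => [|x s IH]; first by rewrite big_nil big1.
rewrite big_cons IH [RHS](eq_bigr (fun e => f e ^+ (x == e) * f e ^+ count_mem e s)).
  rewrite big_split /= [X in _ = X * _](bigD1 x) //= eqxx expr1 [X in _ =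
      _ * X * _]big1 ?mulr1 // => e ex.
  by rewrite eq_sym (negbTE ex) expr0.
by move=> e _; rewrite -exprD.
Qed.

Section Cyclic.
Variables (R : rcfType) (n m k : nat) (y : 'I_m -> 'I_k -> 'I_n -> R[i]).

Definition gram (a b : 'I_m) : R[i] :=
  \prod_(l < k) (n%:R^-1 * \sum_(j < n) (y a l j)^* * y b l j).

Definition cyclic (s : seq 'I_m) : R[i] :=
  \prod_(e <- zip s (rot 1 s)) gram e.1 e.2.

Lemma gram_conj a b : (gram a b)^* = gram b a.
Proof.
rewrite /gram rmorph_prod; apply: eq_bigr => l _.
rewrite rmorphM rmorph_sum /= conjc_inv conjc_nat; congr (_ * _).
by apply: eq_bigr => j _; rewrite rmorphM /= conjcK mulrC.
Qed.

Lemma cyclic_rot i s : cyclic (rot i s) = cyclic s.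
Proof.
rewrite /cyclic rot_rot zip_rot ?size_rot //; apply: perm_big.
by rewrite perm_rot.
Qed.

(** Conjugation exchanges the two indices of the Gram matrix, which reverses
    the direction of the cyclic word. *)
Lemma cyclic_conj s : (cyclic s)^* = cyclic (rev s).
Proof.
rewrite /cyclic rmorph_prod /=.
under eq_bigr do rewrite gram_conj.
have -> : \prod_(e <- zip s (rot 1 s)) gram e.2 e.1 =
    \prod_(e <- map (@swap _ _) (zip s (rot 1 s))) gram e.1 e.2 by rewrite big_map.
apply: perm_big; rewrite map_swap.
have E : rot 1 (rev (zip (rot 1 s) s)) = zip (rev s) (rot 1 (rev s)).
  by rewrite rev_zip ?size_rot // -zip_rot ?size_rev ?size_rot // rev_rot rotrK.
by rewrite -E perm_sym perm_rot perm_rev.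
Qed.

(** Two closed words through the same letter are spliced there. *)
Lemma cyclic_cat a s t : cyclic (a :: s) * cyclic (a :: t) = cyclic ((a :: s) ++ (a :: t)).
Proof.
rewrite /cyclic -big_cat; apply: congr_big => //.
rewrite cat_cons !rot1_cons.
have -> : rcons (s ++ a :: t) a = rcons s a ++ rcons t a by rewrite rcons_cat rcons_cons cat_rcons.
by rewrite -cat_cons zip_cat //= size_rcons.
Qed.

Definition up_count p (s : seq 'I_m) (i : {ffun 'I_k -> p.-tuple 'I_n})
    (t : 'I_m * 'I_k * 'I_n) : nat := count_mem (t.1.1, t.2) (ups s (i t.1.2)).

Definition down_count p (s : seq 'I_m) (i : {ffun 'I_k -> p.-tuple 'I_n})
    (t : 'I_m * 'I_k * 'I_n) : nat := count_mem (t.1.1, t.2) (downs s (i t.1.2)).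

End Cyclic.

Section Reindex.
Variables (K : comPzSemiRingType).

Lemma sum_tuple_ffun p (J : finType) (F : p.-tuple J -> K) :
  \sum_(f : {ffun 'I_p -> J}) F [tuple f u | u < p] = \sum_(i : p.-tuple J) F i.
Proof.
rewrite [RHS](reindex (fun f : {ffun 'I_p -> J} => [tuple f u | u < p])) //.
exists (fun i : p.-tuple J => [ffun u => tnth i u]) => [f _|i _].
  by apply/ffunP => u; rewrite ffunE tnth_mktuple.
by apply: eq_from_tnth => u; rewrite tnth_mktuple ffunE.
Qed.

Lemma prod_triple (m k n : nat) (F : 'I_m * 'I_k * 'I_n -> K) :
  \prod_t F t = \prod_(l < k) \prod_(e : 'I_m * 'I_n) F (e.1, l, e.2).
Proof.
transitivity (\prod_(a < m) \prod_(l < k) \prod_(j < n) F (a, l, j)).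
  rewrite pair_big pair_big /=; apply: eq_bigr => -[[a l] j] _ //.
by rewrite exchange_big /=; apply: eq_bigr => l _; rewrite pair_big; apply: eq_bigr => -[].
Qed.
End Reindex.

Section CyclicExpansion.
Variables (R : rcfType) (n m k : nat) (y : 'I_m -> 'I_k -> 'I_n -> R[i]).

(** Expanding all the inner products assigns to each tensor factor [l] a
    labelling [i l] of the word; equal entries are then collected with their
    exponents. *)
Lemma cyclic_expand p (s : p.-tuple 'I_m) : cyclic y s =
  (n%:R^-1 ^+ p) ^+ k * \sum_(i : {ffun 'I_k -> p.-tuple 'I_n})
    \prod_(t : 'I_m * 'I_k * 'I_n) (y t.1.1 t.1.2 t.2 ^+ up_count s i t * (y t.1.1 t.1.2 t.2)^*
        ^+ down_count s i t).
Proof.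
have step l : \prod_(e <- zip s (rot 1 s)) (n%:R^-1 * \sum_(j < n) (y e.1 l j)^* * y e.2 l j) =
    n%:R^-1 ^+ p * \sum_(i : p.-tuple 'I_n) \prod_(e : 'I_m * 'I_n)
      (y e.1 l e.2 ^+ count_mem e (ups s i) * (y e.1 l e.2)^* ^+ count_mem e (downs s i)).
  rewrite rot1_tuple [in zip _ _](tuple_mapE s) zip_map big_map big_enum /=.
  rewrite big_split /= prodr_const card_ord; congr (_ * _).
  rewrite bigA_distr_bigA /= -sum_tuple_ffun; apply: eq_bigr => f _.
  rewrite !big_split /= -!prod_seq_count mulrC; congr (_ * _).
    by rewrite /ups rot1_tuple zip_map big_map big_enum.
  by rewrite /downs (tuple_mapE s) zip_map big_map big_enum.
rewrite /cyclic /gram exchange_big /=.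
under eq_bigr do rewrite step.
rewrite big_split /= prodr_const card_ord; congr (_ * _).
rewrite bigA_distr_bigA /=; apply: eq_bigr => i _.
by rewrite prod_triple.
Qed.

End CyclicExpansion.

(** * Expansion of the trace *)

Local Open Scope sesquilinear_scope.

Lemma mulmx_adj_cast (K : numClosedFieldType) m1 m2 c1 c2 (e : (m1 = m2) * (c1 =
    c2)) (M N : 'M[K]_(m1, c1)) :
  (castmx e M) ^t* *m castmx e N = castmx (e.2, e.2) (M ^t* *m N).
Proof. by case: e => e1 e2; case: m2 / e1; case: c2 / e2; rewrite !castmx_id. Qed.

Lemma tens_adj (K : numClosedFieldType) m1 m2 (A : 'cV[K]_m1) (B : 'cV[K]_m2) :
  (A *t B) ^t* = A ^t* *t B ^t*.
Proof. by rewrite trmx_tens map_mxT. Qed.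

(** The transports along [n * n ^ k = n ^ k.+1] cancel in the inner product. *)
Lemma tens_inner (R : realType) n k (y z : 'I_k -> 'cV[R[i]]_n) i j :
  ((tens_vec y) ^t* *m tens_vec z) i j = \prod_(l < k) \sum_(b < n) conjc (y l b 0) * z l b 0.
Proof.
elim: k y z i j => [|k IH] y z i j.
  by rewrite big_ord0 !mxE big_ord1 !mxE rmorph1 mulr1.
rewrite /= mulmx_adj_cast castmxE /= tens_adj tensmx_mul.
rewrite big_ord_recl mxE IH; congr (_ * _).
rewrite mxE; apply: eq_bigr => b _; rewrite !mxE.
by rewrite !ord1.
Qed.

Lemma sum_tuple_cons (K : nmodType) (J : finType) p (F : p.+1.-tuple J -> K) :
  \sum_(t : p.+1.-tuple J) F t = \sum_(x : J) \sum_(t : p.-tuple J) F (cons_tuple x t).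
Proof.
rewrite pair_big (reindex (fun xt : J * p.-tuple J => cons_tuple xt.1 xt.2)) //=.
exists (fun t : p.+1.-tuple J => (thead t, behead_tuple t)) => [[x t] _|t _].
  by congr pair; apply: val_inj.
by rewrite [RHS]tuple_eta; apply: val_inj.
Qed.

Lemma pow_entry (K : comPzRingType) (q p : nat) (B : 'M[K]_q) i j :
  (B ^+ p.+1) i j =
  \sum_(t : p.-tuple 'I_q) \prod_(e <- zip (i :: t) (rcons t j)) B e.1 e.2.
Proof.
elim: p i => [|p IH] i.
  rewrite expr1 (bigD1 [tuple]) //= big_cons big_nil mulr1 big1 ?addr0 // => t.
  by move=> /negP[]; apply/eqP; exact: tuple0.
rewrite exprS -[B * _]/(B *m _) mxE sum_tuple_cons; apply: eq_bigr => l _.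
rewrite IH mulr_sumr; apply: eq_bigr => t _.
by rewrite /= big_cons.
Qed.

Lemma trace_pow (K : comPzRingType) (q p : nat) (B : 'M[K]_q) :
  \tr (B ^+ p.+1) = \sum_(a : p.+1.-tuple 'I_q) \prod_(e <- zip a (rot 1 a)) B e.1 e.2.
Proof.
rewrite sum_tuple_cons; apply: eq_bigr => i _; rewrite pow_entry; apply: eq_bigr => t _.
by rewrite /= rot1_cons.
Qed.

Lemma trace_pow_mulC (K : comPzRingType) (q r p : nat) (A : 'M[K]_(q, r)) (B : 'M[K]_(r, q)) :
  \tr ((A *m B) ^+ p.+1) = \tr ((B *m A) ^+ p.+1).
Proof.
have H : (A *m B) ^+ p.+1 = A *m (B *m A) ^+ p *m B.
  elim: p => [|p IH]; first by rewrite expr1 expr0 mulmx1.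
  rewrite exprSr IH exprSr -[_ * (A *m B)]/(_ *m (A *m B)) -[_ * (B *m A)]/(_ *m (B *m A)).
  by rewrite !mulmxA.
by rewrite H -mulmxA mxtrace_mulC -mulmxA exprSr.
Qed.

Lemma Yvec_inner (R : realType) (n k m : nat) (x : 'I_m -> 'I_k -> 'I_n -> R[i]) a b i j :
  ((Yvec x a) ^t* *m Yvec x b) i j = gram x a b.
Proof.
rewrite /Yvec tens_inner; apply: eq_bigr => l _; rewrite mulr_sumr; apply: eq_bigr => c _.
rewrite !mxE; set r := (Num.sqrt n%:R)^-1.
have E (z w : R[i]) : conjc (r%:C * z) * (r%:C * w) = (r ^+ 2)%:C * (conjc z * w).
  case: z w => [z1 z2] [w1 w2]; apply/eqP; rewrite eq_complex /=.
  by apply/andP; split; apply/eqP; ring.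
rewrite E exprVn sqr_sqrtr ?ler0n //.
by rewrite (fmorphV (real_complex R)) (rmorph_nat (real_complex R)).
Qed.

(** With [A] the matrix of the columns [tau_a Y_a] and [B] that of the rows
    [Y_a^*], [Tr (A B)^p = Tr (B A)^p] and [B A] is the weighted Gram matrix. *)
Lemma trace_expansion (R : realType) (n k m p : nat) (tau : nat -> R)
    (x : 'I_m -> 'I_k -> 'I_n -> R[i]) : (0 < p)%N ->
  \tr (Mmx tau x ^+ p) =
  \sum_(a : p.-tuple 'I_m) (\prod_(b <- a) tau b)%:C * cyclic x a.
Proof.
case: p => // p _.
pose A := \matrix_(i < n ^ k, a < m) ((tau a)%:C * Yvec x a i 0).
pose B := \matrix_(a < m, i < n ^ k) ((Yvec x a) ^t*) 0 i.
have -> : Mmx tau x = A *m B.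
  apply/matrixP => i j; rewrite /Mmx summxE mxE; apply: eq_bigr => a _.
  by rewrite !mxE big_ord1 !mxE mulrA.
rewrite trace_pow_mulC trace_pow; apply: eq_bigr => a _.
have BA b c : (B *m A) b c = (tau c)%:C * gram x b c.
  rewrite -(Yvec_inner x b c 0 0) !mxE mulr_sumr; apply: eq_bigr => i _.
  by rewrite !mxE mulrCA.
under eq_bigr do rewrite BA.
rewrite big_split /=; congr (_ * _).
rewrite (rmorph_prod (real_complex R)) /=.
have -> : \prod_(e <- zip a (rot 1 a)) (tau e.2)%:C = \prod_(b <- rot 1 a) (tau b)%:C :> R[i].
  rewrite -[rot 1 a in RHS](@unzip2_zip _ _ a) ?size_rot // /unzip2 big_map //.
by apply: perm_big; rewrite perm_rot.
Qed.

Local Close Scope sesquilinear_scope.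

Local Open Scope classical_set_scope.
Local Open Scope ring_scope.
Local Open Scope complex_scope.

Local Notation Re := complex.Re.
Local Notation Im := complex.Im.
Local Notation nc := Normc.normc.

(** * Bounded complex random variables *)

Section ComplexNorm.
Variable R : rcfType.
Implicit Types z : R[i].

Lemma nc_ge0 z : 0 <= nc z. Proof. by case: z => a b; apply: sqrtr_ge0. Qed.

Lemma nc_sqr z : nc z ^+ 2 = Re z ^+ 2 + Im z ^+ 2.
Proof. by case: z => a b; rewrite /= sqr_sqrtr // addr_ge0 ?sqr_ge0. Qed.

Lemma nc_Re z : `|Re z| <= nc z.
Proof. by case: z => a b; rewrite -sqrtr_sqr /= ler_wsqrtr // lerDl sqr_ge0. Qed.

Lemma nc_Im z : `|Im z| <= nc z.
Proof. by case: z => a b; rewrite -sqrtr_sqr /= ler_wsqrtr // lerDr sqr_ge0. Qed.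

Lemma nc_real (r : R) : nc r%:C = `|r|.
Proof. by rewrite /= expr0n addr0 sqrtr_sqr. Qed.

Lemma nc_conj z : nc z^* = nc z.
Proof. by case: z => a b; rewrite /= sqrrN. Qed.

Lemma ncD z1 z2 : nc (z1 + z2) <= nc z1 + nc z2.
Proof. exact: le_normcD. Qed.

Lemma ncM z1 z2 : nc (z1 * z2) = nc z1 * nc z2.
Proof. exact: Normc.normcM. Qed.

Lemma nc_norm z : `|z| = (nc z)%:C.
Proof. by case: z. Qed.

Lemma nc_sum I (r : seq I) (Q : pred I) (F : I -> R[i]) :
  nc (\sum_(i <- r | Q i) F i) <= \sum_(i <- r | Q i) nc (F i).
Proof.
elim/big_rec2: _ => [|i x y _ H]; first by rewrite Normc.normc0.
by apply: le_trans (ncD _ _) _; rewrite lerD2l.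
Qed.

Lemma ReM z1 z2 : Re (z1 * z2) = Re z1 * Re z2 - Im z1 * Im z2.
Proof. by case: z1 z2 => [a b] [e f]. Qed.
Lemma ImM z1 z2 : Im (z1 * z2) = Re z1 * Im z2 + Im z1 * Re z2.
Proof. by case: z1 z2 => [a b] [e f]. Qed.
Lemma ReD z1 z2 : Re (z1 + z2) = Re z1 + Re z2.
Proof. by case: z1 z2 => [a b] [e f]. Qed.
Lemma ImD z1 z2 : Im (z1 + z2) = Im z1 + Im z2.
Proof. by case: z1 z2 => [a b] [e f]. Qed.

Lemma conj_mul z : z^* * z = (nc z ^+ 2)%:C.
Proof. by rewrite nc_sqr; case: z => a b; apply/eqP; rewrite eq_complex /=; apply/andP; split;
    apply/eqP; ring. Qed.

Lemma complexP z1 z2 : Re z1 = Re z2 -> Im z1 = Im z2 -> z1 = z2.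
Proof. by case: z1 z2 => [a b] [e f] /= -> ->. Qed.

End ComplexNorm.

Section BoundedMeasurable.
Context (R : realType) (d : measure_display) (T : measurableType d).
Implicit Types f g : T -> R[i].

(** All the random variables below are in this class, which is closed under
    sums, products and conjugation and consists of integrable functions. *)
Definition bounded_mfun f : Prop :=
  [/\ measurable_fun setT (fun w => Re (f w)),
      measurable_fun setT (fun w => Im (f w)) &
      exists M, forall w, nc (f w) <= M].

Lemma bm_cst z : bounded_mfun (fun=> z).
Proof. by split; [exact: measurable_cst|exact: measurable_cst|exists (nc z)]. Qed.

Lemma bmD f g : bounded_mfun f -> bounded_mfun g -> bounded_mfun (fun w => f w + g w).
Proof.
move=> [mf mf' [M fM]] [mg mg' [N gN]]; split.
- by under eq_fun do rewrite ReD; exact: measurable_funD.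
- by under eq_fun do rewrite ImD; exact: measurable_funD.
by exists (M + N) => w; apply: le_trans (ncD _ _) _; rewrite lerD.
Qed.

Lemma bmM f g : bounded_mfun f -> bounded_mfun g -> bounded_mfun (fun w => f w * g w).
Proof.
move=> [mf mf' [M fM]] [mg mg' [N gN]]; split.
- by under eq_fun do rewrite ReM; apply: measurable_funB; exact: measurable_funM.
- by under eq_fun do rewrite ImM; apply: measurable_funD; exact: measurable_funM.
by exists (M * N) => w; rewrite ncM; apply: ler_pM; rewrite ?nc_ge0.
Qed.

Lemma bm_conj f : bounded_mfun f -> bounded_mfun (fun w => (f w)^*).
Proof.
move=> [mf mf' [M fM]]; split.
- by rewrite (_ : (fun w => _) = (fun w => Re (f w))) //; apply/funext => w; case: (f w).
- rewrite (_ : (fun w => _) = (fun w => - Im (f w))); last by apply/funext => w; case: (f w).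
  exact: measurableT_comp.
by exists M => w; rewrite nc_conj.
Qed.

Lemma bmZ z f : bounded_mfun f -> bounded_mfun (fun w => z * f w).
Proof. by apply: bmM; exact: bm_cst. Qed.

Lemma bm_sum I (r : seq I) (Q : pred I) (F : I -> T -> R[i]) :
  (forall i, Q i -> bounded_mfun (F i)) -> bounded_mfun (fun w => \sum_(i <- r | Q i) F i w).
Proof.
move=> H; elim: r => [|i r IH].
  by rewrite (_ : (fun w => _) = fun=> 0); [exact: bm_cst|apply/funext => w; rewrite big_nil].
rewrite (_ : (fun w => _) = fun w => if Q i then F i w + \sum_(j <- r | Q j) F j w
    else \sum_(j <- r | Q j) F j w); last first.
  by apply/funext => w; rewrite big_cons.
by case: (Q i) (H i) => /= [/(_ isT) Hi|_]; [exact: bmD|].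
Qed.

Lemma bm_prod I (r : seq I) (Q : pred I) (F : I -> T -> R[i]) :
  (forall i, Q i -> bounded_mfun (F i)) -> bounded_mfun (fun w => \prod_(i <- r | Q i) F i w).
Proof.
move=> H; elim: r => [|i r IH].
  by rewrite (_ : (fun w => _) = fun=> 1); [exact: bm_cst|apply/funext => w; rewrite big_nil].
rewrite (_ : (fun w => _) = fun w => if Q i then F i w * \prod_(j <- r | Q j) F j w
    else \prod_(j <- r | Q j) F j w); last first.
  by apply/funext => w; rewrite big_cons.
by case: (Q i) (H i) => /= [/(_ isT) Hi|_]; [exact: bmM|].
Qed.

Lemma bm_exp f k : bounded_mfun f -> bounded_mfun (fun w => f w ^+ k).
Proof.
move=> bf; elim: k => [|k IH].
  by rewrite (_ : (fun w => _) = fun=> 1); [exact: bm_cst|apply/funext => w; rewrite expr0].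
by rewrite (_ : (fun w => _) = fun w => f w * f w ^+ k); [exact: bmM|apply/funext => w;
    rewrite exprS].
Qed.

Lemma bm_indic (B : set T) : measurable B -> bounded_mfun (fun w => (\1_B w : R)%:C).
Proof.
move=> mB; split; [exact: measurable_indic|exact: measurable_cst|].
by exists 1 => w; rewrite nc_real indicE; case: (_ \in _); rewrite ?normr1 ?normr0.
Qed.

End BoundedMeasurable.

Lemma bm_comp (R : realType) (d d' : measure_display) (T : measurableType d) (U : measurableType d')
    (Y : T -> U) (f : U -> R[i]) : measurable_fun setT Y -> bounded_mfun f -> bounded_mfun (f \o Y).
Proof.
move=> mY [mf mf' [M fM]]; split.
- exact: (measurableT_comp mf mY).
- exact: (measurableT_comp mf' mY).
by exists M => w; apply: fM.
Qed.

Section Expectation.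
Context (R : realType) (d : measure_display) (T : measurableType d) (P : probability T R).
Implicit Types f g : T -> R[i].
Local Notation E := (cexpectation P).

Lemma cexpectationE f : E f = (\int[P]_w Re (f w))%R +i* (\int[P]_w Im (f w))%R.
Proof. by rewrite /cexpectation !unlock. Qed.

(** Stated at the type of measures, which is how [P] occurs in integrals. *)
Lemma PT1 : (P : {measure set T -> \bar R}) setT = 1%E. Proof. exact: probability_setT. Qed.
Lemma PT_lty : ((P : {measure set T -> \bar R}) setT < +oo)%E. Proof. by rewrite PT1 ltry. Qed.

Lemma bm_integrable_Re f : bounded_mfun f -> P.-integrable setT (EFin \o (fun w => Re (f w))).
Proof.
move=> [mf _ [M fM]]; apply: measurable_bounded_integrable => //; first exact: PT_lty.
exists M; split; first exact: num_real.
by move=> x Mx w _; apply: le_trans (ltW Mx); apply: le_trans (nc_Re _) (fM w).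
Qed.

Lemma bm_integrable_Im f : bounded_mfun f -> P.-integrable setT (EFin \o (fun w => Im (f w))).
Proof.
move=> [_ mf [M fM]]; apply: measurable_bounded_integrable => //; first exact: PT_lty.
exists M; split; first exact: num_real.
by move=> x Mx w _; apply: le_trans (ltW Mx); apply: le_trans (nc_Im _) (fM w).
Qed.

Lemma eq_cE f g : f =1 g -> E f = E g.
Proof. by move=> /funext->. Qed.

Lemma cE_cst z : E (fun=> z) = z.
Proof.
by rewrite cexpectationE !Rintegral_cst // PT1 /= !mulr1; case: z.
Qed.

Lemma cED f g : bounded_mfun f -> bounded_mfun g -> E (fun w => f w + g w) = E f + E g.
Proof.
move=> bf bg; rewrite !cexpectationE.
under eq_Rintegral do rewrite ReD.
under [X in _ +i* X]eq_Rintegral do rewrite ImD.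
rewrite !RintegralD //; try exact: bm_integrable_Re; exact: bm_integrable_Im.
Qed.

Lemma cEZ z f : bounded_mfun f -> E (fun w => z * f w) = z * E f.
Proof.
move=> bf; have iR := bm_integrable_Re bf; have iI := bm_integrable_Im bf.
have iZ (r : R) (u : T -> R) : P.-integrable setT (EFin \o u) -> P.-integrable setT (EFin \o (fun
    w => r * u w)).
  by move=> iu; apply: eq_integrable (integrableZl _ r iu).
rewrite !cexpectationE; apply: complexP => /=.
  under eq_Rintegral do rewrite ReM.
  rewrite RintegralB ?RintegralZl //; [by case: z|exact: iZ|exact: iZ].
under eq_Rintegral do rewrite ImM.
by rewrite RintegralD ?RintegralZl //; [case: z|exact: iZ|exact: iZ].
Qed.

Lemma cE_sum I (r : seq I) (F : I -> T -> R[i]) : (forall i, bounded_mfun (F i)) ->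
  E (fun w => \sum_(i <- r) F i w) = \sum_(i <- r) E (F i).
Proof.
move=> H; elim: r => [|i r IH].
  by rewrite big_nil -[RHS](cE_cst 0); apply: eq_cE => w; rewrite big_nil.
rewrite big_cons -IH -cED //; last exact: bm_sum.
by apply: eq_cE => w; rewrite big_cons.
Qed.

Lemma cE_conj f : bounded_mfun f -> E (fun w => (f w)^*) = (E f)^*.
Proof.
move=> bf; rewrite !cexpectationE; apply: complexP => /=.
  by apply: eq_Rintegral => w _; case: (f w).
rewrite -mulN1r -RintegralZl ?bm_integrable_Im //.
by apply: eq_Rintegral => w _; rewrite mulN1r; case: (f w).
Qed.

Lemma Re_cE_le f (M : R) : bounded_mfun f -> (forall w, Re (f w) <= M) -> Re (E f) <= M.
Proof.
move=> bf fM; rewrite cexpectationE /= -[leRHS]mulr1.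
have -> : M * 1 = \int[P]_(w in setT) M by rewrite Rintegral_cst // PT1.
apply: le_Rintegral => //; first exact: bm_integrable_Re.
by apply: (bm_integrable_Re (f := fun=> M%:C)); exact: bm_cst.
Qed.

(** Rotating [f] by the conjugate of its expectation reduces to a bound on a
    real part, so that no constant is lost. *)
Lemma nc_cE f (M : R) : bounded_mfun f -> (forall w, nc (f w) <= M) -> nc (E f) <= M.
Proof.
move=> bf fM; have [->|z0] := eqVneq (E f) 0.
  have [w _] : exists w : T, True.
    apply: contrapT => H; have := PT1; rewrite (_ : setT = set0); last first.
      by apply/seteqP; split => // x _; apply: H; exists x.
    by rewrite measure0 => /eqP; rewrite eqe eq_sym oner_eq0.
  by rewrite Normc.normc0; apply: le_trans (fM w); exact: nc_ge0.
have n0 : 0 < nc (E f).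
  by rewrite lt0r nc_ge0 andbT; apply: contra z0 => /eqP/Normc.eq0_normc/eqP.
rewrite -(ler_pM2l n0) -expr2.
have -> : nc (E f) ^+ 2 = Re ((E f)^* * E f) by rewrite conj_mul.
rewrite -cEZ //; apply: Re_cE_le; first exact: bmZ.
move=> w; apply: le_trans (ler_norm _) _; apply: le_trans (nc_Re _) _.
by rewrite ncM nc_conj ler_pM2l.
Qed.

Lemma cE_indic (B : set T) : measurable B -> E (fun w => (\1_B w : R)%:C) = (fine (P B))%:C.
Proof.
move=> mB; rewrite cexpectationE /=; apply: complexP => /=; last by rewrite Rintegral_cst // mul0r.
by rewrite /Rintegral integral_indic // setIT.
Qed.

End Expectation.

(** * Product formula for independent variables *)

Section IndicatorExtension.
Context (R : realType) (d : measure_display) (U : measurableType d).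
Variables (L : (U -> R[i]) -> R[i]) (C : R).
Hypothesis LD : forall f g, bounded_mfun f -> bounded_mfun g -> L (fun u => f u + g u) = L f + L g.
Hypothesis LZ : forall z f, bounded_mfun f -> L (fun u => z * f u) = z * L f.
Hypothesis LB : forall f M, bounded_mfun f -> (forall u, nc (f u) <= M) -> nc (L f) <= C * M.
Hypothesis LI : forall B, measurable B -> L (fun u => (\1_B u : R)%:C) = 0.

Lemma functional_sum0 I (r : seq I) (F : I -> U -> R[i]) :
  (forall i, bounded_mfun (F i)) -> (forall i, L (F i) = 0) -> L (fun u => \sum_(i <- r) F i u) = 0.
Proof.
move=> bF F0; elim: r => [|i r IH].
  rewrite (_ : (fun u => _) = fun u => 0 * (0 : R[i])); last by apply/funext => u;
      rewrite big_nil mulr0.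
  by rewrite LZ ?mul0r //; exact: bm_cst.
rewrite (_ : (fun u => _) = fun u => F i u + \sum_(j <- r) F j u); last by apply/funext => u;
    rewrite big_cons.
by rewrite LD ?F0 ?IH ?addr0 //; exact: bm_sum.
Qed.

Lemma bm_real (u : U -> R) (M : R) : measurable_fun setT u -> (forall x, `|u x| <= M) ->
  bounded_mfun (fun x => (u x)%:C).
Proof. by move=> mu uM; split=> //; exists M => w; rewrite nc_real. Qed.

(** A bounded measurable function is a uniform limit of the step functions
    that round its values down to multiples of [1 / N]. *)
Lemma functional_nonneg0 (u : U -> R) (M : R) : measurable_fun setT u ->
  (forall x, 0 <= u x) -> (forall x, u x <= M) -> L (fun x => (u x)%:C) = 0.
Proof.
move=> mu u0 uM.
suff H (N : nat) : (0 < N)%N -> nc (L (fun x => (u x)%:C)) * N%:R <= C.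
  apply: Normc.eq0_normc; apply/eqP; rewrite eq_le nc_ge0 andbT leNgt; apply/negP => L0.
  set l := nc _ in L0 H *; set N := (Num.truncn (C / l)).+1.
  have := H N isT; rewrite leNgt => /negP; apply.
  rewrite mulrC -ltr_pdivrMr //.
  exact: truncnS_gt.
move=> N0; have N0' : 0 < N%:R :> R by rewrite ltr0n.
set K := (Num.truncn (N%:R * M)).+1.
pose B (k : nat) := u @^-1` `[k%:R / N%:R, k.+1%:R / N%:R[%classic.
have mB k : measurable (B k) by rewrite -[B k]setTI; apply: mu => //; exact: measurable_itv.
pose s x := \sum_(k < K) (k%:R / N%:R)%:C * (\1_(B k) x : R)%:C.
have mem_B k x : (x \in B k) = (k%:R <= N%:R * u x < k.+1%:R).
  by apply/idP/idP; rewrite inE /B /= in_itv /= ler_pdivrMr // ltr_pdivlMr // mulrC.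
have bs : bounded_mfun s by apply: bm_sum => k _; apply: bmZ; exact: bm_indic.
have Ls : L s = 0.
  apply: functional_sum0 => k; first by apply: bmZ; exact: bm_indic.
  by rewrite LZ ?LI ?mulr0 //; exact: bm_indic.
have bu : bounded_mfun (fun x => (u x)%:C).
  by apply: (@bm_real u M) => // x; rewrite ger0_norm.
have -> : L (fun x => (u x)%:C) = L (fun x => (u x)%:C + (-1) * s x).
  by rewrite LD ?LZ ?Ls ?mulr0 ?addr0 //; exact: bmZ.
rewrite -ler_pdivlMr //; apply: LB; first by apply: bmD => //; exact: bmZ.
move=> x; set k := Num.truncn (N%:R * u x).
have Nu0 : 0 <= N%:R * u x by rewrite mulr_ge0.
have kK : (k < K)%N.
  by rewrite ltnS; apply: le_truncn; rewrite ler_pM2l.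
have /andP[k1 k2] := truncn_itv Nu0; rewrite -/k in k1 k2.
have -> : s x = (k%:R / N%:R)%:C.
  rewrite /s (bigD1 (Ordinal kK)) //= indicE mem_B k1 k2 mulr1 big1 ?addr0 // => j /eqP jk.
  rewrite indicE mem_B; case Hj : (_ <= _ < _); last by rewrite mulr0.
  case: jk; apply: val_inj => /=; symmetry; exact: truncn_def.
rewrite (_ : _ + _ = (u x - k%:R / N%:R)%:C); last by rewrite mulN1r -rmorphN -rmorphD.
rewrite nc_real -[u x](mulKf (lt0r_neq0 N0')) [_^-1 * _]mulrC -mulrBl normrM.
rewrite [X in _ * X]ger0_norm ?invr_ge0 ?ler0n // ler_pdivrMr // mulVf ?gt_eqF //.
by rewrite ger0_norm ?subr_ge0 // lerBlDl; move: k2; rewrite -natr1 => /ltW.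
Qed.

Lemma functional_real0 (u : U -> R) (M : R) : measurable_fun setT u ->
  (forall x, `|u x| <= M) -> L (fun x => (u x)%:C) = 0.
Proof.
move=> mu uM.
have bM : bounded_mfun (fun=> M%:C : R[i]) := bm_cst _ _.
have LM : L (fun=> M%:C) = 0.
  rewrite (_ : (fun=> _) = (fun x => M%:C * (\1_(@setT U) x : R)%:C)).
    by rewrite LZ ?LI ?mulr0 //; apply: bm_indic.
  by apply/funext => x; rewrite indicE in_setT mulr1.
have -> : L (fun x => (u x)%:C) = L (fun x => (u x + M)%:C).
  rewrite (_ : (fun x => (u x + M)%:C) = fun x => (u x)%:C + M%:C).
    by rewrite LD ?LM ?addr0 //; exact: (@bm_real u M).
  by apply/funext => x; rewrite rmorphD.
apply: (@functional_nonneg0 (fun x => u x + M) (M + M)) => [|x|x].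
- by apply: measurable_funD => //; exact: measurable_cst.
- by have := uM x; rewrite ler_norml => /andP[H _]; rewrite -lerBlDr sub0r.
- by rewrite lerD2r (le_trans (ler_norm _)).
Qed.

(** A linear functional which is bounded for the sup norm is determined by its
    values on indicators; product formulas and equalities of laws, given on events,
    extend in this way to bounded functions. *)
Lemma functional0 f : bounded_mfun f -> L f = 0.
Proof.
move=> bf; have [mR mI [M fM]] := bf.
have bR : bounded_mfun (fun x => (Re (f x))%:C).
  by apply: (@bm_real _ M) => // x; apply: le_trans (nc_Re _) (fM x).
have bI : bounded_mfun (fun x => (Im (f x))%:C).
  by apply: (@bm_real _ M) => // x; apply: le_trans (nc_Im _) (fM x).
rewrite (_ : f = fun x => (Re (f x))%:C + 'i%C * (Im (f x))%:C); last first.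
  by apply/funext => x; rewrite -complexE.
rewrite LD ?LZ //; last exact: bmZ.
rewrite (@functional_real0 _ M) // ?(@functional_real0 _ M) // ?mulr0 ?addr0 // => x.
  by apply: le_trans (nc_Im _) (fM x).
by apply: le_trans (nc_Re _) (fM x).
Qed.

End IndicatorExtension.

Section Independence.
Context (R : realType) (d : measure_display) (T : measurableType d) (P : probability T R).
Local Notation E := (cexpectation P).

Lemma bm_law (X : T -> R[i]) (phi : R * R -> R[i]) : is_crv X -> bounded_mfun phi ->
  bounded_mfun (fun w => phi (reim (X w))).
Proof. by move=> mX bphi; apply: (bm_comp mX bphi). Qed.

(** Indicators are replaced by general functions one index at a time: in each
    coordinate both sides are bounded linear functionals ([functional0]). *)
Lemma cE_prod_independent (I : finType) (X : I -> T -> R[i]) (phi : I -> R * R -> R[i]) :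
  (forall j, is_crv (X j)) -> mutually_independent P X -> (forall j, bounded_mfun (phi j)) ->
  E (fun w => \prod_j phi j (reim (X j w))) = \prod_j E (fun w => phi j (reim (X j w))).
Proof.
move=> mX indep.
suff H (J : {set I}) (f : I -> R * R -> R[i]) : (forall j, bounded_mfun (f j)) ->
    (forall j, j \notin J -> exists2 B, measurable B & f j = fun u => (\1_B u : R)%:C) ->
    E (fun w => \prod_j f j (reim (X j w))) = \prod_j E (fun w => f j (reim (X j w))).
  by move=> bphi; apply: (H [set: I]%SET) => // j; rewrite inE.
have [n] := ubnP #|J|; elim: n J f => // n IH J f nJ bf fI.
have [J0|[j jJ]] := set_0Vmem J.
  have /choice[B HB] : forall j, exists B, measurable B /\ f j = fun u => (\1_B u : R)%:C.
    by move=> j; have [|B mB ->] := fI j; [rewrite J0 inE|exists B].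
  have HP := indep [set: I]%SET B (fun j _ => (HB j).1).
  transitivity (fine (P (\bigcap_(j in [set` [set: I]%SET]) ((reim \o X j) @^-1` B j))))%:C.
    rewrite -cE_indic; last first.
      apply: fin_bigcap_measurable => [|j _]; first exact: finite_finset.
      by rewrite -[X in measurable X]setTI; apply: mX => //; exact: (HB j).1.
    apply: eq_cE => w; rewrite indicE; case: (boolP (_ \in _)) => [|].
      rewrite in_setE => Hw; apply: big1 => j _; rewrite (HB j).2 indicE mem_set //.
      by apply: Hw; rewrite /= inE.
    move=> Hw; have [j Hj] : exists j, ~ B j (reim (X j w)).
      by apply: contrapT => N; move/negP: Hw; apply; rewrite in_setE => j _; apply: contrapT =>
          Nj; apply: N; exists j.
    by rewrite (bigD1 j) //= (HB j).2 indicE memNset // mul0r.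
  rewrite HP.
  have Ef j : E (fun w => f j (reim (X j w))) = (fine (P ((reim \o X j) @^-1` B j)))%:C.
    rewrite -cE_indic; first by apply: eq_cE => w; rewrite (HB j).2.
    by rewrite -[X in measurable X]setTI; apply: mX => //; exact: (HB j).1.
  under [RHS]eq_bigr do rewrite Ef.
  rewrite -rmorph_prod; congr (_%:C).
  rewrite (eq_bigr (fun j => (fine (P ((reim \o X j) @^-1` B j)))%:E)); last first.
    move=> j _; rewrite fineK //; apply: fin_num_measure.
    by rewrite -[X in measurable X]setTI; apply: mX => //; exact: (HB j).1.
  by rewrite prodEFin /=; apply: eq_bigl => j; rewrite inE.
pose c := \prod_(i | i != j) E (fun w => f i (reim (X i w))).
pose G w := \prod_(i | i != j) f i (reim (X i w)).
have bG : bounded_mfun G by apply: bm_prod => i _; apply: bm_law.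
(* The defect of the product formula as a function of the coordinate [j]. *)
pose L (g : R * R -> R[i]) := E (fun w => g (reim (X j w)) * G w) - E (fun w =>
    g (reim (X j w))) * c.
suff : L (f j) = 0.
  move=> /eqP; rewrite subr_eq0 => /eqP; rewrite -/c (bigD1 j) //= -/c => <-.
  by apply: eq_cE => w; rewrite (bigD1 j).
have [MG GM] : exists M, forall w, nc (G w) <= M by case: bG.
have bgG g : bounded_mfun g -> bounded_mfun (fun w => g (reim (X j w)) * G w).
  by move=> bg; apply: bmM => //; exact: bm_law.
apply: (@functional0 R _ _ L (MG + nc c)) => // [g h bg bh|z g bg|g M bg gM|B mB]; rewrite /L.
- rewrite (eq_cE P (g := fun w => g (reim (X j w)) * G w + h (reim (X j w)) * G w)); last first.
    by move=> w; rewrite mulrDl.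
  rewrite (cED P (bgG _ bg) (bgG _ bh)) (cED P (bm_law (mX j) bg) (bm_law (mX j) bh)); ring.
- rewrite (eq_cE P (g := fun w => z * (g (reim (X j w)) * G w))); last first.
    by move=> w; rewrite mulrA.
  rewrite (cEZ P z (bgG _ bg)) (cEZ P z (bm_law (mX j) bg)); ring.
- have gE : nc (E (fun w => g (reim (X j w)))) <= M.
    by apply: nc_cE => [|w]; [exact: bm_law|].
  have M0 : 0 <= M by apply: le_trans gE; exact: nc_ge0.
  have GE : nc (E (fun w => g (reim (X j w)) * G w)) <= MG * M.
    apply: nc_cE => [|w]; first exact: bgG.
    by rewrite ncM mulrC; apply: ler_pM; rewrite ?nc_ge0.
  apply: le_trans (ncD _ _) _.
  rewrite mulrDl; apply: lerD => //.
  have -> : nc (- (E (fun w => g (reim (X j w))) * c)) = nc c * nc (E (fun w => g (reim (X j w)))).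
    by rewrite normcN ncM mulrC.
  by apply: ler_wpM2l => //; exact: nc_ge0.
pose f' i := if i == j then (fun u => (\1_B u : R)%:C) else f i.
have Hj : f' j = fun u => (\1_B u : R)%:C by rewrite /f' eqxx.
have Hi i : i != j -> f' i = f i by rewrite /f' => /negbTE->.
have := IH (J :\ j)%SET f'; rewrite (bigD1 j) //= Hj.
have -> : \prod_(i | i != j) E (fun w => f' i (reim (X i w))) = c.
  by apply: eq_bigr => i ij; rewrite Hi.
rewrite (eq_cE P (g := fun w => (\1_B (reim (X j w)) : R)%:C * G w)); last first.
  by move=> w; rewrite (bigD1 j) //= Hj; congr (_ * _); apply: eq_bigr => i ij; rewrite Hi.
move=> ->; rewrite ?subrr //.
- by rewrite -ltnS (leq_trans _ nJ) // ltnS [leqRHS](cardsD1 j) jJ.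
- by move=> i; rewrite /f'; case: eqP => // _; exact: bm_indic.
move=> i; rewrite in_setD1 negb_and negbK /f'; case: eqP => [_ _|_ /= iJ]; last exact: fI.
by exists B.
Qed.

End Independence.

(** * Mixed moments of a unimodular variable *)

Lemma cE_same_law (R : realType) (d1 d2 : measure_display) (T1 : measurableType d1)
    (T2 : measurableType d2) (P1 : probability T1 R) (P2 : probability T2 R)
    (X1 : T1 -> R[i]) (X2 : T2 -> R[i]) (phi : R * R -> R[i]) :
  is_crv X1 -> is_crv X2 -> same_law P1 X1 P2 X2 -> bounded_mfun phi ->
  cexpectation P1 (fun w => phi (reim (X1 w))) = cexpectation P2 (fun w => phi (reim (X2 w))).
Proof.
move=> m1 m2 law bphi; apply/eqP; rewrite -subr_eq0; apply/eqP.
apply: (@functional0 R _ _ (fun g => cexpectation P1 (fun w => g (reim (X1 w))) -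
  cexpectation P2 (fun w => g (reim (X2 w)))) 2) => // [f g bf bg|z f bf|f M bf fM|B mB].
- rewrite (cED P1 (bm_law m1 bf) (bm_law m1 bg)) (cED P2 (bm_law m2 bf) (bm_law m2 bg)); ring.
- rewrite (cEZ P1 z (bm_law m1 bf)) (cEZ P2 z (bm_law m2 bf)); ring.
- apply: le_trans (ncD _ _) _; rewrite normcN mulr_natl mulr2n.
  by apply: lerD; apply: nc_cE => //; exact: bm_law.
have mp d (T : measurableType d) (X : T -> R[i]) : is_crv X -> measurable ((reim \o X) @^-1` B).
  by move=> mX; rewrite -[X in measurable X]setTI; apply: mX.
rewrite (cE_indic P1 (mp _ _ _ m1)) (cE_indic P2 (mp _ _ _ m2)) law //.
exact: subrr.
Qed.

Section UnitVariable.
Variable R : realType.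

(** Off the unit circle the value 1 is arbitrary; the point is to have
    modulus 1 everywhere, so that products are bounded without exceptional sets. *)
Definition unitize (u : R * R) : R[i] :=
  if u.1 ^+ 2 + u.2 ^+ 2 == 1 then u.1 +i* u.2 else 1.

Lemma nc_unitize u : nc (unitize u) = 1.
Proof. by rewrite /unitize; case: eqP => [H|_] /=; rewrite ?H ?expr1n ?expr0n ?addr0 sqrtr1. Qed.

Lemma unitize_conj u : (unitize u)^* * unitize u = 1.
Proof. by rewrite conj_mul nc_unitize expr1n. Qed.

Lemma bm_unitize : bounded_mfun unitize.
Proof.
have mt : measurable_fun setT (fun u : R * R => u.1 ^+ 2 + u.2 ^+ 2 == 1).
  apply: measurable_fun_eqr; last exact: measurable_cst.
  by apply: measurable_funD; apply: measurable_funX; [exact: measurable_fst|exact: measurable_snd].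
split; last by exists 1 => u; rewrite nc_unitize.
- rewrite (_ : (fun w => _) = fun u : R * R => if u.1 ^+ 2 + u.2 ^+ 2 == 1 then u.1 else 1).
    apply: measurable_fun_ifT => //; exact: measurable_fst.
  by apply/funext => u; rewrite /unitize; case: ifP.
- rewrite (_ : (fun w => _) = fun u : R * R => if u.1 ^+ 2 + u.2 ^+ 2 == 1 then u.2 else 0).
    apply: measurable_fun_ifT => //; exact: measurable_snd.
  by apply/funext => u; rewrite /unitize; case: ifP.
Qed.

Lemma unitize_id (z : R[i]) : `|z| = 1 -> unitize (reim z) = z.
Proof.
rewrite nc_norm => -[nz]; rewrite /unitize /reim /= -nc_sqr nz expr1n eqxx.
by case: z {nz}.
Qed.

Definition monomial (u v : nat) (t : R * R) : R[i] := unitize t ^+ u * (unitize t)^* ^+ v.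

Lemma bm_monomial u v : bounded_mfun (monomial u v).
Proof.
apply: bmM; first exact: bm_exp bm_unitize.
exact: bm_exp (bm_conj bm_unitize).
Qed.

Lemma nc_monomial u v t : nc (monomial u v t) = 1.
Proof.
have nX z k : nc z = 1 -> nc (z ^+ k) = 1 :> R.
  by move=> z1; elim: k => [|k IH]; rewrite ?expr0 ?exprS ?ncM ?Normc.normc1 ?z1 ?IH ?mulr1.
by rewrite ncM !nX ?nc_conj ?nc_unitize ?mulr1.
Qed.

Lemma monomial_mul u v u' v' t : monomial u v t * monomial u' v' t = monomial (u + u') (v + v') t.
Proof. by rewrite /monomial !exprD; ring. Qed.

Lemma monomial_diag u t : monomial u u t = 1.
Proof. by rewrite /monomial -exprMn mulrC unitize_conj expr1n. Qed.

Context (d0 : measure_display) (T0 : measurableType d0) (P0 : probability T0 R) (xi : T0 -> R[i]).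
Hypothesis xi_rv : is_crv xi.
Hypothesis xi_int : cintegrable P0 xi.
Hypothesis xi_centered : cexpectation P0 xi = 0.
Hypothesis xi_mod1 : {ae P0, forall w, `|xi w| = 1}.

Definition mixed_moment (u v : nat) : R[i] := cexpectation P0 (fun w => monomial u v (reim (xi w))).

Lemma mixed_moment_diag u : mixed_moment u u = 1.
Proof. by rewrite /mixed_moment (eq_cE _ (g := fun=> 1)) ?cE_cst // => w;
    rewrite monomial_diag. Qed.

Lemma cE_unitize : cexpectation P0 (fun w => unitize (reim (xi w))) = 0.
Proof.
rewrite -xi_centered !cexpectationE.
have [_ _ _] := bm_law xi_rv bm_unitize; have [bR bI _] := bm_law xi_rv bm_unitize.
have [iR iI] := xi_int.
congr (_ +i* _); rewrite /Rintegral; congr fine; apply: ae_eq_integral => //.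
- exact/measurable_EFinP.
- exact: measurable_int iR.
- by apply: filterS xi_mod1 => w /unitize_id->.
- exact/measurable_EFinP.
- exact: measurable_int iI.
- by apply: filterS xi_mod1 => w /unitize_id->.
Qed.

Lemma mixed_moment_up u : mixed_moment u.+1 u = 0.
Proof.
rewrite -cE_unitize; apply: eq_cE => w.
by rewrite -addn1 -[u in X in monomial _ X]addn0 -monomial_mul monomial_diag mul1r /monomial
    expr0 mulr1 expr1.
Qed.

Lemma mixed_moment_down u : mixed_moment u u.+1 = 0.
Proof.
have -> : mixed_moment u u.+1 = (mixed_moment u.+1 u)^*.
  rewrite -cE_conj; last exact: bm_law xi_rv (bm_monomial _ _).
  by apply: eq_cE => w; rewrite /monomial rmorphM !rmorphXn /= conjcK mulrC.
by rewrite mixed_moment_up conjc0.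
Qed.

Lemma mixed_moment_le1 u v : `|mixed_moment u v| <= 1.
Proof.
rewrite nc_norm -[1]/(1%:C) lecR; apply: nc_cE; first exact: bm_law xi_rv (bm_monomial _ _).
by move=> w; rewrite nc_monomial.
Qed.

End UnitVariable.

(** * Expectation and covariance of cyclic products *)

Section CyclicExpectation.
Context (R : realType) (d0 : measure_display) (T0 : measurableType d0) (P0 : probability T0 R)
  (xi : T0 -> R[i]) (xi_rv : is_crv xi) (xi_int : cintegrable P0 xi)
  (xi_centered : cexpectation P0 xi = 0) (xi_mod1 : {ae P0, forall w, `|xi w| = 1})
  (d : measure_display) (T : measurableType d) (P : probability T R)
  (n m k : nat) (X : 'I_m -> 'I_k -> 'I_n -> T -> R[i])
  (X_iid : iid_copies P0 xi P (fun t : 'I_m * 'I_k * 'I_n => X t.1.1 t.1.2 t.2)).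

Local Notation E := (cexpectation P).
Local Notation mu := (mixed_moment P0 xi).

Definition yentry (w : T) a l j : R[i] := unitize (reim (X a l j w)).

Lemma X_rv a l j : is_crv (X a l j).
Proof. by have [H _ _] := X_iid; apply: (H (a, l, j)). Qed.

Lemma cE_monomials (u v : 'I_m * 'I_k * 'I_n -> nat) :
  E (fun w => \prod_t (yentry w t.1.1 t.1.2 t.2 ^+ u t * (yentry w t.1.1 t.1.2 t.2)^* ^+ v t)) =
  \prod_t mu (u t) (v t).
Proof.
have [mX law ind] := X_iid.
apply: etrans (cE_prod_independent (phi := fun t => monomial (u t) (v t)) mX ind _) _ => [t|].
  exact: bm_monomial.
by apply: eq_bigr => t _; apply: cE_same_law => //; exact: bm_monomial.
Qed.

Lemma bm_monomials (u v : 'I_m * 'I_k * 'I_n -> nat) :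
  bounded_mfun (fun w => \prod_t (yentry w t.1.1 t.1.2 t.2 ^+ u t * (yentry w t.1.1 t.1.2 t.2)^*
      ^+ v t)).
Proof.
apply: bm_prod => t _.
exact: (bm_law (X_rv _ _ _) (bm_monomial _ _ _)).
Qed.

(** The expectation of the cyclic product for one tensor factor. *)
Definition normalized_moment p (s : seq 'I_m) : R[i] := n%:R^-1 ^+ p * moment_sum mu n p s.

Lemma sum_prod_wmoment p (s : seq 'I_m) :
  \sum_(i : {ffun 'I_k -> p.-tuple 'I_n}) \prod_t mu (up_count s i t) (down_count s i t) =
  moment_sum mu n p s ^+ k.
Proof.
rewrite /moment_sum -[k in RHS]card_ord -prodr_const bigA_distr_bigA /=.
by apply: eq_bigr => i _; rewrite prod_triple; apply: eq_bigr => l _; apply: eq_bigr => -[].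
Qed.

Lemma cE_cyclic p (s : p.-tuple 'I_m) :
  E (fun w => cyclic (yentry w) s) = normalized_moment p s ^+ k.
Proof.
under eq_fun do rewrite cyclic_expand.
rewrite cEZ; last by apply: bm_sum => i _; exact: bm_monomials.
rewrite cE_sum => [|i]; last exact: bm_monomials.
under eq_bigr do rewrite cE_monomials.
by rewrite sum_prod_wmoment exprMn.
Qed.

(** At each entry one of the two monomials is trivial, so the mixed moments
    factor. *)
Lemma cE_cyclic_disjoint p q (s : p.-tuple 'I_m) (t : q.-tuple 'I_m) :
  ~~ has [in tval s] t ->
  E (fun w => cyclic (yentry w) s * cyclic (yentry w) t) =
  normalized_moment p s ^+ k * normalized_moment q t ^+ k.
Proof.
move=> dis.
rewrite (eq_cE _ (g := fun w => (n%:R^-1 ^+ p) ^+ k * (n%:R^-1 ^+ q) ^+ k *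
  \sum_(i : {ffun 'I_k -> p.-tuple 'I_n}) \sum_(j : {ffun 'I_k -> q.-tuple 'I_n})
    \prod_z (yentry w z.1.1 z.1.2 z.2 ^+ (up_count s i z + up_count t j z)%N *
             (yentry w z.1.1 z.1.2 z.2)^* ^+ (down_count s i z + down_count t j z)%N))); last first.
  move=> w; rewrite !cyclic_expand mulrACA mulr_suml; congr (_ * _).
  apply: eq_bigr => i _; rewrite mulr_sumr; apply: eq_bigr => j _.
  by rewrite -big_split; apply: eq_bigr => z _; rewrite !exprD mulrACA.
rewrite cEZ; last first.
  by apply: bm_sum => i _; apply: bm_sum => j _; exact: bm_monomials.
rewrite cE_sum => [|i]; last by apply: bm_sum => j _; exact: bm_monomials.
rewrite !exprMn -!sum_prod_wmoment [RHS]mulrACA; congr (_ * _).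
rewrite mulr_suml; apply: eq_bigr => i _.
rewrite cE_sum => [|j]; last exact: bm_monomials.
rewrite mulr_sumr; apply: eq_bigr => j _.
rewrite cE_monomials -big_split; apply: eq_bigr => -[[a l] b] _ /=.
have zero r (z : r.-tuple 'I_m) (f : {ffun 'I_k -> r.-tuple 'I_n}) : a \notin tval z ->
    up_count z f (a, l, b) = 0%N /\ down_count z f (a, l, b) = 0%N.
  by move=> az; rewrite /up_count /down_count /ups /downs /= !count_zip_notin ?mem_rot ?az.
have [sa|/(zero _ _ i)[-> ->]] := boolP (a \in tval s); last first.
  by rewrite !add0n mixed_moment_diag // mul1r.
have /(zero _ _ j)[-> ->] : a \notin tval t.
  by apply: contraNN dis => ta; apply/hasP; exists a.
by rewrite !addn0 mixed_moment_diag // mulr1.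
Qed.

Lemma bm_cyclic (s : seq 'I_m) : bounded_mfun (fun w => cyclic (yentry w) s).
Proof.
apply: bm_prod => e _; apply: bm_prod => l _; apply: bmZ; apply: bm_sum => j _.
apply: bmM; last exact: bm_law (X_rv _ _ _) (bm_unitize _).
exact: bm_conj (bm_law (X_rv _ _ _) (bm_unitize _)).
Qed.

Hypothesis n_gt0 : (0 < n)%N.
Local Notation nu := (n%:R^-1 : R).

Lemma nu_ge0 : 0 <= nu. Proof. by rewrite invr_ge0 ler0n. Qed.
Lemma nu_le1 : nu <= 1. Proof. by rewrite invf_le1 ?ltr0n // ler1n. Qed.
Lemma natr_nu : n%:R * nu = 1. Proof. by rewrite divff // pnatr_eq0 -lt0n. Qed.

Lemma natC N : (N%:R)%:C = N%:R :> R[i].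
Proof. exact: (rmorph_nat (real_complex R)). Qed.

Lemma nu_C : nu%:C = n%:R^-1 :> R[i].
Proof. by rewrite (fmorphV (real_complex R)) (rmorph_nat (real_complex R)). Qed.

Lemma nc_exp (z : R[i]) j : nc (z ^+ j) = nc z ^+ j.
Proof. by elim: j => [|j IH]; rewrite ?expr0 ?Normc.normc1 // !exprS ncM IH. Qed.

Lemma nu_shift p s : (s <= p.+1)%N -> nu ^+ p * (n ^ (p.+1 - s))%N%:R = n%:R * nu ^+ s.
Proof.
move=> sp; have -> : nu ^+ p = n%:R * nu ^+ p.+1 by rewrite exprS mulrA natr_nu mul1r.
rewrite -{1}(subnK sp) exprD natrX -mulrA [X in _ * X]mulrAC -exprMn.
by rewrite [nu * _]mulrC natr_nu expr1n mul1r.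
Qed.

Lemma nc_normalized p (s : seq 'I_m) :
  nc (normalized_moment p s) = nu ^+ p * nc (moment_sum mu n p s).
Proof.
by rewrite ncM nc_exp -(rmorph_nat (real_complex R)) -fmorphV nc_real ger0_norm.
Qed.

Lemma nval_le p (s : p.-tuple 'I_m) : (nval s <= p)%N.
Proof. by rewrite -[X in (_ <= X)%N](size_tuple s) size_undup. Qed.

Let le_nc (z : R[i]) N : `|z| <= N%:R -> nc z <= N%:R.
Proof. by rewrite nc_norm -(rmorph_nat (real_complex R)) lecR. Qed.

Section Bounds.
Variables (p : nat) (s : p.-tuple 'I_m).
Hypothesis p_gt0 : (0 < p)%N.

Lemma normalized_planar i0 : planar s i0 ->
  normalized_moment p s = (n%:R * nu ^+ nval s)%:C.
Proof.
move=> P0s; rewrite /normalized_moment (moment_sum_planar _ _ _ _ p_gt0 P0s).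
- rewrite -(nu_shift (leqW (nval_le s))) -nu_C -natC.
  by rewrite -(rmorphXn (real_complex R)) -(rmorphM (real_complex R)).
- exact: mixed_moment_diag.
- exact: mixed_moment_up.
- exact: mixed_moment_down.
Qed.

Lemma normalized_thin : thin s ->
  nc (normalized_moment p s) <= (p ^ p)%N%:R * nu ^+ nval s.
Proof.
move=> Ts; rewrite nc_normalized.
have H : nc (moment_sum mu n p s) <= (p ^ p * n ^ (p - nval s))%N%:R.
  apply: le_nc; apply: moment_sum_thin => //.
  - exact: mixed_moment_up.
  - exact: mixed_moment_down.
  - exact: mixed_moment_le1.
apply: le_trans (ler_wpM2l _ H) _; first by rewrite exprn_ge0 // nu_ge0.
rewrite natrM mulrCA ler_wpM2l // natrX -{1}(subnK (nval_le s)) exprD mulrAC -exprMn.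
by rewrite [nu * _]mulrC natr_nu expr1n mul1r.
Qed.

Lemma normalized_bound :
  nc (normalized_moment p s) <= (p ^ p)%N%:R * (n%:R * nu ^+ nval s).
Proof.
rewrite nc_normalized.
have H : nc (moment_sum mu n p s) <= (p ^ p * n ^ (p.+1 - nval s))%N%:R.
  apply: le_nc; apply: moment_sum_bound => //.
  - exact: mixed_moment_diag.
  - exact: mixed_moment_up.
  - exact: mixed_moment_down.
  - exact: mixed_moment_le1.
apply: le_trans (ler_wpM2l _ H) _; first by rewrite exprn_ge0 // nu_ge0.
by rewrite natrM mulrCA nu_shift // leqW // nval_le.
Qed.

End Bounds.

(** The shared value [a] is counted twice on the right. *)
Lemma nval_cat_shared (A : eqType) (a : A) (s t : seq A) : a \in s -> a \in t ->
  (nval (s ++ t) < nval s + nval t)%N.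
Proof.
move=> sa ta; have : (nval (s ++ t) <= size (undup s ++ rem a (undup t)))%N.
  apply: uniq_leq_size; first exact: undup_uniq.
  move=> x; rewrite mem_undup !mem_cat mem_undup => /orP[->//|xt].
  rewrite (mem_rem_uniq _ (undup_uniq _)) inE mem_undup xt andbT /=.
  by case: eqP => [->|]; rewrite ?sa ?orbT.
have t0 : (0 < nval t)%N by rewrite /nval; case: (undup t) (mem_undup t a); rewrite ta.
rewrite size_cat size_rem ?mem_undup // => H; apply: leq_ltn_trans H _.
by rewrite -/(nval s) -/(nval t) ltn_add2l prednK.
Qed.

Definition covariance_bound p (s : seq 'I_m) : R :=
  ((p + p) ^ (p + p))%N%:R * (n%:R * nu ^+ nval s).

(** The conjugate of the second product is the product of the reversed word.
    Either the words have no common letter and the difference is 0, or they are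
    rotated to start with a common letter and spliced; the product of the two
    expectations obeys the same bound because the shared letter is counted twice. *)
Lemma covariance_le p (s t : p.-tuple 'I_m) : (0 < p)%N ->
  nc (E (fun w => cyclic (yentry w) s * conjc (cyclic (yentry w) t)) -
      E (fun w => cyclic (yentry w) s) * conjc (E (fun w => cyclic (yentry w) t)))
  <= 2 * covariance_bound p (s ++ t) ^+ k.
Proof.
move=> p_gt0; set B := covariance_bound p (s ++ t).
have B0 : 0 <= B by rewrite mulr_ge0 // mulr_ge0 // exprn_ge0 // nu_ge0.
have Ec : (E (fun w => cyclic (yentry w) t))^* = E (fun w => cyclic (yentry w) (rev t)).
  by rewrite -cE_conj; [apply: eq_cE => w; rewrite cyclic_conj|exact: bm_cyclic].
rewrite (eq_cE _ (g := fun w => cyclic (yentry w) s * cyclic (yentry w) (rev t))); last first.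
  by move=> w; rewrite cyclic_conj.
rewrite Ec; pose t' := [tuple of rev t]; rewrite -[rev t]/(tval t').
have [/hasP[a at' sa]|dis] := boolP (has [in tval s] (tval t')); last first.
  rewrite (cE_cyclic_disjoint dis) !cE_cyclic subrr Normc.normc0.
  by rewrite mulr_ge0 // exprn_ge0.
rewrite mulr_natl mulr2n; apply: le_trans (ncD _ _) _; rewrite normcN; apply: lerD.
  have [i s1 Es1] := rot_to sa; have [j t1 Et1] := rot_to at'.
  pose g := [tuple of [tuple of rot i s] ++ [tuple of rot j t']].
  rewrite (eq_cE _ (g := fun w => cyclic (yentry w) g)); last first.
    move=> w; rewrite -(cyclic_rot _ i s) -(cyclic_rot _ j t') /= Es1.
    by rewrite -[rot j (rev t)]/(rot j t') Et1 cyclic_cat.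
  rewrite cE_cyclic nc_exp; apply: lerXn2r; rewrite ?nnegrE ?nc_ge0 //.
  apply: le_trans (normalized_bound g _) _; first by rewrite addn_gt0 p_gt0.
  rewrite /B /covariance_bound (_ : nval g = nval (s ++ t)) //.
  apply: eq_nval => x; rewrite -[LHS]/(x \in rot i s ++ rot j (rev t)).
  by rewrite mem_cat !mem_rot mem_rev [RHS]mem_cat.
rewrite !cE_cyclic -exprMn nc_exp; apply: lerXn2r; rewrite ?nnegrE ?nc_ge0 //.
rewrite ncM; apply: le_trans (ler_pM _ _ (normalized_bound s p_gt0) (normalized_bound t' p_gt0)) _;
  rewrite ?nc_ge0 //.
rewrite mulrACA /B /covariance_bound; apply: ler_pM; rewrite ?mulr_ge0 ?exprn_ge0 ?nu_ge0 //.
  by rewrite -natrM ler_nat expnD leq_mul // leq_exp2r // leq_addr.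
have sh : (nval (tval s ++ tval t) < nval s + nval t')%N.
  have -> : nval t' = nval t by apply: eq_nval => x; rewrite mem_rev.
  by apply: nval_cat_shared sa _; rewrite -mem_rev.
rewrite mulrACA -exprD -(subnK sh) exprD.
have -> : n%:R * n%:R * (nu ^+ (nval s + nval t' - (nval (tval s ++ tval t)).+1) * nu ^+ (nval
    (tval s ++ tval t)).+1) =
   nu ^+ (nval s + nval t' - (nval (tval s ++ tval t)).+1) * (n%:R * nu ^+ nval (tval s ++ tval
       t)) * (n%:R * nu).
  by rewrite exprS; ring.
rewrite natr_nu mulr1 ler_piMl ?mulr_ge0 ?exprn_ge0 ?nu_ge0 //.
by rewrite exprn_ile1 ?nu_ge0 ?nu_le1.
Qed.

End CyclicExpectation.

(** * Limits of the sums of weights *)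

Lemma weighted_sum (K : numDomainType) (q m : nat) (w : 'I_m -> K) (B a : K) :
  (0 < q)%N -> 0 <= a -> (forall j, 0 <= w j) ->
  (forall d, (d <= q)%N -> \sum_j w j ^+ d <= B) ->
  \sum_(g : q.-tuple 'I_m) (\prod_(x <- g) w x) * a ^+ nval g <=
  \sum_(s < q.+1) (s ^ q)%N%:R * (a * B) ^+ s.
Proof.
move=> q0 a0 w0 wB.
have nq (g : q.-tuple 'I_m) : (nval g < q.+1)%N.
  by rewrite ltnS -[X in (_ <= X)%N](size_tuple g) size_undup.
rewrite (partition_big (fun g : q.-tuple 'I_m => Ordinal (nq g)) predT) //=.
apply: ler_sum => s _.
apply: (@le_trans _ _ (\sum_(g : q.-tuple 'I_m | (nval g <= s)%N) (\prod_(x <- g) w x) * a ^+ s)).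
  rewrite big_mkcond [leRHS]big_mkcond; apply: ler_sum => g _.
  case: eqP => [<- /=|_]; first by rewrite leqnn.
  by case: ifP => // _; rewrite mulr_ge0 ?exprn_ge0 // prodr_ge0.
rewrite -mulr_suml exprMn [a ^+ s * _]mulrC mulrA ler_wpM2r ?exprn_ge0 //.
exact: few_values_sum.
Qed.

Section RealLimits.
Variable R : realType.

Lemma cvg_invn : (n%:R^-1 : R) @[n --> \oo] --> (0 : R).
Proof. by rewrite -cvg_shiftS; exact: cvg_harmonic. Qed.

Lemma cvg_sum_fin I (r : seq I) (Q : pred I) (f : I -> nat -> R) (l : I -> R) :
  (forall i, Q i -> f i n @[n --> \oo] --> l i) ->
  (\sum_(i <- r | Q i) f i n) @[n --> \oo] --> \sum_(i <- r | Q i) l i.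
Proof.
move=> H; elim: r => [|i r IH].
  by rewrite big_nil; under eq_fun do rewrite big_nil; exact: cvg_cst.
rewrite big_cons; under eq_fun do rewrite big_cons.
by case: (Q i) (H i) => [/(_ isT) Hi|//]; exact: cvgD.
Qed.

Lemma cvg_prod_fin I (r : seq I) (Q : pred I) (f : I -> nat -> R) (l : I -> R) :
  (forall i, Q i -> f i n @[n --> \oo] --> l i) ->
  (\prod_(i <- r | Q i) f i n) @[n --> \oo] --> \prod_(i <- r | Q i) l i.
Proof.
move=> H; elim: r => [|i r IH].
  by rewrite big_nil; under eq_fun do rewrite big_nil; exact: cvg_cst.
rewrite big_cons; under eq_fun do rewrite big_cons.
by case: (Q i) (H i) => [/(_ isT) Hi|//]; exact: cvgM.
Qed.

(** Comparison up to an error tending to 0. *)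
Lemma cvg_close (f g h : nat -> R) (l : R) :
  (\forall n \near \oo, `|f n - g n| <= h n) -> h n @[n --> \oo] --> (0 : R) ->
  g n @[n --> \oo] --> l -> f n @[n --> \oo] --> l.
Proof.
move=> fgh h0 gl.
have d0 : (f n - g n) @[n --> \oo] --> (0 : R).
  apply: (@squeeze_cvgr _ _ _ _ (fun n => - h n) h); [|by rewrite -oppr0; exact: cvgN|by []].
  by apply: filterS fgh => n; rewrite ler_norml.
have -> : f = fun n => (f n - g n) + g n by apply/funext => n; rewrite subrK.
by rewrite -[l]add0r; exact: cvgD.
Qed.

End RealLimits.

Section TauSums.
Variables (R : realType) (tau mtau : nat -> R).
Hypothesis tau_moments : forall q : nat, (0 < q)%N ->
  (M%:R^-1 * \sum_(j < M) tau j ^+ q : R) @[M --> \oo] --> mtau q.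

(** [|t| ^ d <= 1 + t ^ (2 d)], and even moments converge. *)
Lemma tau_abs_bound1 d : exists C, 0 <= C /\ forall M, \sum_(j < M) `|tau j| ^+ d <= C * M%:R.
Proof.
have [->|d0] := posnP d.
  exists 1; split=> // M; rewrite mul1r; under eq_bigr do rewrite expr0.
  by rewrite sumr_const card_ord.
have d2 : (0 < d.*2)%N by rewrite double_gt0.
have /cvg_seq_bounded[B [_ /(_ (B + 1))HB]] : cvgn (fun M =>
    M%:R^-1 * \sum_(j < M) tau j ^+ d.*2 : R).
  by apply/cvg_ex; exists (mtau d.*2); exact: tau_moments.
have {}HB M : `|M%:R^-1 * \sum_(j < M) tau j ^+ d.*2| <= B + 1.
  by apply: HB => //; rewrite ltrDl.
have B0 : 0 <= B + 1 by apply: le_trans (HB 0%N).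
exists (1 + (B + 1)); split=> [|M]; first by rewrite addr_ge0.
apply: (@le_trans _ _ (\sum_(j < M) (1 + tau j ^+ d.*2))).
  apply: ler_sum => j _; have -> : tau j ^+ d.*2 = (`|tau j| ^+ d) ^+ 2.
    by rewrite -exprM muln2 -normrX ger0_norm // -muln2 exprM sqr_ge0.
  by set u := _ ^+ d; have : 0 <= (u - 1) ^+ 2 + u ^+ 2 + 1;
      [rewrite !addr_ge0 ?sqr_ge0|rewrite sqrrB1; lra].
rewrite big_split /= sumr_const card_ord mulrDl mul1r lerD2l.
have [->|M0] := posnP M; first by rewrite big_ord0 mulr0.
have M0' : 0 < M%:R :> R by rewrite ltr0n.
rewrite -ler_pdivrMr // mulrC; apply: le_trans (HB M); exact: ler_norm.
Qed.

Lemma tau_abs_bound q : exists C, 0 <= C /\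
  forall M d, (d <= q)%N -> \sum_(j < M) `|tau j| ^+ d <= C * M%:R.
Proof.
elim: q => [|q [C [C0 HC]]].
  by have [C [C0 H]] := tau_abs_bound1 0; exists C; split=> // M [].
have [C' [C0' H]] := tau_abs_bound1 q.+1.
exists (C + C'); split=> [|M d]; first exact: addr_ge0.
rewrite mulrDl leq_eqVlt => /predU1P[->|dq].
  by apply: le_trans (H M) _; rewrite lerDr mulr_ge0.
by apply: le_trans (HC M d dq) _; rewrite lerDl mulr_ge0.
Qed.

Variables (p s : nat) (c : p.-tuple 'I_p.+1).
Hypothesis p_gt0 : (0 < p)%N.
Hypothesis cC : c \in Cseq s.+1 p.

Definition block_sum (M : nat) : R :=
  \sum_(a : p.-tuple 'I_M | canon_tuple a == c) \prod_(x <- a) tau x.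

Lemma degree_gt0 (t : 'I_s.+1) : (0 < degree c t.+1)%N.
Proof.
rewrite -(card_block cC) card_gt0; apply/set0Pn.
by have [u <-] := block_surj cC t; exists u; rewrite inE.
Qed.

(** Summing over all assignments of letters, injective or not, factors over the
    values of [c]. *)
Lemma sum_lift (M : nat) :
  \sum_(f : {ffun 'I_s.+1 -> 'I_M}) \prod_(x <- lift_tuple c f) tau x =
  \prod_(t < s.+1) \sum_(j < M) tau j ^+ degree c t.+1.
Proof.
rewrite -[RHS](eq_bigr _ (fun t _ => eq_bigr _ (fun j _ =>
    congr1 (GRing.exp _) (card_block cC t)))).
rewrite -(sum_prod_assign (block s c) (fun j : 'I_M => tau j)).
by apply: eq_bigr => f _; rewrite /= big_map big_enum.
Qed.

Lemma block_sum_inj (M : nat) :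
  block_sum M = \sum_(f : {ffun 'I_s.+1 -> 'I_M} | injectiveb f) \prod_(x <- lift_tuple c f) tau x.
Proof.
rewrite /block_sum; symmetry.
rewrite -(big_imset (h := fun f : {ffun 'I_s.+1 -> 'I_M} => lift_tuple c f)
  (fun a : p.-tuple 'I_M => \prod_(x <- a) tau x)) /=; last first.
  by move=> f g _ _ /(lift_tuple_inj cC) fg; apply/ffunP.
apply: eq_bigl => a; apply/imsetP/eqP => [[f /injectiveP fi ->]|Ea]; first exact: canon_lift.
have [f Ef] := lift_surj p_gt0 cC Ea.
exists [ffun t => f t]; last by rewrite Ef; apply: eq_from_tnth => u; rewrite !tnth_mktuple ffunE.
rewrite unfold_in; apply: contraT => ni.
have : (nval a <= s)%N by rewrite Ef; apply: nval_lift; apply: contra ni => /injectiveP H;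
    apply/injectiveP => x y; rewrite !ffunE; exact: H.
have /mem_Cseq[_ nc] := cC.
by rewrite -nval_canon_tuple Ea nc ltnn.
Qed.

(** The words of the non-injective assignments have at most [s] values, one
    less than those counted in [block_sum]. *)
Lemma block_sum_near (C : R) (M : nat) : 0 <= C ->
  (forall d, (d <= p)%N -> \sum_(j < M) `|tau j| ^+ d <= C * M%:R) ->
  `|block_sum M - \prod_(t < s.+1) \sum_(j < M) tau j ^+ degree c t.+1| <=
      (s ^ p)%N%:R * (C * M%:R) ^+ s.
Proof.
move=> C0 HC; rewrite -sum_lift block_sum_inj.
rewrite [X in _ - X](bigID (fun f : {ffun 'I_s.+1 -> 'I_M} =>
    injectiveb f)) /= opprD addrA subrr add0r normrN.
apply: le_trans (ler_norm_sum _ _ _) _.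
apply: le_trans (few_values_sum (p := p) s p_gt0 (w := fun j : 'I_M => `|tau j|) _ HC) => //.
under eq_bigr do rewrite normr_prod.
rewrite (eq_bigl (mem [set f : {ffun 'I_s.+1 -> 'I_M} | ~~ injectiveb f]%SET)); last first.
  by move=> f; rewrite /= inE.
rewrite -(big_imset (h := fun f : {ffun 'I_s.+1 -> 'I_M} => lift_tuple c f)
  (fun a : p.-tuple 'I_M => \prod_(x <- a) `|tau x|)) /=; last first.
  by move=> f g _ _ /(lift_tuple_inj cC) fg; apply/ffunP.
rewrite big_mkcond [leRHS]big_mkcond; apply: ler_sum => a _.
case: imsetP => [[f]|_]; last by case: ifP => // _; apply: prodr_ge0.
by rewrite inE => /nval_lift fs ->; rewrite fs.
Qed.

Lemma block_sum_limit :
  ((M%:R^-1) ^+ s.+1 * block_sum M : R) @[M --> \oo] -->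
  \prod_(t < s.+1) mtau (degree c t.+1).
Proof.
have [C [C0 HC]] := tau_abs_bound p.
pose full M := \prod_(t < s.+1) (M%:R^-1 * \sum_(j < M) tau j ^+ degree c t.+1).
have full_cvg : full M @[M --> \oo] --> \prod_(t < s.+1) mtau (degree c t.+1).
  by apply: cvg_prod_fin => t _; apply: tau_moments; exact: degree_gt0.
apply: (@cvg_close _ _ full (fun M => M%:R^-1 * ((s ^ p)%N%:R * C ^+ s))) full_cvg; last first.
  by rewrite -[0 : R](mul0r ((s ^ p)%N%:R * C ^+ s)); apply: cvgMl; exact: cvg_invn.
apply: nearW => M; have [->|M0] := posnP M.
  rewrite /full invr0 mul0r exprS !mul0r big_ord_recl mul0r mul0r subrr normr0 //.
have M0' : M%:R != 0 :> R by rewrite pnatr_eq0 -lt0n.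
have -> : full M = M%:R^-1 ^+ s.+1 * \prod_(t < s.+1) \sum_(j < M) tau j ^+ degree c t.+1.
  by rewrite /full big_split /= prodr_const card_ord.
rewrite -mulrBr normrM ger0_norm ?exprn_ge0 // ?invr_ge0 //.
apply: le_trans (ler_wpM2l _ (block_sum_near C0 (HC M))) _; first by rewrite exprn_ge0 // invr_ge0.
rewrite exprMn exprS -mulrA ler_wpM2l ?invr_ge0 // mulrCA ler_wpM2l // mulrCA -exprMn mulVf //.
by rewrite expr1n mulr1.
Qed.

End TauSums.

(** * Mean and variance of the trace *)

(** The sum on the right runs over a larger set of nonnegative terms. *)
Lemma ler_sum_inj (K : numDomainType) (I J : finType) (F : I -> K) (h : J -> I) :
  injective h -> (forall x, 0 <= F x) -> \sum_y F (h y) <= \sum_x F x.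
Proof.
move=> hi F0; rewrite [leRHS](bigID (mem (h @: [set: J]%SET))) /=.
rewrite -[leLHS]addr0; apply: lerD; last exact: sumr_ge0.
rewrite (big_imset (fun x => F x)) /=; last by move=> x y _ _; apply: hi.
by rewrite le_eqVlt; apply/orP; left; apply/eqP; apply: eq_bigl => x; rewrite inE.
Qed.

Section SpectralMoment.
Context (R : realType) (d0 : measure_display) (T0 : measurableType d0) (P0 : probability T0 R)
  (xi : T0 -> R[i]) (xi_rv : is_crv xi) (xi_int : cintegrable P0 xi)
  (xi_centered : cexpectation P0 xi = 0) (xi_mod1 : {ae P0, forall w, `|xi w| = 1})
  (d : measure_display) (T : measurableType d) (P : probability T R)
  (n m k : nat) (X : 'I_m -> 'I_k -> 'I_n -> T -> R[i])
  (X_iid : iid_copies P0 xi P (fun t : 'I_m * 'I_k * 'I_n => X t.1.1 t.1.2 t.2)).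
Variables (tau : nat -> R) (p : nat).
Hypothesis n_gt0 : (0 < n)%N.
Hypothesis p_gt0 : (0 < p)%N.

Local Notation E := (cexpectation P).
Local Notation nu := (n%:R^-1 : R).
Local Notation invN := ((n ^ k)%N%:R^-1 : R).

Definition weight (s : seq 'I_m) : R := \prod_(b <- s) tau b.
Definition abs_weight (s : seq 'I_m) : R := \prod_(b <- s) `|tau b|.

Lemma norm_weight s : `|weight s| = abs_weight s.
Proof. exact: normr_prod. Qed.

Lemma abs_weight_ge0 s : 0 <= abs_weight s.
Proof. exact: prodr_ge0. Qed.

Definition trace_moment (w : T) : R[i] :=
  invN%:C * \sum_(a : p.-tuple 'I_m) (weight a)%:C * cyclic (yentry X w) a.

Lemma invN_nu : invN = nu ^+ k.
Proof. by rewrite natrX exprVn. Qed.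

Lemma invN_ge0 : 0 <= invN. Proof. by rewrite invr_ge0. Qed.

(** The normalization [n ^ - k] compensates the factor [n] of the [k] tensor
    factors. *)
Lemma invN_pow (D : R) s : invN * (D * (n%:R * nu ^+ s)) ^+ k = D ^+ k * invN ^+ s.
Proof.
rewrite invN_nu exprMn mulrCA; congr (_ * _).
rewrite exprMn mulrA -exprMn [nu * _]mulrC natr_nu // expr1n mul1r.
by rewrite -!exprM mulnC.
Qed.

Lemma bm_term a : bounded_mfun (fun w => (weight a)%:C * cyclic (yentry X w) a).
Proof. by apply: bmZ; apply: bm_cyclic X_iid _. Qed.

Lemma bm_trace_moment : bounded_mfun trace_moment.
Proof. by apply: bmZ; apply: bm_sum => a _; exact: bm_term. Qed.

Lemma cE_trace_moment : E trace_moment =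
  invN%:C * \sum_(a : p.-tuple 'I_m) (weight a)%:C * E (fun w => cyclic (yentry X w) a).
Proof.
rewrite /trace_moment cEZ; last by apply: bm_sum => a _; exact: bm_term.
rewrite cE_sum => [|a]; last exact: bm_term.
by congr (_ * _); apply: eq_bigr => a _; rewrite cEZ //; apply: bm_cyclic X_iid _.
Qed.

(** The main term of the mean: only planar words are kept, for which the
    [k]-th power of the moment is explicit. *)
Definition noncrossing_sum : R := \sum_(1 <=
    s < p.+1) \sum_(c in Cseq1 s p) invN ^+ s * block_sum tau c m.

Lemma Cseq1_nval (A : eqType) (a : p.-tuple A) s : canon_tuple a \in Cseq1 s p -> nval a = s.
Proof.
rewrite inE => /andP[/mem_Cseq[_ <-] _]; symmetry; exact: nval_canon_tuple.
Qed.

Lemma noncrossing_sumE : noncrossing_sum =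
  \sum_(a : p.-tuple 'I_m | canon_tuple a \in Cseq1 (nval a) p) invN ^+ nval a * weight a.
Proof.
rewrite /noncrossing_sum.
transitivity (\sum_(1 <= s < p.+1) \sum_(a : p.-tuple 'I_m | canon_tuple a \in Cseq1 s p) invN ^+
    s * weight a).
  apply: eq_bigr => s _.
  rewrite [RHS](partition_big (fun a => canon_tuple a) (mem (Cseq1 s p))) //=.
  apply: eq_bigr => c cC; rewrite mulr_sumr; apply: eq_bigl => a.
  by case: eqP => [->|]; rewrite ?cC ?andbF.
under eq_bigr do rewrite big_mkcond.
rewrite exchange_big /= [RHS]big_mkcond; apply: eq_bigr => a _.
have a0 := nval_gt0 a p_gt0; have ap := nval_le a.
rewrite (bigD1_seq (nval a)) ?mem_index_iota ?a0 ?ltnS ?ap ?iota_uniq //=.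
rewrite big1 ?addr0 // => s sa; case: ifP => // /Cseq1_nval E.
by rewrite E eqxx in sa.
Qed.

Definition remainder_bound (q : nat) (x : R) : R := \sum_(s < q.+1) (s ^ q)%N%:R * x ^+ s.

Variable C : R.
Hypothesis tau_C : forall d, (d <= p + p)%N -> \sum_(j < m) `|tau j| ^+ d <= C * m%:R.

Lemma weighted_abs_weight q : (0 < q)%N -> (q <= p + p)%N ->
  \sum_(g : q.-tuple 'I_m) abs_weight g * invN ^+ nval g <= remainder_bound q (invN * (C * m%:R)).
Proof.
move=> q0 qp; apply: (weighted_sum (w := fun j : 'I_m => `|tau j|) q0 invN_ge0) => [//|e eq].
by apply: tau_C; apply: leq_trans eq qp.
Qed.

(** Planar words contribute the main term exactly; each thin word loses a
    factor [(C / n) ^ k]. *)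
Lemma mean_close : nc (E trace_moment - noncrossing_sum%:C) <=
  ((p ^ p)%N%:R * nu) ^+ k * remainder_bound p (invN * (C * m%:R)).
Proof.
rewrite cE_trace_moment noncrossing_sumE mulr_sumr.
rewrite (bigID (fun a : p.-tuple 'I_m => canon_tuple a \in Cseq1 (nval a) p)) /=.
have -> : \sum_(a : p.-tuple 'I_m | canon_tuple a \in Cseq1 (nval a) p)
    invN%:C * ((weight a)%:C * E (fun w => cyclic (yentry X w) a)) =
    (\sum_(a : p.-tuple 'I_m | canon_tuple a \in Cseq1 (nval a) p) invN ^+ nval a * weight a)%:C.
  rewrite (rmorph_sum (real_complex R)); apply: eq_bigr => a /(Cseq1_planar p_gt0)[i0 P1].
  rewrite (cE_cyclic xi_rv X_iid).
  rewrite (normalized_planar xi_rv xi_int xi_centered xi_mod1 n_gt0 p_gt0 P1).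
  rewrite -(rmorphXn (real_complex R)) -!(rmorphM (real_complex R)); congr (_%:C).
  have := invN_pow 1 (nval a); rewrite mul1r expr1n mul1r => <-.
  by ring.
rewrite addrAC subrr add0r; apply: le_trans (nc_sum _ _ _) _.
have H0 : 0 <= ((p ^ p)%N%:R * nu) ^+ k by rewrite exprn_ge0 // mulr_ge0 // nu_ge0.
apply: le_trans (ler_wpM2l H0 (weighted_abs_weight p_gt0 (leq_addr p p))).
rewrite mulr_sumr big_mkcond; apply: ler_sum => a _.
case: ifPn => [/(not_Cseq1_thin p_gt0) Ta|_]; last first.
  by rewrite mulr_ge0 // mulr_ge0 ?abs_weight_ge0 // exprn_ge0 // invN_ge0.
rewrite (cE_cyclic xi_rv X_iid) !ncM nc_exp !nc_real norm_weight ger0_norm ?invN_ge0 //.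
rewrite mulrCA [leRHS]mulrCA ler_wpM2l ?abs_weight_ge0 //.
have H1 := normalized_thin xi_rv xi_int xi_centered xi_mod1 n_gt0 p_gt0 Ta.
apply: (@le_trans _ _ (invN * ((p ^ p)%N%:R * nu ^+ nval a) ^+ k)).
  apply: ler_wpM2l; first exact: invN_ge0.
  by apply: lerXn2r; rewrite ?nnegrE ?nc_ge0 // mulr_ge0 // exprn_ge0 // nu_ge0.
rewrite invN_nu !exprMn -[(nu ^+ nval a) ^+ k]exprM -[(nu ^+ k) ^+ nval a]exprM mulnC.
by rewrite mulrCA mulrA.
Qed.

Lemma cE_centered : E (fun w =>
    (trace_moment w - E trace_moment) * conjc (trace_moment w - E trace_moment)) =
  E (fun w => trace_moment w * conjc (trace_moment w)) - E trace_moment * conjc (E trace_moment).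
Proof.
set z := E trace_moment; have bZ := bm_trace_moment.
have bZc : bounded_mfun (fun w => conjc (trace_moment w)) by exact: bm_conj.
have bZZ : bounded_mfun (fun w => trace_moment w * conjc (trace_moment w)) by exact: bmM.
rewrite (eq_cE _ (g := fun w => trace_moment w * conjc (trace_moment w) +
   ((- z) * conjc (trace_moment w) + ((- conjc z) * trace_moment w + z * conjc z)))); last first.
  by move=> w; rewrite rmorphB /=; ring.
have bc : bounded_mfun (fun _ : T => z * conjc z) by exact: bm_cst.
have b1 : bounded_mfun (fun w => (- conjc z) * trace_moment w) by exact: bmZ.
have b2 : bounded_mfun (fun w => (- z) * conjc (trace_moment w)) by exact: bmZ.
rewrite (cED P bZZ (bmD b2 (bmD b1 bc))) (cED P b2 (bmD b1 bc)) (cED P b1 bc).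
rewrite (cEZ P _ bZc) (cEZ P _ bZ) cE_cst (cE_conj P bZ) -/z; ring.
Qed.

Definition covariance_term (a b : p.-tuple 'I_m) : R[i] :=
  E (fun w => cyclic (yentry X w) a * conjc (cyclic (yentry X w) b)) -
  E (fun w => cyclic (yentry X w) a) * conjc (E (fun w => cyclic (yentry X w) b)).

(** The weights are real, so the variance is the weighted sum of the
    covariances. *)
Lemma variance_expand :
  E (fun w => trace_moment w * conjc (trace_moment w)) - E trace_moment * conjc (E trace_moment) =
  \sum_(a : p.-tuple 'I_m) \sum_(b : p.-tuple 'I_m) (invN ^+ 2 * (weight a * weight b))%:C *
      covariance_term a b.
Proof.
have bc (a : p.-tuple 'I_m) := bm_cyclic X_iid a.
have Econj (f g : R[i]) (r s : R) : (r%:C * f) * conjc (s%:C * g) = (r * s)%:C * (f * conjc g).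
  case: f g => [f1 f2] [g1 g2]; apply/eqP; rewrite eq_complex /=.
  by apply/andP; split; apply/eqP; ring.
have expand (f : p.-tuple 'I_m -> R[i]) :
    (invN%:C * \sum_(a : p.-tuple 'I_m) (weight a)%:C * f a) *
      conjc (invN%:C * \sum_(a : p.-tuple 'I_m) (weight a)%:C * f a) =
    \sum_(a : p.-tuple 'I_m) \sum_(b : p.-tuple 'I_m) (invN ^+ 2 * (weight a * weight b))%:C * (f
        a * conjc (f b)).
  rewrite !mulr_sumr rmorph_sum /= mulr_suml; apply: eq_bigr => a _.
  rewrite mulr_sumr; apply: eq_bigr => b _.
  rewrite !mulrA -!(rmorphM (real_complex R)) Econj mulrA; congr ((_ %:C) * _ * _).
  by ring.
rewrite cE_trace_moment expand.
rewrite (eq_cE _ (g := fun w => \sum_(a : p.-tuple 'I_m) \sum_(b : p.-tuple 'I_m)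
   (invN ^+ 2 * (weight a * weight b))%:C * (cyclic (yentry X w) a * conjc (cyclic (yentry X w)
       b)))); last first.
  by move=> w; rewrite -expand.
have bab (a b : p.-tuple 'I_m) : bounded_mfun (fun w =>
    (invN ^+ 2 * (weight a * weight b))%:C * (cyclic (yentry X w) a * conjc (cyclic (yentry X w)
        b))).
  by apply: bmZ; apply: bmM; [exact: bm_cyclic X_iid _|exact: bm_conj (bm_cyclic X_iid _)].
rewrite cE_sum => [|a]; last by apply: bm_sum => b _; exact: bab.
rewrite -sumrB; apply: eq_bigr => a _.
rewrite cE_sum => [|b]; last exact: bab.
rewrite -sumrB; apply: eq_bigr => b _.
rewrite cEZ ?mulrBr //.
by apply: bmM; [exact: bc|exact: bm_conj].
Qed.

(** A pair of words is read as one word of length [2 p], whose number of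
    letters governs both the covariance and the sum of the weights. *)
Lemma variance_le :
  nc (E (fun w => (trace_moment w - E trace_moment) * conjc (trace_moment w - E trace_moment))) <=
  2 * ((((p + p) ^ (p + p))%N%:R * nu) ^+ k * remainder_bound (p + p) (invN * (C * m%:R))).
Proof.
rewrite cE_centered variance_expand pair_big /=.
set D := ((p + p) ^ (p + p))%N%:R : R.
have D0 : 0 <= D by exact: ler0n.
pose F (g : (p + p).-tuple 'I_m) := 2 * ((D * nu) ^+ k * (abs_weight g * invN ^+ nval g)).
have F0 g : 0 <= F g.
  by rewrite mulr_ge0 // mulr_ge0 ?exprn_ge0 // ?mulr_ge0 ?nu_ge0 ?abs_weight_ge0 ?exprn_ge0
      ?invN_ge0.
apply: (@le_trans _ _ (\sum_(ab : p.-tuple 'I_m * p.-tuple 'I_m) F (cat_tuple ab.1 ab.2))).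
  apply: le_trans (nc_sum _ _ _) _; apply: ler_sum => -[a b] _; rewrite -[(a, b).1]/a -[(a, b).2]/b.
  rewrite ncM nc_real normrM ger0_norm ?exprn_ge0 ?invN_ge0 // normrM !norm_weight.
  have Hc := covariance_le xi_rv xi_int xi_centered xi_mod1 X_iid n_gt0 a b p_gt0.
  rewrite -/(covariance_term a b) in Hc.
  have ab0 : 0 <= abs_weight a * abs_weight b by rewrite mulr_ge0 ?abs_weight_ge0.
  have nab0 : 0 <= invN ^+ 2 * (abs_weight a * abs_weight b) by rewrite mulr_ge0 // exprn_ge0 //
      invN_ge0.
  apply: le_trans (ler_wpM2l nab0 Hc) _.
  rewrite /F /covariance_bound -/D.
  have -> : abs_weight (cat_tuple a b) = abs_weight a * abs_weight b by rewrite /abs_weight big_cat.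
  have := invN_pow D (nval (a ++ b)); set Y := (_ * (n%:R * _)) ^+ k => HY.
  have -> : invN ^+ 2 * (abs_weight a * abs_weight b) * (2 * Y) =
      2 * (abs_weight a * abs_weight b) * (invN * (invN * Y)) by ring.
  rewrite HY exprMn -invN_nu /=.
  by rewrite le_eqVlt; apply/orP; left; apply/eqP; ring.
apply: (@le_trans _ _ (\sum_g F g)).
  apply: (@ler_sum_inj _ _ _ F (fun ab : p.-tuple 'I_m * p.-tuple 'I_m =>
      cat_tuple ab.1 ab.2)) => //.
  move=> [a b] [a' b'] /(congr1 val)/= /eqP; rewrite eqseq_cat ?size_tuple // =>
      /andP[/eqP aa /eqP bb].
  by congr pair; apply: val_inj.
rewrite -mulr_sumr ler_pM2l // -mulr_sumr ler_wpM2l ?exprn_ge0 ?mulr_ge0 ?nu_ge0 //.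
by apply: weighted_abs_weight; rewrite ?addn_gt0 ?p_gt0.
Qed.

End SpectralMoment.

(** * Almost sure convergence *)

(** Telescoping: [1 / (i + 2) ^ 2 <= 1 / (i + 1) - 1 / (i + 2)]. *)
Lemma sum_invsq (R : realType) N : \sum_(0 <= i < N) ((i.+2%:R^-1) ^+ 2 : R) <= 1 - N.+1%:R^-1.
Proof.
elim: N => [|N IH]; first by rewrite big_nil invr1 subrr.
rewrite big_nat_recr //=; apply: le_trans (lerD IH (lexx _)) _.
have a0 : 0 < N.+1%:R :> R by rewrite ltr0n.
have -> : N.+2%:R = N.+1%:R + 1 :> R by rewrite -natr1.
set a := N.+1%:R in a0 *.
have a1 : 0 < a + 1 by rewrite addr_gt0.
rewrite -subr_ge0 (_ : _ - _ = a^-1 * (a + 1)^-1 ^+ 2); last by field; rewrite !gt_eqF.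
by rewrite mulr_ge0 ?exprn_ge0 // invr_ge0 ltW.
Qed.

(** The series of the [f n] has a finite integral, so it converges almost
    everywhere and its terms tend to 0. *)
Lemma ae_cvg0 (R : realType) (d : measure_display) (T : measurableType d) (P : probability T R)
    (f : nat -> T -> R) (K : R) :
  (forall n, measurable_fun setT (f n)) -> (forall n w, 0 <= f n w) ->
  (\forall n \near \oo, (\int[P]_w (f n w)%:E <= (K * n%:R^-1 ^+ 2)%:E)%E) ->
  {ae P, forall w, f n w @[n --> \oo] --> (0 : R)}.
Proof.
move=> mf f0 [n0 _ Hn0].
(* The shift makes the bound hold for all terms, with summable right-hand
   sides [K / (n + 2) ^ 2]. *)
pose g n w := f (n + n0.+2)%N w.
have K0 : 0 <= K.
  have := Hn0 n0.+1 (leqnSn _) => H.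
  have : 0 <= K * n0.+1%:R^-1 ^+ 2.
    rewrite -lee_fin; apply: le_trans H; apply: integral_ge0 => w _; rewrite lee_fin; exact: f0.
  by rewrite pmulr_lge0 // exprn_gt0 // invr_gt0 ltr0n.
have ig n : (\int[P]_w (g n w)%:E <= (K * n.+2%:R^-1 ^+ 2)%:E)%E.
  apply: le_trans (Hn0 (n + n0.+2)%N _) _ => /=; first by lia.
  rewrite lee_fin ler_wpM2l // lerXn2r ?nnegrE ?invr_ge0 //.
  by rewrite lef_pV2 ?posrE ?ltr0n //; [rewrite ler_nat; lia|lia].
have mg n : measurable_fun setT (fun w => (g n w)%:E) by apply/measurable_EFinP; exact: mf.
have g0 n w : (0 <= (g n w)%:E)%E by rewrite lee_fin; exact: f0.
pose G w := (\sum_(0 <= n <oo) (g n w)%:E)%E.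
have G0 w : (0 <= G w)%E by apply: nneseries_ge0 => n _ _.
have mG : measurable_fun setT G.
  by apply: (@ge0_emeasurable_sum _ _ _ setT (fun n w => (g n w)%:E) predT) => [n w _ _|n _].
have iG : (\int[P]_w G w < +oo)%E.
  rewrite /G integral_nneseries //.
  apply: (@le_lt_trans _ _ K%:E); last exact: ltry.
  apply: lime_le; first by apply: is_cvg_nneseries => n _ _; apply: integral_ge0 => w _; exact: g0.
  apply: nearW => N; apply: (@le_trans _ _ (\sum_(0 <= i < N) (K * i.+2%:R^-1 ^+ 2)%:E)%E).
    by apply: lee_sum => n _; exact: ig.
  rewrite sumEFin lee_fin -mulr_sumr -[leRHS]mulr1 ler_wpM2l //.
  by apply: le_trans (sum_invsq R N) _; rewrite lerBlDr lerDl invr_ge0.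
have intG : P.-integrable setT G.
  apply/integrableP; split=> //.
  by rewrite (eq_integral G) // => w _; rewrite gee0_abs.
have := integrable_ae measurableT intG; apply: filterS => w /(_ I) finG.
rewrite -(cvg_shiftn n0.+2).
apply: (@cvg_series_cvg_0 _ _ (fun n => g n w)).
apply: nondecreasing_is_cvgn.
  by apply: nondecreasing_series => n _ _; have := g0 n w; rewrite lee_fin.
exists (fine (G w)) => _ [N _ <-].
rewrite -lee_fin fineK // /series /= -sumEFin.
exact: nneseries_lim_ge.
Qed.

Section Limits.
Variable R : realType.

Lemma cvg_complex (z : nat -> R[i]) (L : R[i]) (h : nat -> R) :
  (\forall n \near \oo, nc (L - z n) <= h n) -> h n @[n --> \oo] --> (0 : R) ->
  (z n : (R[i])^o) @[n --> \oo] --> (L : (R[i])^o).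
Proof.
move=> zh h0; apply/cvgrPdist_lt => e e0.
have [r Er] : exists r : R, e = r%:C.
  by exists (complex.Re e); rewrite RRe_real // ger0_real // ltW.
rewrite Er ltcR in e0.
have /cvgr0Pnorm_lt/(_ _ e0) hr := h0.
near=> n.
rewrite nc_norm Er ltcR; apply: le_lt_trans (_ : h n < r); first by near: n.
apply: le_lt_trans (ler_norm _) _; near: n; exact: hr.
Unshelve. all: by end_near. Qed.

Lemma cvg0_of_sqr (u : nat -> R) : (forall n, 0 <= u n) ->
  (u n ^+ 2) @[n --> \oo] --> (0 : R) -> u n @[n --> \oo] --> (0 : R).
Proof.
move=> u0 H; rewrite -[0 : R]sqrtr0.
rewrite (_ : u = fun n => Num.sqrt (u n ^+ 2)); last first.
  by apply/funext => n; rewrite sqrtr_sqr ger0_norm.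
by apply: continuous_cvg => //; exact: sqrt_continuous.
Qed.

End Limits.

Section AlmostSureModulus.
Context (R : realType) (d0 : measure_display) (T0 : measurableType d0) (P0 : probability T0 R)
  (xi : T0 -> R[i]) (xi_rv : is_crv xi) (xi_mod1 : {ae P0, forall w, `|xi w| = 1})
  (d : measure_display) (T : measurableType d) (P : probability T R).

(** Having modulus 1 is a Borel condition, so it depends only on the law. *)
Lemma ae_mod1 (X : T -> R[i]) : is_crv X -> same_law P X P0 xi -> {ae P, forall w, `|X w| = 1}.
Proof.
move=> mX law.
have n1 (z : R[i]) : (`|z| = 1) <-> ((reim z).1 ^+ 2 + (reim z).2 ^+ 2 = 1).
  rewrite nc_norm /reim /= -nc_sqr; split=> [[->]|/eqP H]; first exact: expr1n.
  by rewrite sqrp_eq1 ?nc_ge0 // in H; rewrite (eqP H).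
pose B := [set u : R * R | u.1 ^+ 2 + u.2 ^+ 2 != 1].
have mB : measurable B.
  rewrite (_ : B = (fun u : R * R => u.1 ^+ 2 + u.2 ^+ 2 == 1) @^-1` [set false]); last first.
    by apply/seteqP; split=> u /=; [move=> /negbTE|move=> /negbT].
  rewrite -[X in measurable X]setTI; apply: measurable_fun_eqr => //.
  by apply: measurable_funD; apply: measurable_funX; [exact: measurable_fst|exact: measurable_snd].
have mp d' (T' : measurableType d') (Y : T' -> R[i]) : is_crv Y -> measurable ((reim \o Y) @^-1` B).
  by move=> mY; rewrite -[X in measurable X]setTI; apply: mY.
have E d' (T' : measurableType d') (Y : T' -> R[i]) :
    ~` [set w | `|Y w| = 1] = (reim \o Y) @^-1` B.
  by apply/seteqP; split=> w /= H; [apply/eqP => H1|move=> /n1 H1]; [apply: H;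
      apply/n1|move/eqP: H].
have : P0 ((reim \o xi) @^-1` B) = 0.
  apply/negligibleP; first exact: mp.
  by apply: negligibleS xi_mod1; rewrite -E.
rewrite -law // => PB.
have PN : P.-negligible ((reim \o X) @^-1` B) by apply/negligibleP; first exact: mp.
by apply: negligibleS PN; rewrite -E.
Qed.

End AlmostSureModulus.

(** * The limit of the moments *)

Lemma near_ge (u : nat -> nat) j : u n @[n --> \oo] --> \oo -> \forall n \near \oo, (j <= u n)%N.
Proof.
move=> uoo; have H : (u n @[n --> \oo]) [set M | (j <= M)%N] by apply: uoo; exists j.
exact: H.
Qed.

Section NoncrossingLimit.
Variables (R : realType) (tau mtau : nat -> R) (k m : nat -> nat) (c : R) (p : nat).
Hypothesis tau_moments : forall q : nat, (0 < q)%N ->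
  (M%:R^-1 * \sum_(j < M) tau j ^+ q : R) @[M --> \oo] --> mtau q.
Hypothesis m_infty : m n @[n --> \oo] --> \oo.
Hypothesis m_ratio : ((m n)%:R / (n ^ k n)%:R : R) @[n --> \oo] --> c.
Hypothesis p_gt0 : (0 < p)%N.

Lemma noncrossing_sum_limit :
  noncrossing_sum n (m n) (k n) tau p @[n --> \oo] -->
  (\sum_(1 <= s < p.+1) c ^+ s *
        \sum_(a in Cseq1 s p) \prod_(1 <= t < s.+1) mtau (degree a t)).
Proof.
rewrite big_add1 /= big_mkord.
rewrite (_ : (fun n => _) = fun n => \sum_(s < p) \sum_(a in Cseq1 s.+1 p)
    (n ^ k n)%N%:R^-1 ^+ s.+1 * block_sum tau a (m n)); last first.
  by apply/funext => n; rewrite /noncrossing_sum big_add1 big_mkord.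
apply: cvg_sum_fin => s _; rewrite mulr_sumr; apply: cvg_sum_fin => a aC1.
have aC : a \in Cseq s.+1 p by move: aC1; rewrite inE => /andP[].
rewrite big_add1 /= big_mkord.
have cexp : ((m n)%:R / (n ^ k n)%:R : R) ^+ s.+1 @[n --> \oo] --> c ^+ s.+1.
  rewrite (_ : (fun n => _) = fun n => \prod_(i < s.+1) ((m n)%:R / (n ^ k n)%:R : R)); last first.
    by apply/funext => n; rewrite prodr_const card_ord.
  rewrite (_ : c ^+ s.+1 = \prod_(i < s.+1) c); last by rewrite prodr_const card_ord.
  by apply: cvg_prod_fin => i _.
have bl := cvg_comp _ _ m_infty (block_sum_limit tau_moments p_gt0 aC).
apply: (@cvg_close _ _ _ (fun=> 0)) (cvgM cexp bl); last exact: cvg_cst.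
have : \forall n \near \oo, (0 < m n)%N by exact: near_ge m_infty.
apply: filterS => n m0 /=.
have m0' : (m n)%:R != 0 :> R by rewrite pnatr_eq0 -lt0n.
rewrite mulrA -exprMn mulrAC mulfV // mul1r subrr normr0 //.
Qed.

End NoncrossingLimit.

Lemma remainder_bound_mono (R : realType) q (x y : R) : 0 <= x -> x <= y ->
  remainder_bound q x <= remainder_bound q y.
Proof.
move=> x0 xy; apply: ler_sum => s _; rewrite ler_wpM2l // lerXn2r // nnegrE //.
exact: le_trans x0 xy.
Qed.

Lemma remainder_bound_ge0 (R : realType) q (x : R) : 0 <= x -> 0 <= remainder_bound q x.
Proof. by move=> x0; apply: sumr_ge0 => s _; rewrite mulr_ge0 // exprn_ge0. Qed.

Theorem theorem1p2 (R : realType)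
  (d0 : measure_display) (T0 : measurableType d0) (P0 : probability T0 R)
  (xi : T0 -> R[i])
  (xi_rv : is_crv xi)
  (xi_int : cintegrable P0 xi)
  (xi_centered : cexpectation P0 xi = 0)
  (xi_var : cvariance P0 xi = 1%E)
  (xi_mod1 : {ae P0, forall w, `|xi w| = 1})
  (d : measure_display) (T : measurableType d) (P : probability T R)
  (k m : nat -> nat)
  (X : forall n : nat, 'I_(m n) -> 'I_(k n) -> 'I_n -> T -> R[i])
  (X_iid : forall n : nat,
     iid_copies P0 xi P
       (fun alj : 'I_(m n) * 'I_(k n) * 'I_n =>
          X n alj.1.1 alj.1.2 alj.2))
  (tau mtau : nat -> R)
  (tau_moments : forall q : nat, (0 < q)%N ->
     (M%:R^-1 * \sum_(j < M) tau j ^+ q : R) @[M --> \oo] --> mtau q)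
  (k_infty : k n @[n --> \oo] --> \oo)
  (m_infty : m n @[n --> \oo] --> \oo)
  (c : R) (c_gt0 : 0 < c)
  (m_ratio : ((m n)%:R / (n ^ k n)%:R : R) @[n --> \oo] --> c)
  (p : nat) (p_ge1 : (1 <= p)%N) :
  {ae P, forall w,
    ((n ^ k n)%:R^-1 *
       \tr (Mmx tau (fun a l j => X n a l j w) ^+ p) : (R[i])^o)
      @[n --> \oo] -->
    ((\sum_(1 <= s < p.+1) c ^+ s *
        \sum_(a in Cseq1 s p) \prod_(1 <= t < s.+1) mtau (degree a t))%:C
      : (R[i])^o)}.
Proof.
have [C [C0 HC]] := tau_abs_bound tau_moments (p + p).
pose Z n := trace_moment (X n) tau p.
pose z n := cexpectation P (Z n).
pose main n := noncrossing_sum n (m n) (k n) tau p.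
pose D : R := ((p + p) ^ (p + p))%N%:R.
pose x0 := C * (c + 1).
have c1 : 0 <= c + 1 by rewrite addr_ge0 // ltW.
have x00 : 0 <= x0 by rewrite mulr_ge0.
have Dp : (p ^ p)%N%:R <= D :> R.
  by rewrite ler_nat; apply: leq_trans (_ : (p + p) ^ p <= _)%N;
    [rewrite leq_exp2r // leq_addr|rewrite leq_exp2l ?leq_addr //; lia].
have D0 : 0 <= D by exact: ler0n.
(* [k n >= 2] makes the variance summable; the last condition bounds the
   argument of [remainder_bound] uniformly in [n]. *)
have near_n : \forall n \near \oo, [/\ (0 < n)%N, (2 <= k n)%N, D * n%:R^-1 <= 1 &
    (n ^ k n)%N%:R^-1 * (C * (m n)%:R) <= x0].
  have n1 : \forall n \near \oo, (0 < n)%N by exists 1%N.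
  have k2 : \forall n \near \oo, (2 <= k n)%N by exact: near_ge k_infty.
  have Dn : \forall n \near \oo, D * n%:R^-1 <= 1.
    exists ((p + p) ^ (p + p)).+1 => // n /= Hn.
    by rewrite ler_pdivrMr ?mul1r ?ltr0n ?ler_nat; lia.
  have mr : \forall n \near \oo, (m n)%:R / (n ^ k n)%:R < c + 1 :> R.
    by apply: (cvgr_lt c m_ratio); rewrite ltrDl.
  near=> n; split; [by near: n|by near: n|by near: n|].
  rewrite mulrCA ler_wpM2l // mulrC ltW //; near: n; exact: mr.
have pown (u : R) j : 0 <= u -> u <= 1 -> (0 < j)%N -> u ^+ j <= u.
  by case: j => // j u0 u1 _; rewrite exprS ler_piMr // exprn_ile1.
have pow2 (u : R) j : 0 <= u -> u <= 1 -> (2 <= j)%N -> u ^+ j <= u ^+ 2.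
  by move=> u0 u1 j2; rewrite -(subnK j2) exprD ler_piMl ?exprn_ge0 // exprn_ile1.
have mean_err : \forall n \near \oo, nc (z n - (main n)%:C) <= (D * remainder_bound p x0) * n%:R^-1.
  apply: filterS near_n => n [n0 k2 Dn xn].
  have Hn := mean_close xi_rv xi_int xi_centered xi_mod1 (X_iid n) n0 p_ge1 (HC (m n)).
  apply: le_trans Hn _.
  have nu0 : 0 <= n%:R^-1 :> R by rewrite invr_ge0.
  have x1 : 0 <= (n ^ k n)%N%:R^-1 * (C * (m n)%:R) by rewrite !mulr_ge0 // invr_ge0.
  rewrite mulrAC; apply: ler_pM; rewrite ?exprn_ge0 ?mulr_ge0 ?remainder_bound_ge0 //.
    apply: le_trans (_ : D * n%:R^-1 <= _) => //.
    apply: le_trans (_ : (D * n%:R^-1) ^+ k n <= _).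
      by rewrite lerXn2r ?nnegrE ?mulr_ge0 // ler_wpM2r.
    by apply: pown; rewrite ?mulr_ge0 // ltnW.
  exact: remainder_bound_mono.
have bmZ n : bounded_mfun (Z n) by exact: bm_trace_moment (X_iid n) _ _.
have bmc n : bounded_mfun (fun w => (Z n w - z n) * conjc (Z n w - z n)).
  have bc : bounded_mfun (fun w => Z n w - z n) by apply: bmD => //; exact: bm_cst.
  by apply: bmM => //; exact: bm_conj.
have sqE n w : nc (Z n w - z n) ^+ 2 = complex.Re ((Z n w - z n) * conjc (Z n w - z n)).
  by rewrite mulrC conj_mul.
have var_err : \forall n \near \oo,
    (\int[P]_w (nc (Z n w - z n) ^+ 2)%:E <=
        ((2 * D ^+ 2 * remainder_bound (p + p) x0) * n%:R^-1 ^+ 2)%:E)%E.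
  apply: filterS near_n => n [n0 k2 Dn xn].
  have Hn := variance_le xi_rv xi_int xi_centered xi_mod1 (X_iid n) n0 p_ge1 (HC (m n)).
  have nu0 : 0 <= n%:R^-1 :> R by rewrite invr_ge0.
  have x1 : 0 <= (n ^ k n)%N%:R^-1 * (C * (m n)%:R) by rewrite !mulr_ge0 // invr_ge0.
  under eq_integral do rewrite sqE.
  rewrite -[leLHS]fineK; last first.
    by apply: integrable_fin_num => //; exact: bm_integrable_Re.
  rewrite lee_fin; apply: le_trans (_ : nc (cexpectation P (fun w =>
      (Z n w - z n) * conjc (Z n w - z n))) <= _).
    by apply: le_trans (nc_Re _); rewrite cexpectationE; exact: ler_norm.
  apply: le_trans Hn _.
  rewrite -/D (_ : 2 * D ^+ 2 * _ * _ = 2 * ((D * n%:R^-1) ^+ 2 * remainder_bound (p + p) x0)).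
    rewrite ler_pM2l // ler_pM ?exprn_ge0 ?mulr_ge0 ?remainder_bound_ge0 //.
      by apply: pow2; rewrite ?mulr_ge0.
    exact: remainder_bound_mono.
  by rewrite exprMn; set u := n%:R^-1 ^+ 2; ring.
have dev0 : {ae P, forall w, (nc (Z n w - z n)) @[n --> \oo] --> (0 : R)}.
  have := ae_cvg0 (f := fun n w => nc (Z n w - z n) ^+ 2) _ _ var_err.
  have mf n : measurable_fun setT (fun w => nc (Z n w - z n) ^+ 2).
    by rewrite (_ : (fun w => _) = fun w => complex.Re ((Z n w - z n) * conjc (Z n w - z n)));
      [have [H _ _] := bmc n|apply/funext => w; exact: sqE].
  move=> /(_ mf (fun n w => sqr_ge0 _)); apply: filterS => w.
  by apply: cvg0_of_sqr => n; exact: nc_ge0.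
(* Off a null set all the entries, for all [n], equal their unitized
   versions. *)
have mod1 : {ae P, forall w, forall n, forall t : 'I_(m n) * 'I_(k n) * 'I_n,
    `|X n t.1.1 t.1.2 t.2 w| = 1}.
  apply: ae_foralln => n; apply: filter_forall => t.
  have [mX law _] := X_iid n.
  exact: (ae_mod1 xi_rv xi_mod1 (mX t) (law t)).
have main_lim : main n @[n --> \oo] --> \sum_(1 <= s < p.+1) c ^+ s *
    \sum_(a in Cseq1 s p) \prod_(1 <= t < s.+1) mtau (degree a t).
  exact: noncrossing_sum_limit.
set L := \sum_(1 <= s < p.+1) _ in main_lim *.
apply: filterS2 dev0 mod1 => w dw modw.
have ZE n : (n ^ k n)%:R^-1 * \tr (Mmx tau (fun a l j => X n a l j w) ^+ p) = Z n w.
  rewrite trace_expansion // /Z /trace_moment; congr (_ * _).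
    by rewrite (fmorphV (real_complex R)) (rmorph_nat (real_complex R)).
  apply: eq_bigr => a _; congr (_ * _); congr cyclic.
  apply/funext => e; apply/funext => l; apply/funext => j; rewrite /yentry unitize_id //.
  exact: (modw n (e, l, j)).
rewrite (_ : (fun n => _) = fun n => Z n w); last by apply/funext => n; exact: ZE.
apply: (@cvg_complex _ _ _ (fun n =>
    `|L - main n| + (D * remainder_bound p x0) * n%:R^-1 + nc (Z n w - z n))).
  apply: filterS mean_err => n Hn.
  have -> : L%:C - Z n w = (L - main n)%:C + (- (z n - (main n)%:C)) + (- (Z n w - z n)).
    by rewrite (rmorphB (real_complex R)); ring.
  apply: le_trans (ncD _ _) _; rewrite normcN lerD2r.
  by apply: le_trans (ncD _ _) _; rewrite normcN nc_real lerD2l.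
rewrite -[0 : R]addr0; apply: cvgD => //; rewrite -[0 : R]addr0; apply: cvgD.
  have H : (L - main n) @[n --> \oo] --> (0 : R).
    by rewrite -(subrr L); apply: cvgB => //; exact: cvg_cst.
  by have := cvg_norm H; rewrite normr0; exact.
by rewrite -[0 : R](mulr0 (D * remainder_bound p x0)); apply: cvgMr; exact: cvg_invn.
Unshelve. all: by end_near.
Qed.
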